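(* The following are equivalent for a compact set $E\subset\mathbb{T}$: (i) every singular inner function associated with a measure supported on $E$ is a factor of $\mathcal{D}$; (ii) $E$ is a Carleson set.
   Context: $\mathbb{D}$ is the open unit disc in $\mathbb{C}$ and $\mathbb{T}$ the unit circle. The Dirichlet space $\mathcal{D}$ is the space of analytic functions $f$ on $\mathbb{D}$ with $\int_{\mathbb{D}}|f'|^2\,dA<\infty$ ($A$ normalized area measure); it is contained in the Hardy space $H^2$. For a positive finite Borel measure $\mu$ on $\mathbb{T}$ singular with respect to Lebesgue measure, the associated singular inner function is $S_\mu(z)=\exp\left(-\int_{\mathbb{T}}\frac{w+z}{w-z}\,d\mu(w)\right)$. An inner function $I$ is a factor of $\mathcal{D}$ if it occurs as the inner factor of some non-zero function in $\mathcal{D}$, i.e. if $IH^2\cap\mathcal{D}\neq(0)$. A compact set $E\subset\mathbb{T}$ is a Carleson set if $\int_{\mathbb{T}}\log\left(\frac{1}{\operatorname{dist}(z,E)}\right)|dz|<\infty$. *)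

(* Defs.v *)
From HB Require Import structures.
From mathcomp Require Import all_boot all_order all_algebra.
From mathcomp Require Import complex.
From mathcomp Require Import all_classical all_reals all_analysis.

Set Implicit Arguments.
Unset Strict Implicit.
Unset Printing Implicit Defensive.

Import Order.TTheory GRing.Theory Num.Theory.
Import numFieldNormedType.Exports.
Import ComplexField.Normc.

Local Open Scope classical_set_scope.
Local Open Scope ring_scope.
Local Open Scope complex_scope.

(* R[i] carries the metric topology of its own modulus. *)
#[warning="-redundant-canonical-projection"]
HB.instance Definition _ (R : realType) := NormedModule.copy R[i] R[i]^o.

Definition borelC (R : realType) := g_sigma_algebraType (@open R[i]).

Section Definitions.
Context {R : realType}.
Implicit Types (z w : R[i]) (f h I : R[i] -> R[i]) (E : set R[i]).

Definition disc : set R[i] := [set z | `|z| < 1].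

Definition circle : set R[i] := [set z | `|z| = 1].

Definition expC z : R[i] := (expR (complex.Re z))%:C * (cos (complex.Im z) +i* sin (complex.Im z)).

Definition expi (t : R) : R[i] := expC (0 +i* t).

(* Functions on the disc are total functions on R[i], of which only the values
   on the disc matter. *)
Definition analytic_disc f := forall z, disc z -> derivable f z 1.

Definition dirichlet_integral f : \bar R :=
  ((pi^-1 : R)%:E *
   \int[lebesgue_measure \x lebesgue_measure]_(p in
       [set p : R * R | disc (p.1 +i* p.2)])
     (normc (derive1 f (p.1 +i* p.2)) ^+ 2)%:E)%E.

Definition dirichlet_space f :=
  analytic_disc f /\ (dirichlet_integral f < +oo)%E.

Definition hardy_mean f (r : R) : \bar R :=
  (((2 * pi)^-1 : R)%:E *
   \int[lebesgue_measure]_(t in `[0%R, (2 * pi)%R])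
     (normc (f (r%:C * expi t)) ^+ 2)%:E)%E.

Definition hardy2 f :=
  analytic_disc f /\
  (ereal_sup [set hardy_mean f r | r in [set r | (0 <= r < 1)%R]] < +oo)%E.

(* I H^2 meets the Dirichlet space in more than the zero function. *)
Definition is_factor I :=
  exists f, [/\ dirichlet_space f,
                exists2 z, disc z & f z != 0 &
                exists2 h, hardy2 h & forall z, disc z -> f z = I z * h z].

(* Lebesgue measure of the circle (total mass 2 pi), as a set function on the
   Borel sets of R[i]. *)
Definition arc_length (A : set (borelC R)) : \bar R :=
  lebesgue_measure [set t : R | 0 <= t < 2 * pi /\ A (expi t)].

Definition singular (mu : set (borelC R) -> \bar R) :=
  exists A : set (borelC R),
    [/\ measurable A, arc_length A = 0%E & mu (~` A) = 0%E].

(* A measure on the circle is a Borel measure on R[i] that is null off the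
   circle; for closed E, the support lies in E iff the complement is null. *)
Definition supported_on (mu : set (borelC R) -> \bar R) E := mu (~` E) = 0%E.

Definition singular_inner (mu : {finite_measure set (borelC R) -> \bar R}) z :
    R[i] :=
  let herglotz w := (w + z) / (w - z) in
  expC (- ((\int[mu]_(w in circle) complex.Re (herglotz w)) +i*
           (\int[mu]_(w in circle) complex.Im (herglotz w)))).

(* Valued in the extended reals, so that the distance to the empty set is
   +oo. *)
Definition dist z E : \bar R := ereal_inf [set (normc (z - w))%:E | w in E].

(* Here inve 0 = +oo and lne 0 = -oo, so the integrand is +oo on (the closure
   of) E and the empty set is a Carleson set. *)
Definition carleson_set E :=
  [/\ compact E, E `<=` circle &
  (\int[lebesgue_measure]_(t in `[0%R, (2 * pi)%R]) lne ((dist (expi t) E)^-1)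
     < +oo)%E].

End Definitions.

(* Main.v *)
(* If [E] is a Carleson set, let [H] be the Herglotz integral of
   [log (4 / dist (., E))] along the curve obtained by pushing each point of the
   circle outwards by its distance to [E]. Then [|exp (- N H)| <= dist (z, E)^2]
   for large [N], while [H'] is at most a constant times [dist (z, E)^-2] since
   the curve stays far from [z] relative to [dist (z, E)]; hence
   [S_mu exp (- N H)] has bounded derivative.
   Conversely, let [mu] be a sum of atoms of masses [n^(-1/2) - (n + 1)^(-1/2)]
   at points of [E] nearly closest to [exp (i log n)]. With [d = dist (z, E)] on
   the circle, [1 - |S_mu (r z)|^2 >= c (1 - r) / sqrt (max d (1 - r))]. If
   [f = S_mu h] is in the Dirichlet space, the means of
   [|h_r|^2 - |f_r|^2 = |h_r|^2 (1 - |S_mu|^2)] are [O (1 - r)], so that those of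
   [|h_r|^2 / sqrt (max d (1 - r))] are bounded. Multiplying [h] by an outer
   function with boundary modulus at most a negative power of [max d e], Cauchy's
   formula at a point where [h] does not vanish bounds the integral of
   [log (1 / max d e)] uniformly in [e], and monotone convergence concludes. *)
Require Import Defs.
From HB Require Import structures.
From mathcomp Require Import all_boot all_order all_algebra.
From mathcomp Require Import complex ring lra.
From mathcomp Require Import all_classical all_reals all_analysis.
From mathcomp Require Import measurable_realfun.
Set Implicit Arguments.
Unset Strict Implicit.
Unset Printing Implicit Defensive.
Import Order.TTheory GRing.Theory Num.Theory.
Import numFieldNormedType.Exports.
Import ComplexField.Normc.
Local Open Scope classical_set_scope.
Local Open Scope ring_scope.
Local Open Scope complex_scope.

(** * Complex modulus, derivative and continuity *)

Section Basics.
Context {R : realType}.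
Implicit Types (z w h l : R[i]) (f g : R[i] -> R[i]).

(** Everything happens on circles of radius r < 1; no function is given boundary values. That |S_mu|
    = 1 on the circle becomes smallness of the mean of 1 - |S_mu|^2 at radii close to 1. The rate
    O(1 - r) comes from Taylor coefficients: the Dirichlet integral bounds the sum of n |a_n|^2, so
    the quadratic mean of f grows by at most a constant times 1 - r between r and 1. The points
    exp(i log n) are dense at every scale at once: each angle and each D admit an n comparable with
    1/D whose point is within D. The mass there is of order D^(3/2) and the Poisson kernel of order
    (1 - r) / D^2 when 1 - r <= D and E is within D; their product gives the square root. So one
    measure tests all scales. The exponent 1/2 is immaterial, as only a logarithm survives. In the
    other direction the density log(4 / dist) is unbounded near E, just where the Herglotz kernel on
    the circle would be singular. Off the circle the kernel is controlled by dist(z, E) alone, and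
    integrability of the density suffices. The push is also small enough for a short arc next to z
    to bound Re H from below. *)

Lemma normcE z : `|z| = (normc z)%:C.
Proof. by case: z. Qed.

Lemma normc_ge0 z : 0 <= normc z.
Proof. by case: z => a b; exact: sqrtr_ge0. Qed.

Lemma normcD z w : normc (z + w) <= normc z + normc w.
Proof. exact: le_normcD. Qed.

Lemma normcN z : normc (- z) = normc z.
Proof. by case: z => a b /=; rewrite !sqrrN. Qed.

Lemma normcBC z w : normc (z - w) = normc (w - z).
Proof. by rewrite -normcN opprB. Qed.

Lemma normcB z w : normc (z - w) <= normc z + normc w.
Proof. by rewrite -(normcN w); exact: normcD. Qed.

Lemma normc_lerB z w : normc z - normc w <= normc (z - w).
Proof. by rewrite lerBlDr; apply: le_trans (normcD _ _); rewrite subrK. Qed.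

Lemma normc_triangle w z (x : R[i]) : normc (z - x) <= normc (z - w) + normc (w - x).
Proof. by apply: le_trans (normcD _ _); rewrite addrA subrK. Qed.

Lemma sqr_normc z : normc z ^+ 2 = complex.Re z ^+ 2 + complex.Im z ^+ 2.
Proof. by case: z => a b; rewrite sqr_sqrtr ?addr_ge0 ?sqr_ge0. Qed.

Lemma normc_real (x : R) : normc x%:C = `|x|.
Proof. by rewrite /= expr0n addr0 sqrtr_sqr. Qed.

Lemma normc_eq0 z : (normc z == 0) = (z == 0).
Proof.
by apply/eqP/eqP => [/eq0_normc //|->]; exact: normc0.
Qed.

Lemma normc_gt0 z : (0 < normc z) = (z != 0).
Proof. by rewrite lt_def normc_ge0 andbT normc_eq0. Qed.

Lemma normcX z n : normc (z ^+ n) = normc z ^+ n.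
Proof.
by elim: n => [|n IH]; rewrite ?expr0 ?normc1// !exprS normcM IH.
Qed.

Lemma normc_div z w : normc (z / w) = normc z / normc w.
Proof. by rewrite normcM normcV. Qed.

Lemma normc_Re z : `|complex.Re z| <= normc z.
Proof.
rewrite -(@ler_pXn2r _ 2)// ?nnegrE ?normc_ge0// sqr_normc real_normK ?num_real//.
by rewrite lerDl sqr_ge0.
Qed.

Lemma normc_Im z : `|complex.Im z| <= normc z.
Proof.
rewrite -(@ler_pXn2r _ 2)// ?nnegrE ?normc_ge0// sqr_normc real_normK ?num_real//.
by rewrite lerDr sqr_ge0.
Qed.

Lemma normc_le z : normc z <= `|complex.Re z| + `|complex.Im z|.
Proof.
rewrite {1}(complexE z); apply: le_trans (normcD _ _) _.
rewrite normcM !normc_real lerD2l /= expr0n expr1n add0r sqrtr1 mul1r//.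
Qed.

Lemma complex_gt0 z : 0 < z -> z = (complex.Re z)%:C /\ 0 < complex.Re z.
Proof. by case: z => a b; rewrite ltcE /= => /andP[/eqP -> ->]. Qed.

Lemma discE z : disc z <-> normc z < 1.
Proof. by rewrite /disc /= normcE -[1]/(1%:C) ltcR. Qed.

Lemma circleE z : circle z <-> normc z = 1.
Proof.
rewrite /circle /= normcE; split => [[] //|->//].
Qed.

(** Affine approximation with error [e * normc h]: without a quotient, [h = 0] is no special case,
    and Goursat's argument can use the estimate as it stands. *)
Record cdiff f z l : Prop := Cdiff { cdiff_eps : forall e : R, 0 < e ->
  exists2 d : R, 0 < d &
    forall h, normc h < d -> normc (f (z + h) - f z - l * h) <= e * normc h }.

Lemma cdiffP f z l : cdiff f z l <->
  (fun h => h^-1 *: (f (h + z) - f z)) @ 0^' --> l.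
Proof.
split => [[fl]|/cvgrPdist_lt fl].
  apply/cvgrPdist_le => /= e e0.
  have [e_re e_gt0] := complex_gt0 e0.
  have [d d0 H] := fl _ e_gt0.
  apply/nbhs_ballP; exists d%:C => /=; first by rewrite ltcR.
  move=> h; rewrite -ball_normE /= sub0r normrN normcE ltcR => hd h0.
  rewrite normcE e_re lecR.
  have nh0 : 0 < normc h by rewrite normc_gt0.
  rewrite -(ler_pM2r nh0); apply: le_trans (H h hd).
  rewrite -normcM mulrBl -[_ *: _]/(_ * _) mulrAC mulVf// mul1r -normcN opprB.
  by rewrite (addrC h).
split=> e e0.
have /= := fl (e%:C); rewrite ltcR => /(_ e0) /nbhs_ballP[d /= d0 H].
have [d_re d_gt0] := complex_gt0 d0.
exists (complex.Re d) => // h hd.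
have [->|h0] := eqVneq h 0.
  by rewrite addr0 subrr mulr0 subrr normc0 mulr0.
have := H h; rewrite -ball_normE /= sub0r normrN normcE d_re ltcR => /(_ hd h0).
rewrite normcE ltcR => /ltW.
have nh0 : 0 < normc h by rewrite normc_gt0.
rewrite -(ler_pM2r nh0); apply: le_trans.
rewrite -normcM mulrBl -[_ *: _]/(_ * _) (mulrAC h^-1) mulVf// mul1r -normcN opprB.
by rewrite (addrC h).
Qed.

Lemma cdiff_derivable f z l : cdiff f z l -> derivable f z 1 /\ derive1 f z = l.
Proof.
move=> /cdiffP fl; split.
  rewrite /derivable; apply/cvg_ex; exists l => /=.
  by under eq_fun do rewrite -[_ *: 1]/(_ * 1) mulr1.
exact: cvg_lim fl.
Qed.

Lemma derivable_cdiff f z : derivable f z 1 -> cdiff f z (derive1 f z).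
Proof.
move=> fz; apply/cdiffP; rewrite derive1E.
have E : (fun h => h^-1 *: ((f \o shift z) (h *: 1) - f z)) =
    (fun h => h^-1 *: (f (h + z) - f z)).
  by apply/funext => h /=; rewrite -[h *: 1]/(h * 1) mulr1.
by move: fz; rewrite /derivable /derive E.
Qed.

End Basics.

(** A one-field record around the filter limit, so that the closure rules below treat it as an
    atomic predicate, for real and complex values alike. *)
Record cont_at (T U : topologicalType) (p : T -> U) (x : T) : Prop :=
  ContAt { cont_atP : p @ x --> p x }.

Section Continuity.
Context {R : realType}.
Implicit Types (z w h l : R[i]) (f g : R[i] -> R[i]).

Lemma cvg_complexP (T : Type) (F : set_system T) (FF : Filter F)
    (p : T -> R[i]) l : p @ F --> l <->
  (forall e : R, 0 < e -> \forall x \near F, normc (l - p x) < e).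
Proof.
split => [/cvgrPdist_lt pl e e0|pl].
  have := pl (e%:C); rewrite ltcR => /(_ e0).
  by apply: filterS => x; rewrite normcE ltcR.
apply/cvgrPdist_lt => /= e e0.
have [e_re e_gt0] := complex_gt0 e0.
by apply: filterS (pl _ e_gt0) => x; rewrite normcE {2}e_re ltcR.
Qed.

Lemma cvg_complex_ReIm (T : Type) (F : set_system T) (FF : Filter F)
    (p : T -> R[i]) l : p @ F --> l <->
  ((fun x => complex.Re (p x)) @ F --> complex.Re l /\
   (fun x => complex.Im (p x)) @ F --> complex.Im l).
Proof.
split => [/cvg_complexP pl|[/cvgrPdist_lt pr /cvgrPdist_lt pi]].
  split; apply/cvgrPdist_lt => e e0; apply: filterS (pl _ e0) => x; apply: le_lt_trans.
    by rewrite -[complex.Re l - _]/(complex.Re l + - complex.Re (p x)) -raddfN -raddfD; exact: normc_Re.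
  by rewrite -[complex.Im l - _]/(complex.Im l + - complex.Im (p x)) -raddfN -raddfD; exact: normc_Im.
apply/cvg_complexP => e e0; near=> x.
apply: le_lt_trans (normc_le _) _; rewrite (splitr e) ltrD//.
  rewrite [complex.Re _](raddfB (@complex.Re R : Rcomplex R -> R)).
  by near: x; apply: pr; rewrite divr_gt0.
rewrite [complex.Im _](raddfB (@complex.Im R : Rcomplex R -> R)).
by near: x; apply: pi; rewrite divr_gt0.
Unshelve. all: by end_near. Qed.

Lemma continuous_complex_ReIm (T : topologicalType) (p : T -> R[i]) x :
  cont_at p x <-> cont_at (fun x => complex.Re (p x)) x /\
   cont_at (fun x => complex.Im (p x)) x.
Proof.
split => [[/cvg_complex_ReIm[? ?]]|[[? [?]]]]; first by split; split.
by split; apply/cvg_complex_ReIm.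
Qed.

Lemma cont_cst (T : topologicalType) (c : R[i]) (x : T) :
  cont_at (fun=> c) x.
Proof. by split; exact: cst_continuous. Qed.

Lemma cont_id z : cont_at (fun w : R[i] => w) z.
Proof. by split; exact: cvg_id. Qed.

Lemma contD (T : topologicalType) (p q : T -> R[i]) x :
  cont_at p x -> cont_at q x ->
  cont_at (fun y => p y + q y) x.
Proof. by move=> [cp] [cq]; split; exact: (cvgD cp cq). Qed.

Lemma contB (T : topologicalType) (p q : T -> R[i]) x :
  cont_at p x -> cont_at q x ->
  cont_at (fun y => p y - q y) x.
Proof. by move=> [cp] [cq]; split; exact: (cvgB cp cq). Qed.

Lemma contM (T : topologicalType) (p q : T -> R[i]) x :
  cont_at p x -> cont_at q x ->
  cont_at (fun y => p y * q y) x.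
Proof. by move=> [cp] [cq]; split; exact: (cvgM cp cq). Qed.

Lemma contV (T : topologicalType) (p : T -> R[i]) x : p x != 0 ->
  cont_at p x -> cont_at (fun y => (p y)^-1) x.
Proof. by move=> px [cp]; split; exact: (cvgV px cp). Qed.

Lemma cont_comp (T U V : topologicalType) (p : T -> U) (g : U -> V) x :
  cont_at p x -> cont_at g (p x) ->
  cont_at (fun y => g (p y)) x.
Proof. by move=> [cp] [cg]; split; exact: (continuous_comp cp cg). Qed.

Lemma cont_near (T : topologicalType) (p : T -> R[i]) x :
  cont_at p x <->
  (forall e : R, 0 < e -> \forall y \near x, normc (p x - p y) < e).
Proof.
have H := @cvg_complexP T (nbhs x) _ p (p x).
by split => [[/H]|/H].
Qed.

Lemma nbhs_complexP z (P : R[i] -> Prop) :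
  (\forall w \near z, P w) <->
  exists2 d : R, 0 < d & forall w, normc (w - z) < d -> P w.
Proof.
split => [/nbhs_ballP[d /= d0 H]|[d d0 H]].
  have [d_re d_gt0] := complex_gt0 d0.
  exists (complex.Re d) => // w wd; apply: H.
  by rewrite -ball_normE /= normcE d_re ltcR normcBC.
apply/nbhs_ballP; exists d%:C => /=; first by rewrite ltcR.
by move=> w; rewrite -ball_normE /= normcE ltcR normcBC; exact: H.
Qed.

Lemma near_normc_lt z (r : R) : normc z < r -> \forall w \near z, normc w < r.
Proof.
move=> zr; apply/nbhs_complexP; exists (r - normc z); first by rewrite subr_gt0.
by move=> w; have := normc_lerB w z; lra.
Qed.

Lemma cont_complexP f z : cont_at f z <->
  forall e : R, 0 < e -> exists2 d : R, 0 < d &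
    forall w, normc (w - z) < d -> normc (f w - f z) < e.
Proof.
split => [/cont_near fz e /fz /nbhs_complexP[d d0 H]|fz].
  by exists d => // w /H; rewrite normcBC.
apply/cont_near => e /fz[d d0 H]; apply/nbhs_complexP; exists d => // w /H.
by rewrite normcBC.
Qed.

Lemma continuous_normc z : cont_at (@normc R : R[i] -> R) z.
Proof.
split.
apply/(@cvgrPdist_lt R R _ (nbhs z) _) => e e0; apply/nbhs_complexP; exists e => // w.
apply: le_lt_trans; rewrite ler_norml normcBC normc_lerB andbT lerNl opprB.
by rewrite normcBC normc_lerB.
Qed.

Lemma continuous_Re z : cont_at (@complex.Re R : R[i] -> R) z.
Proof. by have /continuous_complex_ReIm [] := cont_id z. Qed.

Lemma continuous_Im z : cont_at (@complex.Im R : R[i] -> R) z.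
Proof. by have /continuous_complex_ReIm [] := cont_id z. Qed.

(** Caratheodory's form of the derivative: a slope function continuous at [z]. It turns the product
    and chain rules into identities between slopes, and the slope itself reappears as the integrand
    in the proof of Cauchy's formula. *)
Lemma cdiff_slope f z l : cdiff f z l <->
  exists q : R[i] -> R[i], [/\ cont_at q z, q z = l &
    forall w, f w - f z = q w * (w - z)].
Proof.
split => [[fl]|[q [qz <- fq]]]; last first.
  split=> e e0; have /cont_complexP /(_ _ e0)[d d0 H] := qz.
  exists d => // h hd.
  rewrite fq (addrAC z) subrr add0r -mulrBl normcM ler_wpM2r ?normc_ge0//.
  by rewrite ltW// H// addrAC subrr add0r.
exists (fun w => if w == z then l else (f w - f z) / (w - z)).
split; [apply/cont_complexP => e e0| |move=> w].
  - have [|d d0 H] := fl (e / 2); first by rewrite divr_gt0.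
    exists d => // w wd; rewrite eqxx; case: eqVneq => [_|wz].
      by rewrite subrr normc0.
    have nh0 : 0 < normc (w - z) by rewrite normc_gt0 subr_eq0.
    rewrite -(ltr_pM2r nh0) -normcM mulrBl divfK ?subr_eq0//.
    have := H _ wd; rewrite (addrC z) subrK => /le_lt_trans; apply.
    by rewrite ltr_pM2r// ltr_pdivrMr// ltr_pMr// ltr1n.
  - by rewrite eqxx.
  - case: eqVneq => [->|wz]; first by rewrite !subrr mulr0.
    by rewrite divfK ?subr_eq0.
Qed.

Lemma cdiff_continuous f z l : cdiff f z l -> cont_at f z.
Proof.
move=> /cdiff_slope[q [qz _ fq]].
have -> : f = fun w => f z + q w * (w - z).
  by apply/funext => w; rewrite -fq addrC subrK.
apply: contD; [exact: cont_cst|apply: contM; first exact: qz].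
by apply: contB; [exact: cont_id|exact: cont_cst].
Qed.

Lemma cdiff_eq f z l m : l = m -> cdiff f z l -> cdiff f z m.
Proof. by move=> ->. Qed.

Lemma cdiff_cst (c : R[i]) z : cdiff (fun=> c) z 0.
Proof.
apply/cdiff_slope; exists (fun=> 0).
by split; [exact: cont_cst| |move=> w; rewrite subrr mul0r].
Qed.

Lemma cdiff_id z : cdiff id z 1.
Proof.
apply/cdiff_slope; exists (fun=> 1).
by split; [exact: cont_cst| |move=> w; rewrite mul1r].
Qed.

Lemma cdiffD f g z l m : cdiff f z l -> cdiff g z m ->
  cdiff (fun w => f w + g w) z (l + m).
Proof.
move=> /cdiff_slope[q [qz <- fq]] /cdiff_slope[r [rz <- gr]].
apply/cdiff_slope; exists (fun w => q w + r w).
split; [exact: contD| |move=> w]; first by [].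
by rewrite mulrDl -fq -gr opprD addrACA.
Qed.

Lemma cdiffM f g z l m : cdiff f z l -> cdiff g z m ->
  cdiff (fun w => f w * g w) z (l * g z + f z * m).
Proof.
move=> fl gm; have gc := cdiff_continuous gm.
move: fl gm => /cdiff_slope[q [qz <- fq]] /cdiff_slope[r [rz <- gr]].
apply/cdiff_slope; exists (fun w => q w * g w + f z * r w).
split; [| by [] |move=> w].
  by apply: contD; apply: contM; [exact: qz|exact: gc|exact: cont_cst|exact: rz].
by rewrite mulrDl mulrAC -fq -mulrA -gr mulrBl mulrBr addrA subrK.
Qed.

Lemma cdiffZ (c : R[i]) f z l : cdiff f z l -> cdiff (fun w => c * f w) z (c * l).
Proof.
by move=> fl; apply: cdiff_eq (cdiffM (cdiff_cst c z) fl); rewrite mul0r add0r.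
Qed.

Lemma cdiffN f z l : cdiff f z l -> cdiff (fun w => - f w) z (- l).
Proof.
move=> /(cdiffZ (-1)); rewrite mulN1r.
by under eq_fun do rewrite mulN1r.
Qed.

Lemma cdiffB f g z l m : cdiff f z l -> cdiff g z m ->
  cdiff (fun w => f w - g w) z (l - m).
Proof. by move=> fl /cdiffN; exact: cdiffD. Qed.

Lemma cdiff_comp f g z l m : cdiff f z l -> cdiff g (f z) m ->
  cdiff (fun w => g (f w)) z (m * l).
Proof.
move=> fl; have fc := cdiff_continuous fl.
move: fl => /cdiff_slope[q [qz <- fq]] /cdiff_slope[r [rz <- gr]].
apply/cdiff_slope; exists (fun w => r (f w) * q w).
split; [| by [] |move=> w].
  by apply: contM; [exact: cont_comp rz|exact: qz].
by rewrite gr fq mulrA.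
Qed.

Lemma cdiff_near f g z l : (\forall w \near z, f w = g w) ->
  cdiff f z l -> cdiff g z l.
Proof.
move=> /nbhs_complexP[d d0 fg] [fl]; split=> e /fl[d' d'0 H].
exists (Num.min d d'); first by rewrite lt_min d0.
move=> h; rewrite lt_min => /andP[hd hd'].
rewrite -!fg; [exact: H|by rewrite subrr normc0|].
by rewrite addrAC subrr add0r.
Qed.

Lemma cdiffV z : z != 0 -> cdiff (fun w => w^-1) z (- z ^- 2).
Proof.
move=> z0; split=> e e0; have nz0 : 0 < normc z by rewrite normc_gt0.
(* The first bound keeps |z + h| above |z| / 2, so that the remainder is at most 2 |h|^2 / |z|^3;
   the second turns this into e |h|. *)
exists (Num.min (normc z / 2) (e * normc z ^+ 3 / 2)).
  by rewrite lt_min !(divr_gt0, mulr_gt0, exprn_gt0).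
move=> h; rewrite lt_min => /andP[hz he].
have nzh : normc z / 2 < normc (z + h).
  by have := normc_lerB z (- h); rewrite normcN opprK; lra.
have zh0 : z + h != 0 by rewrite -normc_gt0; apply: lt_trans nzh; rewrite divr_gt0.
have -> : (z + h)^-1 - z^-1 - - z^-2 * h = h ^+ 2 / (z ^+ 2 * (z + h)).
  by field; rewrite z0 zh0.
rewrite normc_div normcX (normcM (z ^+ 2)) normcX ler_pdivrMr; last first.
  by rewrite mulr_gt0 ?exprn_gt0// normc_gt0.
rewrite expr2 -mulrA mulrCA ler_wpM2l ?normc_ge0//.
rewrite (le_trans (ltW he))// -mulrA ler_pM2l// exprSr -mulrA ler_pM2l ?exprn_gt0//.
exact: ltW.
Qed.

End Continuity.

(** * The complex exponential and the angular parametrisation of the circle *)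

Section Exponential.
Context {R : realType}.
Implicit Types (z w h l : R[i]) (x y s t : R).

Lemma is_derive_eps (f : R -> R) x (l : R) : is_derive x 1 f l ->
  forall e : R, 0 < e -> exists2 d : R, 0 < d &
  forall h : R, `|h| < d -> `|f (x + h) - f x - l * h| <= e * `|h|.
Proof.
move=> [fx fl] e e0.
have E : (fun h : R => h^-1 *: ((f \o shift x) (h *: 1) - f x)) =
    (fun h : R => h^-1 *: (f (h + x) - f x)).
  by apply/funext => h /=; rewrite -[h *: 1]/(h * 1) mulr1.
move: fx fl; rewrite /derivable /derive E => fx fl.
have : (fun h : R => h^-1 *: (f (h + x) - f x)) @ 0^' --> l by rewrite -fl.
move=> /cvgrPdist_lt /(_ _ e0) /nbhs_ballP[d /= d0 H].
exists d => // h hd.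
have [->|h0] := eqVneq h 0.
  by rewrite addr0 subrr mulr0 subrr normr0 mulr0.
have := H h; rewrite -ball_normE /= sub0r normrN => /(_ hd h0) /ltW.
have nh0 : 0 < `|h| by rewrite normr_gt0.
rewrite -(ler_pM2r nh0); apply: le_trans.
rewrite -normrM mulrBl -[_ *: _]/(_ * _) (mulrAC h^-1) mulVf// mul1r -normrN opprB.
by rewrite (addrC h).
Qed.

Lemma expC0 : expC 0 = 1 :> R[i].
Proof. by rewrite /expC /= expR0 cos0 sin0 mul1r. Qed.

Lemma expCD z w : expC (z + w) = expC z * expC w.
Proof.
case: z => a b; case: w => c d; rewrite /expC /= expRD sinD cosD; simpc.
by congr (_ +i* _); ring.
Qed.

Lemma normc_cos_sin t : normc (cos t +i* sin t) = 1.
Proof. by rewrite /= cos2Dsin2 sqrtr1. Qed.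

Lemma normc_expC z : normc (expC z) = expR (complex.Re z).
Proof. by rewrite /expC normcM normc_cos_sin mulr1 normc_real ger0_norm ?expR_ge0. Qed.

Lemma expC_neq0 z : expC z != 0.
Proof. by rewrite -normc_gt0 normc_expC expR_gt0. Qed.

Lemma expCN z : expC (- z) = (expC z)^-1.
Proof.
apply: (mulfI (expC_neq0 z)); rewrite -expCD subrr expC0 divff//.
exact: expC_neq0.
Qed.

Lemma expi_cos_sin t : expi t = cos t +i* sin t.
Proof. by rewrite /expi /expC /= expR0 mul1r. Qed.

Lemma normc_expi t : normc (expi t) = 1.
Proof. by rewrite expi_cos_sin normc_cos_sin. Qed.

Lemma expi_neq0 t : expi t != 0.
Proof. exact: expC_neq0. Qed.

Lemma expi0 : expi 0 = 1 :> R[i].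
Proof. exact: expC0. Qed.

Lemma expiD s t : expi (s + t) = expi s * expi t.
Proof. by rewrite /expi -expCD; congr expC; simpc. Qed.

Lemma expi2pi : expi (2 * pi) = 1 :> R[i].
Proof. by rewrite expi_cos_sin mulr_natl cos2pi sin2pi. Qed.

Lemma expCE x y : expC (x +i* y) = (expR x)%:C * expi y.
Proof. by rewrite expi_cos_sin. Qed.

Lemma cdiff_expC0 : cdiff (@expC R) 0 1.
Proof.
(* Altogether seven errors of size e' |h| arise below, so e / 8 suffices; e' <= 1 serves to bound |1
   + x| by 2. *)
split=> e e0; pose e' := Num.min (e / 8) 1.
have e'0 : 0 < e' by rewrite lt_min divr_gt0/=.
have [e'e e'1] : e' <= e / 8 /\ e' <= 1 by rewrite !ge_min !lexx orbT.
have [d1 d10 H1] := is_derive_eps (is_derive_expR (0 : R)) e'0.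
have [d2 d20 H2] := is_derive_eps (is_derive_cos (0 : R)) e'0.
have [d3 d30 H3] := is_derive_eps (is_derive_sin (0 : R)) e'0.
exists (Num.min (Num.min d1 d2) (Num.min d3 e')).
  by rewrite lt_min (lt_min _ d1) d10 d20 lt_min d30.
move=> h; rewrite lt_min (lt_min _ d1) (lt_min _ d3).
move=> /andP[/andP[h1 h2] /andP[h3 h4]].
have hx := normc_Re h; have hy := normc_Im h.
have {H1} := H1 _ (le_lt_trans hx h1); have {H2} := H2 _ (le_lt_trans hy h2).
have {H3} := H3 _ (le_lt_trans hy h3).
rewrite !add0r sin0 cos0 expR0 expC0 subr0 oppr0 mul0r subr0 !mul1r.
set x := complex.Re h in hx *; set y := complex.Im h in hy *.
move=> H3 H2 H1.
have x1 : `|x| <= e' by apply: le_trans hx (ltW h4).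
have y1 : `|y| <= e' by apply: le_trans hy (ltW h4).
apply: le_trans (normc_le _) _.
have -> : complex.Re (expC h - 1 - h) = (expR x - 1 - x) * cos y + (1 + x) * (cos y - 1).
  by rewrite /x /y /expC; case: (h) => a b /=; rewrite mul0r subr0; ring.
have -> : complex.Im (expC h - 1 - h) =
    (expR x - 1 - x) * sin y + (1 + x) * (sin y - y) + x * y.
  by rewrite /x /y /expC; case: (h) => a b /=; ring.
have A1 : `|(expR x - 1 - x) * cos y| <= e' * `|x|.
  by rewrite normrM -[leRHS]mulr1 ler_pM// cos_max.
have A2 : `|(expR x - 1 - x) * sin y| <= e' * `|x|.
  by rewrite normrM -[leRHS]mulr1 ler_pM// sin_max.
have x2 : `|1 + x| <= 2.
  by apply: le_trans (ler_normD _ _) _; rewrite normr1; lra.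
have A3 : `|(1 + x) * (cos y - 1)| <= 2 * (e' * `|y|) by rewrite normrM ler_pM.
have A4 : `|(1 + x) * (sin y - y)| <= 2 * (e' * `|y|) by rewrite normrM ler_pM.
have A5 : `|x * y| <= e' * `|y| by rewrite normrM ler_pM.
have A6 := ler_normD ((expR x - 1 - x) * cos y) ((1 + x) * (cos y - 1)).
have A7 := ler_normD ((expR x - 1 - x) * sin y + (1 + x) * (sin y - y)) (x * y).
have A8 := ler_normD ((expR x - 1 - x) * sin y) ((1 + x) * (sin y - y)).
have A9 : e' * `|x| <= e / 8 * normc h by rewrite ler_pM// ltW.
have A10 : e' * `|y| <= e / 8 * normc h by rewrite ler_pM// ltW.
have A11 : 0 <= e * normc h by rewrite mulr_ge0 ?normc_ge0// ltW.
lra.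
Qed.

Lemma cdiff_expC z : cdiff (@expC R) z (expC z).
Proof.
have -> : (@expC R) = fun w => expC z * expC (w - z).
  by apply/funext => w; rewrite -expCD addrC subrK.
rewrite subrr expC0.
apply/cdiffZ/cdiff_eq; first exact: mulr1.
apply: (@cdiff_comp _ (fun w => w - z)).
  by apply: cdiff_eq (cdiffB (cdiff_id z) (cdiff_cst z z)); rewrite subr0.
by rewrite subrr; exact: cdiff_expC0.
Qed.

Lemma cont_expi t : cont_at (@expi R) t.
Proof.
have -> : (@expi R) = fun t => cos t +i* sin t by apply/funext => s; rewrite expi_cos_sin.
by apply/continuous_complex_ReIm; split; split; [exact: continuous_cos|exact: continuous_sin].
Qed.

(** The mean value theorem is applied to cosine and sine separately, hence the factor 2 in place of
    1. *)
Lemma normc_expiB s t : normc (expi s - expi t) <= 2 * `|s - t|.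
Proof.
rewrite !expi_cos_sin; apply: le_trans (normc_le _) _ => /=.
suff H (f df : R -> R) : (forall x, is_derive x 1 f (df x)) -> (forall x, `|df x| <= 1) ->
    `|f s - f t| <= `|s - t|.
  have C : `|cos s - cos t| <= `|s - t|.
    apply: (H _ (fun x => - sin x) (@is_derive_cos R)) => x.
    by rewrite normrN sin_max.
  have S : `|sin s - sin t| <= `|s - t|.
    apply: (H _ cos (@is_derive_sin R)) => x.
    by rewrite cos_max.
  by rewrite mulr_natl mulr2n lerD.
move=> fd dfb.
wlog ts : s t / t <= s => [W|].
  by have [/W//|/ltW/W] := leP t s; rewrite distrC (distrC t).
have fc : {within `[t, s], continuous f}.
  apply: continuous_subspaceT => x.
  by apply: differentiable_continuous; apply/derivable1_diffP; have [] := fd x.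
have [c _ ->] := MVT_segment ts (fun x _ => fd x) fc.
by rewrite normrM ler_piMl.
Qed.

Lemma expi_inj s t : 0 <= s < 2 * pi -> 0 <= t < 2 * pi -> expi s = expi t -> s = t.
Proof.
wlog ts : s t / t <= s => [W hs ht st|].
  by have [ts|/ltW ts] := leP t s; [apply: W|apply/esym/W].
move=> /andP[s0 s1] /andP[t0 t1] st.
have [//|st'] := eqVneq s t; exfalso.
have lt_ts : t < s by rewrite lt_neqAle eq_sym st'.
(* cos (s - t) = 1 would force sin ((s - t) / 2) = 0, whereas (s - t) / 2 lies strictly between 0
   and pi. *)
have : sin ((s - t) / 2) > 0.
  by apply: sin_gt0_pi; lra.
have : cos (s - t) = 1.
  rewrite cosB; move: st; rewrite !expi_cos_sin => -[-> ->].
  by rewrite -!expr2 cos2Dsin2.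
have {1}-> : s - t = ((s - t) / 2) *+ 2 by rewrite mulr2n; lra.
rewrite cos_mulr2n => c1; have := cos2Dsin2 ((s - t) / 2).
set c := cos _ in c1 *; set r := sin _ => cr r0.
have : r ^+ 2 > 0 by rewrite exprn_gt0.
by lra.
Qed.

Lemma expi_surj z : normc z = 1 -> exists2 t, 0 <= t <= 2 * pi & z = expi t.
Proof.
case: z => a b ab.
have {ab} ab : a ^+ 2 + b ^+ 2 = 1.
  by have := sqr_normc (a +i* b); rewrite ab expr1n.
have a1 : -1 <= a <= 1.
  by rewrite -ler_norml -(@ler_pXn2r _ 2)// ?nnegrE// expr1n real_normK ?num_real// -ab lerDl sqr_ge0.
have s2 : Num.sqrt (1 - a ^+ 2) = `|b| by rewrite -ab addrAC subrr add0r sqrtr_sqr.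
have [b0|b0] := leP 0 b.
  exists (acos a).
    by rewrite acos_ge0//= (le_trans (acos_lepi a1))// ler_peMl ?pi_ge0// ler1n.
  by rewrite expi_cos_sin acosK ?in_itv//= sin_acos// s2 ger0_norm.
exists (2 * pi - acos a).
  have := acos_ge0 a1; have := acos_lepi a1; have := @pi_gt0 R; lra.
rewrite expi_cos_sin cosB sinB mulr_natl cos2pi sin2pi.
by rewrite acosK ?in_itv//= sin_acos// s2 ltr0_norm//; congr (_ +i* _); ring.
Qed.

End Exponential.

(** * Complex integrals *)

Section ComplexMeasurable.
Context {R : realType} {d : measure_display} {T : measurableType d}.
Implicit Types (D : set T) (f g : T -> R[i]) (u v : T -> R).

(** Inversion is continuous on the open set of nonzero reals; the remaining point, with value 0 by
    convention, is a measurable singleton. *)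
Lemma measurable_inv : measurable_fun [set: R] (@GRing.inv R).
Proof.
have o : open [set x : R | x != 0].
  have -> : [set x : R | x != 0] = ~` [set 0].
    by apply/seteqP; split => x /= /eqP.
  by apply: closed_openC; exact: closed_eq.
have -> : [set: R] = [set x | x != 0] `|` [set 0].
  by apply/seteqP; split => // x _; have [->|] := eqVneq x 0; [right|left].
apply/measurable_funU; [exact: open_measurable|exact: measurable_set1|split].
  apply: open_continuous_measurable_fun => // x /set_mem /= x0.
  exact: inv_continuous.
exact: measurable_fun_set1.
Qed.

Record cmeas D f : Prop := CMeas {
  cmeas_Re : measurable_fun D (fun x => complex.Re (f x));
  cmeas_Im : measurable_fun D (fun x => complex.Im (f x)) }.

Lemma cmeas_cst D (c : R[i]) : cmeas D (fun=> c).
Proof. by split; exact: measurable_cst. Qed.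

Lemma cmeas_real D u : measurable_fun D u -> cmeas D (fun x => (u x)%:C).
Proof. by move=> mu; split => //=; exact: measurable_cst. Qed.

Lemma cmeasD D f g : cmeas D f -> cmeas D g -> cmeas D (fun x => f x + g x).
Proof.
move=> [fr fi] [gr gi]; split.
  apply: eq_measurable_fun (measurable_funD fr gr) => x _.
  by rewrite /=; case: (f x) => a b; case: (g x).
apply: eq_measurable_fun (measurable_funD fi gi) => x _.
by rewrite /=; case: (f x) => a b; case: (g x).
Qed.

Lemma cmeasN D f : cmeas D f -> cmeas D (fun x => - f x).
Proof.
move=> [fr fi]; split.
  by apply: eq_measurable_fun (measurable_funN fr) => x _ /=; case: (f x).
by apply: eq_measurable_fun (measurable_funN fi) => x _ /=; case: (f x).
Qed.

Lemma cmeasB D f g : cmeas D f -> cmeas D g -> cmeas D (fun x => f x - g x).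
Proof. by move=> mf /cmeasN; exact: cmeasD. Qed.

Lemma cmeasM D f g : cmeas D f -> cmeas D g -> cmeas D (fun x => f x * g x).
Proof.
move=> [fr fi] [gr gi]; split.
  apply: eq_measurable_fun (measurable_funB (measurable_funM fr gr) (measurable_funM fi gi)) => x _.
  by rewrite /=; case: (f x) => a b; case: (g x).
apply: eq_measurable_fun (measurable_funD (measurable_funM fr gi) (measurable_funM fi gr)) => x _.
by rewrite /=; case: (f x) => a b; case: (g x).
Qed.

Lemma measurable_sqr_normc D f : cmeas D f ->
  measurable_fun D (fun x => normc (f x) ^+ 2).
Proof.
move=> [fr fi].
apply: eq_measurable_fun (measurable_funD (measurable_funX 2 fr) (measurable_funX 2 fi)) => x _.
by rewrite sqr_normc.
Qed.

Lemma measurable_normc D f : cmeas D f -> measurable_fun D (fun x => normc (f x)).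
Proof.
move=> mf; have := measurableT_comp (continuous_measurable_fun (@sqrt_continuous R)) (measurable_sqr_normc mf).
by apply: eq_measurable_fun => x _ /=; rewrite sqrtr_sqr ger0_norm ?normc_ge0.
Qed.

(** Conjugate over squared modulus; since [0^-1 = 0], this formula for the inverse also holds where
    [f] vanishes. *)
Lemma cmeasV D f : cmeas D f -> cmeas D (fun x => (f x)^-1).
Proof.
move=> mf; have mn := measurableT_comp measurable_inv (measurable_sqr_normc mf).
case: mf => fr fi; split.
  apply: eq_measurable_fun (measurable_funM fr mn) => x _.
  by rewrite /= sqr_normc; case: (f x).
apply: eq_measurable_fun (measurable_funM (measurable_funN fi) mn) => x _.
by rewrite /= sqr_normc; case: (f x) => a b /=; rewrite mulNr.
Qed.

Lemma cmeas_subset D D' f : measurable D -> D' `<=` D -> cmeas D f -> cmeas D' f.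
Proof. by move=> mD DD' [fr fi]; split; exact: measurable_funS mD DD' _. Qed.

End ComplexMeasurable.

Section ComplexIntegral.
Context {R : realType} {d : measure_display} {T : measurableType d}.
Variable mu : {measure set T -> \bar R}.
Implicit Types (D : set T) (f g : T -> R[i]) (u v : T -> R).

Record cintegrable D f : Prop := CIntegrable {
  cintegrable_Re : mu.-integrable D (EFin \o (fun x => complex.Re (f x)));
  cintegrable_Im : mu.-integrable D (EFin \o (fun x => complex.Im (f x))) }.

Definition cint D f : R[i] := (\int[mu]_(x in D) complex.Re (f x)) +i*
  (\int[mu]_(x in D) complex.Im (f x)).

Lemma le_cintegrable D f u : measurable D -> cmeas D f ->
  (forall x, D x -> normc (f x) <= u x) -> mu.-integrable D (EFin \o u) ->
  cintegrable D f.
Proof.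
move=> mD [fr fi] fu iu; split; apply: le_integrable iu => //.
- exact/measurable_EFinP.
- move=> x Dx /=; rewrite lee_fin (le_trans (normc_Re _))//.
  by rewrite (le_trans (fu _ Dx))// ler_norm.
- exact/measurable_EFinP.
- move=> x Dx /=; rewrite lee_fin (le_trans (normc_Im _))//.
  by rewrite (le_trans (fu _ Dx))// ler_norm.
Qed.

Lemma cintegrable_cmeas D f : cintegrable D f -> cmeas D f.
Proof.
by move=> [/measurable_int fr /measurable_int fi]; split; apply/measurable_EFinP.
Qed.

Lemma integrable_normc D f : measurable D -> cintegrable D f ->
  mu.-integrable D (EFin \o (fun x => normc (f x))).
Proof.
move=> mD fi; have mf := cintegrable_cmeas fi; case: fi => fr fi.
apply: le_integrable (integrableD mD (integrable_abse fr) (integrable_abse fi)) => //.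
  exact/measurable_EFinP/measurable_normc.
move=> x Dx; rewrite -[leLHS]/(`|normc (f x)|%:E).
rewrite -[leRHS]/(`| `|complex.Re (f x)| + `|complex.Im (f x)| |%:E).
by rewrite lee_fin (ger0_norm (normc_ge0 _)) (le_trans (normc_le _))// ler_norm.
Qed.

Lemma eq_cint D f g : (forall x, D x -> f x = g x) -> cint D f = cint D g.
Proof.
by move=> fg; congr (_ +i* _); apply: eq_Rintegral => x /set_mem Dx; rewrite fg.
Qed.

Lemma cintegrableD D f g : measurable D -> cintegrable D f -> cintegrable D g ->
  cintegrable D (fun x => f x + g x).
Proof.
move=> mD [fr fi] [gr gi]; split.
  apply: eq_integrable (integrableD mD fr gr) => // x _ /=.
  by rewrite /=; case: (f x) => a b; case: (g x).
apply: eq_integrable (integrableD mD fi gi) => // x _ /=.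
by rewrite /=; case: (f x) => a b; case: (g x).
Qed.

Lemma cintD D f g : measurable D -> cintegrable D f -> cintegrable D g ->
  cint D (fun x => f x + g x) = cint D f + cint D g.
Proof.
move=> mD [fr fi] [gr gi]; rewrite /cint; simpc; rewrite -!RintegralD//.
by congr (_ +i* _); apply: eq_Rintegral => x _; case: (f x) => a b; case: (g x).
Qed.

Lemma cintegrableZ D (c : R[i]) f : measurable D -> cintegrable D f ->
  cintegrable D (fun x => c * f x).
Proof.
move=> mD [fr fi]; case: c => a b; split.
  apply: eq_integrable (integrableB mD (integrableZl mD a fr) (integrableZl mD b fi)) => // x _ /=.
  by case: (f x).
apply: eq_integrable (integrableD mD (integrableZl mD a fi) (integrableZl mD b fr)) => // x _ /=.
by case: (f x).
Qed.

Lemma cintZ D (c : R[i]) f : measurable D -> cintegrable D f ->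
  cint D (fun x => c * f x) = c * cint D f.
Proof.
move=> mD [fr fi]; case: c => a b; rewrite /cint; simpc.
rewrite -!RintegralZl// -RintegralB//; last 2 first.
- exact: (integrableZl mD a fr).
- exact: (integrableZl mD b fi).
rewrite -RintegralD//; last 2 first.
- exact: (integrableZl mD a fi).
- exact: (integrableZl mD b fr).
by congr (_ +i* _); apply: eq_Rintegral => x _ /=; case: (f x).
Qed.

Lemma cintegrableB D f g : measurable D -> cintegrable D f -> cintegrable D g ->
  cintegrable D (fun x => f x - g x).
Proof.
move=> mD fi /(cintegrableZ (-1) mD) gi.
by have := cintegrableD mD fi gi; under eq_fun do rewrite mulN1r.
Qed.

Lemma cintB D f g : measurable D -> cintegrable D f -> cintegrable D g ->
  cint D (fun x => f x - g x) = cint D f - cint D g.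
Proof.
move=> mD fi gi; rewrite -mulN1r -cintZ// -cintD//; last exact: cintegrableZ.
by apply: eq_cint => x _; rewrite mulN1r.
Qed.

Lemma cint_sum D (I : Type) (r : seq I) (F : I -> T -> R[i]) : measurable D ->
  (forall i, cintegrable D (F i)) ->
  cintegrable D (fun x => \sum_(i <- r) F i x) /\
  cint D (fun x => \sum_(i <- r) F i x) = \sum_(i <- r) cint D (F i).
Proof.
move=> mD Fi; elim: r => [|i r [IH1 IH2]].
  under eq_fun do rewrite big_nil; rewrite big_nil; split.
    by split; exact: integrable0.
  by rewrite /cint /= /Rintegral !integral0.
under eq_fun do rewrite big_cons; rewrite big_cons -IH2 -cintD//; split => //.
exact: cintegrableD.
Qed.

(* The constant 2 is not optimal; it comes from bounding real and imaginary
   parts separately. *)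
Lemma normc_cint D f u : measurable D -> cintegrable D f ->
  (forall x, D x -> normc (f x) <= u x) -> mu.-integrable D (EFin \o u) ->
  normc (cint D f) <= 2 * \int[mu]_(x in D) u x.
Proof.
move=> mD [fr fi] fu iu; apply: le_trans (normc_le _) _ => /=.
rewrite mulr_natl mulr2n lerD//.
  apply: le_trans (le_normr_Rintegral mD fr) _; apply: le_Rintegral => //.
    exact: integrable_norm.
  by move=> x Dx; rewrite (le_trans (normc_Re _))// fu.
apply: le_trans (le_normr_Rintegral mD fi) _; apply: le_Rintegral => //.
  exact: integrable_norm.
by move=> x Dx; rewrite (le_trans (normc_Im _))// fu.
Qed.

End ComplexIntegral.

Section IntervalIntegral.
Context {R : realType}.
Implicit Types (a b c s t : R) (p q : R -> R[i]).

Definition cI a b p : R[i] := cint lebesgue_measure `[a, b] p.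

Lemma cont_cintegrable a b p : (forall t, a <= t <= b -> cont_at p t) ->
  cintegrable lebesgue_measure `[a, b] p.
Proof.
move=> pc; split; apply: continuous_compact_integrable; try exact: segment_compact.
  apply: continuous_in_subspaceT => t /set_mem /=; rewrite in_itv /= => tab.
  by have /continuous_complex_ReIm[[]] := pc t tab.
apply: continuous_in_subspaceT => t /set_mem /=; rewrite in_itv /= => tab.
by have /continuous_complex_ReIm[_ []] := pc t tab.
Qed.

Lemma Rint_split a b c (u : R -> R) : a <= c -> c <= b ->
  lebesgue_measure.-integrable `[a, b] (EFin \o u) ->
  \int[lebesgue_measure]_(t in `[a, b]) u t =
  \int[lebesgue_measure]_(t in `[a, c]) u t + \int[lebesgue_measure]_(t in `[c, b]) u t.
Proof.
move=> ac cb iu.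
have := @Rintegral_itvB R u (BLeft a) (BRight b) c iu.
rewrite !bnd_simp => /(_ ac cb) H.
rewrite -(Rintegral_itv_obnd_cbnd (r := c)); first by rewrite -H addrC subrK.
apply: integrableS iu => //= x /=; rewrite !in_itv /= => /andP[/ltW cx ->].
by rewrite (le_trans ac cx).
Qed.

Lemma cI_split a b c p : a <= c -> c <= b ->
  (forall t, a <= t <= b -> cont_at p t) -> cI a b p = cI a c p + cI c b p.
Proof.
move=> ac cb /cont_cintegrable[pr pi].
by rewrite /cI /cint; simpc; congr (_ +i* _); exact: Rint_split.
Qed.

Lemma eq_cI a b p q : (forall t, a <= t <= b -> p t = q t) -> cI a b p = cI a b q.
Proof. by move=> pq; apply: eq_cint => t /=; rewrite in_itv; exact: pq. Qed.

Lemma cID a b p q : (forall t, a <= t <= b -> cont_at p t) ->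
  (forall t, a <= t <= b -> cont_at q t) ->
  cI a b (fun t => p t + q t) = cI a b p + cI a b q.
Proof. by move=> pc qc; apply: cintD => //; exact: cont_cintegrable. Qed.

Lemma cIB a b p q : (forall t, a <= t <= b -> cont_at p t) ->
  (forall t, a <= t <= b -> cont_at q t) ->
  cI a b (fun t => p t - q t) = cI a b p - cI a b q.
Proof. by move=> pc qc; apply: cintB => //; exact: cont_cintegrable. Qed.

Lemma cIZ a b (k : R[i]) p : (forall t, a <= t <= b -> cont_at p t) ->
  cI a b (fun t => k * p t) = k * cI a b p.
Proof. by move=> pc; apply: cintZ => //; exact: cont_cintegrable. Qed.

Lemma measure_itvcc a b : a <= b -> (lebesgue_measure `[a, b] = (b - a)%:E)%E.
Proof.
move=> ab; rewrite lebesgue_measure_itv /= lte_fin; case: ltP => //.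
by move=> ba; have -> : a = b; [apply/eqP; rewrite eq_le ab|rewrite subrr].
Qed.

Lemma integrable_itv_cst a b (k : R) :
  lebesgue_measure.-integrable `[a, b] (EFin \o (fun=> k)).
Proof.
apply: continuous_compact_integrable; first exact: segment_compact.
exact/continuous_subspaceT/cst_continuous.
Qed.

Lemma normc_cI a b p (M : R) : a <= b -> (forall t, a <= t <= b -> cont_at p t) ->
  (forall t, a <= t <= b -> normc (p t) <= M) -> normc (cI a b p) <= 2 * (M * (b - a)).
Proof.
move=> ab pc pM.
have := @normc_cint _ _ _ lebesgue_measure `[a, b] p (fun=> M) _ (cont_cintegrable pc) _ (integrable_itv_cst a b M).
rewrite Rintegral_cst//= measure_itvcc//=; exact.
Qed.

Lemma cI_cst a b (k : R[i]) : a <= b -> cI a b (fun=> k) = k * (b - a)%:C.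
Proof.
by move=> ab; rewrite /cI /cint !Rintegral_cst//= measure_itvcc//=; case: k => x y; simpc.
Qed.

(** Derivative of a curve in the plane, again through a continuous slope, so that it composes with
    [cdiff] and splits into real and imaginary parts. *)
Record pdiff p t (l : R[i]) : Prop := Pdiff {
  pdiff_slope : exists q : R -> R[i], [/\ cont_at q t, q t = l &
    forall s, p s - p t = q s * (s - t)%:C] }.

Lemma pdiff_eq p t l m : l = m -> pdiff p t l -> pdiff p t m.
Proof. by move=> ->. Qed.

Lemma cont_realC t : cont_at (fun s : R => s%:C) t.
Proof.
apply/continuous_complex_ReIm; split; split => /=; first exact: cvg_id.
exact: cvg_cst.
Qed.

Lemma pdiff_cont p t l : pdiff p t l -> cont_at p t.
Proof.
move=> [[q [qc _ pq]]].
have -> : p = fun s => p t + q s * (s%:C - t%:C).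
  by apply/funext => w; rewrite -rmorphB -pq addrC subrK.
apply: contD; [exact: cont_cst|apply: contM; first exact: qc].
by apply: contB; [exact: cont_realC|exact: cont_cst].
Qed.

Lemma cdiff_pdiff (f : R[i] -> R[i]) p t l m : cdiff f (p t) l -> pdiff p t m ->
  pdiff (fun s => f (p s)) t (l * m).
Proof.
move=> /cdiff_slope[r [rc <- fr]] pm; have pc := pdiff_cont pm.
move: pm => [[q [qc <- pq]]]; split.
exists (fun s => r (p s) * q s); split; [| |move=> s].
- by apply: contM; [exact: cont_comp pc rc|exact: qc].
- by [].
- by rewrite fr pq mulrA.
Qed.

Lemma pdiff_cst t (k : R[i]) : pdiff (fun=> k) t 0.
Proof.
split; exists (fun=> 0); split; [exact: cont_cst|by []|move=> s].
by rewrite subrr mul0r.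
Qed.

Lemma pdiff_realC t : pdiff (fun s => s%:C) t 1.
Proof.
split; exists (fun=> 1); split; [exact: cont_cst|by []|move=> s].
by rewrite mul1r rmorphB.
Qed.

Lemma pdiffM p q t l m : pdiff p t l -> pdiff q t m ->
  pdiff (fun s => p s * q s) t (l * q t + p t * m).
Proof.
move=> fl gm; have gc := pdiff_cont gm.
move: fl gm => [[f [fc <- pf]]] [[r [rc <- qr]]].
split; exists (fun w => f w * q w + p t * r w); split; [| |move=> s].
- by apply: contD; apply: contM; [exact: fc|exact: gc|exact: cont_cst|exact: rc].
- by [].
- by rewrite mulrDl mulrAC -pf -mulrA -qr mulrBl mulrBr addrA subrK.
Qed.

Lemma pdiff_expi (k : R) t : pdiff (fun s => expi (k * s)) t ((0 +i* k) * expi (k * t)).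
Proof.
have -> : (fun s => expi (k * s)) = (fun s => expC ((0 +i* k) * s%:C)).
  by apply/funext => s; rewrite /expi; congr expC; simpc.
have -> : expi (k * t) = expC ((0 +i* k) * t%:C) by rewrite /expi; congr expC; simpc.
rewrite mulrC.
apply: (@cdiff_pdiff _ (fun s => (0 +i* k) * s%:C)); first exact: cdiff_expC.
apply: pdiff_eq (pdiffM (pdiff_cst t (0 +i* k)) (pdiff_realC t)).
by rewrite mul0r add0r mulr1.
Qed.

Lemma slope_is_derive (f q : R -> R) t : {for t, continuous q} ->
  (forall s, f s - f t = q s * (s - t)) -> is_derive t 1 f (q t).
Proof.
move=> qc fq.
have H : h^-1 *: ((f \o shift t) (h *: (1 : R)) - f t) @[h --> (0 : R)^'] --> q t.
  apply/cvgrPdist_lt => e e0.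
  have /cvgrPdist_lt /(_ _ e0) /nbhs_ballP[d /= d0 qd] := qc.
  apply/nbhs_ballP; exists d => //= h; rewrite -ball_normE /= sub0r normrN => hd h0.
  rewrite fq /= -[h *: 1]/(h * 1) mulr1 addrK -[_ *: _]/(_ * _) mulrC mulfK//.
  by apply: qd; rewrite -ball_normE /= opprD addrCA subrr addr0 normrN.
by split; [exact: (cvgP (q t))|exact: cvg_lim H].
Qed.

Lemma cI_FTC a b p p' : a < b -> (forall t, pdiff p t (p' t)) ->
  (forall t, cont_at p' t) -> cI a b p' = p b - p a.
Proof.
move=> ab pp' p'c.
have dr t : is_derive t 1 (fun s => complex.Re (p s)) (complex.Re (p' t)).
  have [[q [qc <- pq]]] := pp' t.
  apply: (@slope_is_derive _ (fun s => complex.Re (q s))).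
    by have /continuous_complex_ReIm[[]] := qc.
  by move=> s; have := pq s; case: (p s) => ? ?; case: (p t) => ? ?; case: (q s) => ? ? /=; simpc => -[].
have di t : is_derive t 1 (fun s => complex.Im (p s)) (complex.Im (p' t)).
  have [[q [qc <- pq]]] := pp' t.
  apply: (@slope_is_derive _ (fun s => complex.Im (q s))).
    by have /continuous_complex_ReIm[_ []] := qc.
  by move=> s; have := pq s; case: (p s) => ? ?; case: (p t) => ? ?; case: (q s) => ? ? /=; simpc => -[].
have ftc (f g : R -> R) : (forall t, is_derive t 1 f (g t)) -> continuous g ->
    \int[lebesgue_measure]_(t in `[a, b]) g t = f b - f a.
  move=> fg gc; have fc : continuous f.
    by move=> t; apply: differentiable_continuous; apply/derivable1_diffP; have [] := fg t.
  rewrite /Rintegral (@continuous_FTC2 R g f)//.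
  - exact: continuous_subspaceT.
  - split; first by move=> t _; have [] := fg t.
      exact: cvg_at_right_filter (fc a).
    exact: cvg_at_left_filter (fc b).
  - by move=> t _; rewrite derive1E; have [] := fg t.
rewrite /cI /cint (ftc _ _ dr) ?(ftc _ _ di).
- by case: (p a) => ? ?; case: (p b).
- by move=> t; have /continuous_complex_ReIm[_ []] := p'c t.
- by move=> t; have /continuous_complex_ReIm[[]] := p'c t.
Qed.

End IntervalIntegral.
#[global] Arguments cint : simpl never.
#[global] Arguments cI : simpl never.
#[global] Arguments normc : simpl never.

(** * Cauchy's theorem and Taylor coefficients on the disc *)

Section Goursat.
Context {R : realType}.
Implicit Types (x y u v s t : R) (G H P A : R[i] -> R[i]).

(** Counterclockwise contour integral over the rectangle with lower left corner [x +i* y], width [u]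
    and height [v]. *)
Definition bd G x y u v : R[i] :=
  (cI x (x + u) (fun s => G (s +i* y)) - cI x (x + u) (fun s => G (s +i* (y + v))))
  + 'i * (cI y (y + v) (fun t => G ((x + u) +i* t)) - cI y (y + v) (fun t => G (x +i* t))).

#[local] Arguments bd : simpl never.

Definition rect_cont G x y u v := forall s t, x <= s <= x + u -> y <= t <= y + v ->
  cont_at G (s +i* t).

Lemma cont_hline y s : cont_at (fun s : R => s +i* y) s.
Proof.
apply/continuous_complex_ReIm; split; split => /=; first exact: cvg_id.
exact: cvg_cst.
Qed.

Lemma cont_vline x t : cont_at (fun t : R => x +i* t) t.
Proof.
apply/continuous_complex_ReIm; split; split => /=; last exact: cvg_id.
exact: cvg_cst.
Qed.

Lemma cont_rect_h G x y u v t : rect_cont G x y u v -> y <= t <= y + v ->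
  forall s, x <= s <= x + u -> cont_at (fun s => G (s +i* t)) s.
Proof. by move=> Gc tv s sx; apply: cont_comp (cont_hline _ _) (Gc _ _ sx tv). Qed.

Lemma cont_rect_v G x y u v s : rect_cont G x y u v -> x <= s <= x + u ->
  forall t, y <= t <= y + v -> cont_at (fun t => G (s +i* t)) t.
Proof. by move=> Gc su t ty; apply: cont_comp (cont_vline _ _) (Gc _ _ su ty). Qed.

Lemma rect_contS G x y u v x' y' u' v' : rect_cont G x y u v ->
  x <= x' -> x' + u' <= x + u -> y <= y' -> y' + v' <= y + v ->
  rect_cont G x' y' u' v'.
Proof. by move=> Gc *; move=> s t /andP[? ?] /andP[? ?]; apply: Gc; apply/andP; split; lra. Qed.

Lemma bd_hsplit G x y u1 u2 v : 0 <= u1 -> 0 <= u2 -> 0 <= v ->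
  rect_cont G x y (u1 + u2) v ->
  bd G x y (u1 + u2) v = bd G x y u1 v + bd G (x + u1) y u2 v.
Proof.
move=> u10 u20 v0 Gc; rewrite /bd addrA.
rewrite (@cI_split _ x (x + u1 + u2) (x + u1)) ?lerDl//; last first.
  by rewrite -addrA; apply: cont_rect_h Gc _; rewrite lexx lerDl.
rewrite (@cI_split _ x (x + u1 + u2) (x + u1) (fun s => G (s +i* (y + v)))) ?lerDl//; last first.
  by rewrite -addrA; apply: cont_rect_h Gc _; rewrite lexx lerDl v0.
by ring.
Qed.

Lemma bd_vsplit G x y u v1 v2 : 0 <= u -> 0 <= v1 -> 0 <= v2 ->
  rect_cont G x y u (v1 + v2) ->
  bd G x y u (v1 + v2) = bd G x y u v1 + bd G x (y + v1) u v2.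
Proof.
move=> u0 v10 v20 Gc; rewrite /bd addrA.
rewrite (@cI_split _ y (y + v1 + v2) (y + v1)) ?lerDl//; last first.
  by rewrite -addrA; apply: cont_rect_v Gc _; rewrite lexx lerDl u0.
rewrite (@cI_split _ y (y + v1 + v2) (y + v1) (fun t => G (x +i* t))) ?lerDl//; last first.
  by rewrite -addrA; apply: cont_rect_v Gc _; rewrite lexx lerDl.
by ring.
Qed.

Lemma bdB G H x y u v : 0 <= u -> 0 <= v -> rect_cont G x y u v ->
  rect_cont H x y u v ->
  bd (fun z => G z - H z) x y u v = bd G x y u v - bd H x y u v.
Proof.
move=> u0 v0 Gc Hc.
have y1 : y <= y <= y + v by rewrite lexx lerDl.
have y2 : y <= y + v <= y + v by rewrite lexx lerDl v0.
have x1 : x <= x <= x + u by rewrite lexx lerDl.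
have x2 : x <= x + u <= x + u by rewrite lexx lerDl u0.
rewrite /bd !cIB; last 8 first.
- exact: cont_rect_v Gc _.
- exact: cont_rect_v Hc _.
- exact: cont_rect_v Gc _.
- exact: cont_rect_v Hc _.
- exact: cont_rect_h Gc _.
- exact: cont_rect_h Hc _.
- exact: cont_rect_h Gc _.
- exact: cont_rect_h Hc _.
by ring.
Qed.

Lemma normc_i : normc ('i : R[i]) = 1.
Proof. by rewrite /normc expr0n expr1n add0r sqrtr1. Qed.

Lemma normc_bd G x y u v (M : R) : 0 <= u -> 0 <= v -> rect_cont G x y u v ->
  (forall s t, x <= s <= x + u -> y <= t <= y + v -> normc (G (s +i* t)) <= M) ->
  normc (bd G x y u v) <= 4 * (M * (u + v)).
Proof.
move=> u0 v0 Gc GM.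
have y1 : y <= y <= y + v by rewrite lexx lerDl.
have y2 : y <= y + v <= y + v by rewrite lexx lerDl v0.
have x1 : x <= x <= x + u by rewrite lexx lerDl.
have x2 : x <= x + u <= x + u by rewrite lexx lerDl u0.
have H1 t : y <= t <= y + v -> normc (cI x (x + u) (fun s => G (s +i* t))) <= 2 * (M * u).
  move=> tv; have := @normc_cI _ x (x + u) (fun s => G (s +i* t)) M.
  rewrite addrAC subrr add0r; apply; first by rewrite lerDl.
    exact: cont_rect_h Gc _.
  by move=> s sx; exact: GM.
have H2 s : x <= s <= x + u -> normc (cI y (y + v) (fun t => G (s +i* t))) <= 2 * (M * v).
  move=> su; have := @normc_cI _ y (y + v) (fun t => G (s +i* t)) M.
  rewrite addrAC subrr add0r; apply; first by rewrite lerDl.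
    exact: cont_rect_v Gc _.
  by move=> t tx; exact: GM.
apply: le_trans (normcD _ _) _; rewrite normcM normc_i mul1r.
have A := normcB (cI x (x + u) (fun s => G (s +i* y))) (cI x (x + u) (fun s => G (s +i* (y + v)))).
have B := normcB (cI y (y + v) (fun t => G ((x + u) +i* t))) (cI y (y + v) (fun t => G (x +i* t))).
have := H1 _ y1; have := H1 _ y2; have := H2 _ x1; have := H2 _ x2.
lra.
Qed.

Lemma bd_primitive P A x y u v : 0 < u -> 0 < v -> (forall z, cdiff P z (A z)) ->
  (forall z, cont_at A z) -> bd A x y u v = 0.
Proof.
move=> u0 v0 PA Ac.
have Hh t : cI x (x + u) (fun s => A (s +i* t)) = P ((x + u) +i* t) - P (x +i* t).
  apply: (@cI_FTC _ _ _ (fun s => P (s +i* t))); first by rewrite ltrDl.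
    move=> s; apply: pdiff_eq (mulr1 _) _; apply: (cdiff_pdiff (PA _)).
    split; exists (fun=> 1); split; [exact: cont_cst|by []|move=> w].
    by simpc.
  by move=> s; exact: cont_comp (cont_hline _ _) (Ac _).
have Hv s : 'i * cI y (y + v) (fun t => A (s +i* t)) = P (s +i* (y + v)) - P (s +i* y).
  rewrite -cIZ; last by move=> t _; exact: cont_comp (cont_vline _ _) (Ac _).
  apply: (@cI_FTC _ _ _ (fun t => P (s +i* t))); first by rewrite ltrDl.
    move=> t; rewrite mulrC; apply: (cdiff_pdiff (PA _)).
    split; exists (fun=> 'i); split; [exact: cont_cst|by []|move=> w].
    by simpc.
  move=> t; apply: contM; first exact: cont_cst.
  exact: cont_comp (cont_vline _ _) (Ac _).
by rewrite /bd mulrBr !Hv !Hh; ring.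
Qed.

Lemma half_pow_lt (w e : R) : 0 < e -> exists n : nat, w / 2 ^+ n < e.
Proof.
move=> e0; exists (Num.Def.archi_bound (w / e)).
rewrite ltr_pdivrMr ?exprn_gt0// mulrC -ltr_pdivrMr//.
exact: upper_nthrootP.
Qed.

(** The contour integrals of the four quarters add up to that of the whole, so they cannot all be
    smaller than a quarter of it. *)
Lemma bd_quarter G a b u v (N : R) : 0 < u -> 0 < v ->
  rect_cont G a b (u + u) (v + v) -> N <= normc (bd G a b (u + u) (v + v)) ->
  exists a' b', [/\ a <= a', a' + u <= a + (u + u), b <= b', b' + v <= b + (v + v) &
    N <= 4 * normc (bd G a' b' u v)].
Proof.
move=> u0 v0 Gc; have [u1 v1] := (ltW u0, ltW v0).
rewrite (bd_hsplit u1 u1 _ Gc) ?addr_ge0// !(bd_vsplit u1 v1 v1); last 2 first.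
- by apply: rect_contS Gc _ _ _ _; lra.
- by apply: rect_contS Gc _ _ _ _; lra.
set A := bd _ _ _ _ _; set B := bd _ _ _ _ _; set C := bd _ _ _ _ _.
set D := bd _ _ _ _ _ => NG.
have {}NG : N <= normc A + normc B + (normc C + normc D).
  by apply: (le_trans NG); apply: le_trans (normcD _ _) _; rewrite lerD ?normcD.
have [hA|hA] := leP N (4 * normc A).
  by exists a, b; rewrite !lexx !lerD2l !lerDl.
have [hB|hB] := leP N (4 * normc B).
  by exists a, (b + v); rewrite -!addrA !lexx !lerD2l !lerDl.
have [hC|hC] := leP N (4 * normc C).
  by exists (a + u), b; rewrite -!addrA !lexx !lerD2l !lerDl.
exists (a + u), (b + v); rewrite -!addrA !lexx !lerDl; split=> //.
by move: (normc A) (normc B) (normc C) (normc D) NG hA hB hC => *; lra.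
Qed.

(** The derivative is not assumed continuous. Quarter repeatedly, keeping a quarter with large
    contour integral, and compare [G] with its affine approximation at the point common to all
    rectangles: the affine part has a primitive and contributes nothing. *)
Lemma goursat G x y u v : 0 < u -> 0 < v ->
  (forall s t, x <= s <= x + u -> y <= t <= y + v -> exists l, cdiff G (s +i* t) l) ->
  bd G x y u v = 0.
Proof.
move=> u0 v0 Gd; have Gc : rect_cont G x y u v.
  by move=> s t sx ty; have [l /cdiff_continuous] := Gd _ _ sx ty.
apply/eqP/negP => /negP; rewrite -normc_gt0; set N := normc _ => N0.
pose un n : R := u / 2 ^+ n; pose vn n : R := v / 2 ^+ n.
have un0 n : 0 < un n by rewrite divr_gt0 ?exprn_gt0.
have vn0 n : 0 < vn n by rewrite divr_gt0 ?exprn_gt0.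
have unS n : un n = un n.+1 + un n.+1 by rewrite /un exprS; field.
have vnS n : vn n = vn n.+1 + vn n.+1 by rewrite /vn exprS; field.
pose good (p : nat * (R * R)) := [/\ x <= p.2.1, p.2.1 + un p.1 <= x + u,
  y <= p.2.2, p.2.2 + vn p.1 <= y + v &
  N <= 4 ^+ p.1 * normc (bd G p.2.1 p.2.2 (un p.1) (vn p.1))].
(* The implication makes [next] total: outside [good] any successor will do, so dependent choice
   applies without a subtype. *)
pose next (p q : nat * (R * R)) := q.1 = p.1.+1 /\ (good p ->
  [/\ good q, p.2.1 <= q.2.1, q.2.1 + un q.1 <= p.2.1 + un p.1,
     p.2.2 <= q.2.2 & q.2.2 + vn q.1 <= p.2.2 + vn p.1]).
have step p : {q | next p q}.
  apply: cid; case: p => n [a b].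
  have [[/= ax au bY bV NG]|ng] := pselect (good (n, (a, b))); last first.
    by exists (n.+1, (a, b)); split.
  have q0 : 0 < 4 ^+ n :> R by rewrite exprn_gt0.
  have [||||a' [b' [a1 a2 b1 b2 NN]]] := @bd_quarter G a b (un n.+1) (vn n.+1) (N / 4 ^+ n) => //.
  - by rewrite -unS -vnS; exact: rect_contS Gc _ _ _ _.
  - by rewrite -unS -vnS ler_pdivrMr// mulrC.
  rewrite -unS in a2; rewrite -vnS in b2.
  exists (n.+1, (a', b')); split=> // _; split=> //; split=> //=.
  - exact: le_trans a1.
  - exact: le_trans au.
  - exact: le_trans b1.
  - exact: le_trans bV.
  - by rewrite exprS mulrAC -ler_pdivrMr.
have [c [c0 cS]] := dependent_choice step (0%N, (x, y)).
have c1 n : (c n).1 = n by elim: n => [|n IH]; [rewrite c0|rewrite (cS n).1 IH].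
have cg n : good (c n).
  elim: n => [|n IH]; last by have [_ /(_ IH)[]] := cS n.
  rewrite c0 /good /= /un /vn !expr0 !divr1; split => //; try lra.
  by rewrite mul1r.
pose X n := (c n).2.1; pose Y n := (c n).2.2.
have mono m n : (m <= n)%N -> [/\ X m <= X n, X n + un n <= X m + un m,
    Y m <= Y n & Y n + vn n <= Y m + vn m].
  elim: n => [|n IH]; first by rewrite leqn0 => /eqP ->.
  rewrite leq_eqVlt ltnS => /predU1P[<-//|/IH[? ? ? ?]].
  have [_ /(_ (cg n))[_]] := cS n; rewrite !c1 -/(X n) -/(Y n) -/(X n.+1) -/(Y n.+1).
  by move=> *; split; lra.
have lim (Z wn : nat -> R) : (forall n, 0 < wn n) ->
    (forall m n, (m <= n)%N -> Z m <= Z n /\ Z n + wn n <= Z m + wn m) ->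
    exists z, forall n, Z n <= z <= Z n + wn n.
  move=> wn0 Zm; exists (sup (range Z)) => n.
  have ub m : Z m <= Z n + wn n.
    have [mn|/ltnW nm] := leqP m n; first by have := Zm _ _ mn; have := wn0 n; lra.
    by have := Zm _ _ nm; have := wn0 m; lra.
  apply/andP; split.
    apply: ub_le_sup; last by exists n.
    by exists (Z n + wn n) => _ [m _ <-].
  by apply: ge_sup; [exists (Z 0%N), 0%N|move=> _ [m _ <-]].
have [X0 HX] := lim X un un0 (fun m n mn => let: And4 a b _ _ := mono m n mn in conj a b).
have [Y0 HY] := lim Y vn vn0 (fun m n mn => let: And4 _ _ a b := mono m n mn in conj a b).
have [l Gl] : exists l, cdiff G (X0 +i* Y0) l.
  apply: Gd.
    by have := HX 0%N; rewrite /X c0 /un expr0 divr1.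
  by have := HY 0%N; rewrite /Y c0 /vn expr0 divr1.
(* The error on the n-th rectangle is at most 4 e (u + v)^2 / 4^n. With this [e] it is (N / 2) /
   4^n, half of what the selection of rectangles guarantees. *)
pose e := N / (8 * (u + v) ^+ 2).
have uv0 : 0 < u + v by rewrite addr_gt0.
have e0 : 0 < e by rewrite divr_gt0// mulr_gt0// exprn_gt0.
have [d d0 H] := cdiff_eps Gl e0.
have [n nd] := half_pow_lt (u + v) d0.
pose A z := G (X0 +i* Y0) + l * (z - (X0 +i* Y0)).
have Ac z : cont_at A z.
  apply: contD; first exact: cont_cst.
  apply: contM; first exact: cont_cst.
  by apply: contB; [exact: cont_id|exact: cont_cst].
pose P z := G (X0 +i* Y0) * z + (l / 2%:R) * ((z - (X0 +i* Y0)) * (z - (X0 +i* Y0))).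
have PA z : cdiff P z (A z).
  have D1 : cdiff (fun z => z - (X0 +i* Y0)) z 1.
    by apply: cdiff_eq (cdiffB (cdiff_id z) (cdiff_cst _ _)); rewrite subr0.
  apply: cdiff_eq (cdiffD (cdiffZ _ (cdiff_id z)) (cdiffZ _ (cdiffM D1 D1))).
  by rewrite /A; move: (z - _) => k; field.
have [ax au bY bv NG] := cg n; rewrite c1 -/(X n) -/(Y n) in ax au bY bv NG.
have Gcn : rect_cont G (X n) (Y n) (un n) (vn n) by exact: rect_contS Gc _ _ _ _.
have uvn : un n + vn n = (u + v) / 2 ^+ n by rewrite /un /vn mulrDl.
have HB : normc (bd (fun z => G z - A z) (X n) (Y n) (un n) (vn n)) <=
    4 * (e * (un n + vn n) * (un n + vn n)).
  apply: normc_bd; [exact: ltW|exact: ltW| |].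
    by move=> s t sx ty; apply: contB; [exact: Gcn|exact: Ac].
  move=> s t /andP[s1 s2] /andP[t1 t2].
  have zle : normc (s +i* t - (X0 +i* Y0)) <= un n + vn n.
    apply: le_trans (normc_le _) _; rewrite lerD// /= ler_norml.
      by have /andP[? ?] := HX n; apply/andP; split; lra.
    by have /andP[? ?] := HY n; apply/andP; split; lra.
  have := H (s +i* t - (X0 +i* Y0)); rewrite (addrC (X0 +i* Y0)) subrK /A opprD addrA => H'.
  by apply: le_trans (H' _) _; [rewrite (le_lt_trans zle)// uvn|rewrite ler_pM2l].
rewrite (bdB (ltW (un0 n)) (ltW (vn0 n)) Gcn (fun s t _ _ => Ac _)) in HB.
rewrite (bd_primitive (X n) (Y n) (un0 n) (vn0 n) PA Ac) subr0 in HB.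
move: NG; apply/negP; rewrite -ltNge.
have q0 : 0 < 4 ^+ n :> R by rewrite exprn_gt0.
apply: (@le_lt_trans _ _ (4 ^+ n * (4 * (e * (un n + vn n) * (un n + vn n))))).
  by rewrite ler_pM2l.
rewrite uvn /e.
have -> : 4 ^+ n = (2 ^+ n) ^+ 2 :> R by rewrite exprAC; congr (_ ^+ _); ring.
have : 2 ^+ n != 0 :> R by rewrite expf_neq0.
move: (2 ^+ n) => q qn0.
rewrite [ltLHS](_ : _ = N / 2); first by rewrite ltr_pdivrMr// ltr_pMr// ltr1n.
by field; rewrite qn0 gt_eqF.
Qed.

End Goursat.
#[global] Arguments bd : simpl never.

(** * Integrals over circles and Cauchy's formula *)

Section CircleMeans.
Context {R : realType}.
Implicit Types (r s t : R) (z w : R[i]) (f g : R[i] -> R[i]).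

Definition circ f r : R[i] := cI 0 (2 * pi) (fun t => f (r%:C * expi t)).

Lemma pi2_gt0 : 0 < 2 * pi :> R.
Proof. by rewrite mulr_gt0// pi_gt0. Qed.

Lemma normc_realM r z : normc (r%:C * z) = `|r| * normc z.
Proof. by rewrite normcM normc_real. Qed.

Lemma normc_circle r t : normc (r%:C * expi t) = `|r|.
Proof. by rewrite normc_realM normc_expi mulr1. Qed.

Lemma cont_circle r t : cont_at (fun t => r%:C * expi t) t.
Proof. by apply: contM; [exact: cont_cst|exact: cont_expi]. Qed.

Lemma cont_on_circle f r : (forall z, normc z = `|r| -> cont_at f z) ->
  forall t, cont_at (fun t => f (r%:C * expi t)) t.
Proof.
by move=> fc t; apply: cont_comp (cont_circle _ _) (fc _ (normc_circle _ _)).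
Qed.

(** The exponential wraps the rectangle [ln r1, ln r2] x [0, 2 pi] around the annulus. In Goursat's
    theorem for [f] composed with [expC] the horizontal sides cancel by periodicity, and the
    vertical ones are the two circles. *)
Lemma circ_annulus f r1 r2 : 0 < r1 -> r1 < r2 ->
  (forall z, r1 <= normc z <= r2 -> exists l, cdiff f z l) ->
  circ f r1 = circ f r2.
Proof.
move=> r10 r12 fd; have r20 : 0 < r2 by exact: lt_trans r12.
have l12 : ln r1 < ln r2 by rewrite ltr_ln.
have := @goursat R (fun w => f (expC w)) (ln r1) 0 (ln r2 - ln r1) (2 * pi).
rewrite subr_gt0 => /(_ l12 pi2_gt0) H.
have {}H : bd (fun w => f (expC w)) (ln r1) 0 (ln r2 - ln r1) (2 * pi) = 0.
  apply: H => s t /andP[s1 s2] _.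
  have [|l fl] := fd (expC (s +i* t)).
    rewrite normc_expC /=; move: s2; rewrite addrC subrK => s2.
    by rewrite -(lnK r10) -(lnK r20) !ler_expR s1.
  by exists (l * expC (s +i* t)); exact: cdiff_comp (cdiff_expC _) fl.
move: H; rewrite /bd add0r.
have -> : (fun s => f (expC (s +i* (2 * pi)))) = (fun s => f (expC (s +i* 0))).
  by apply/funext => s; rewrite !expCE expi2pi expi0.
rewrite subrr add0r (addrC (ln r1)) subrK => /eqP.
rewrite mulf_eq0 -normc_eq0 normc_i oner_eq0 /= subr_eq0 => /eqP.
under [X in X = _ -> _]eq_cI do rewrite expCE lnK//.
by under [X in _ = X -> _]eq_cI do rewrite expCE lnK//.
Qed.

Lemma cont_polar f r t : cont_at f (r%:C * expi t) ->
  cont_at (fun p : R * R => f (p.1%:C * expi p.2)) (r, t).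
Proof.
move=> fc; apply: (@cont_comp _ _ _ (fun p : R * R => p.1%:C * expi p.2) f); last exact: fc.
apply: contM.
  apply: (@cont_comp _ _ _ fst (fun s : R => s%:C)); last exact: cont_realC.
  by split; exact: cvg_fst.
apply: (@cont_comp _ _ _ snd (@expi R)); last exact: cont_expi.
by split; exact: cvg_snd.
Qed.

(** Compactness is taken from the rectangle of polar coordinates, a product of two real segments. *)
Lemma disc_bounded f r : 0 <= r -> (forall z, normc z <= r -> cont_at f z) ->
  exists2 M, 0 < M & forall s t, `|s| <= r -> 0 <= t <= 2 * pi ->
    normc (f (s%:C * expi t)) <= M.
Proof.
move=> r0 fc.
pose A : set (R * R) := `[- r, r] `*` `[0, 2 * pi].
have cA : compact A by apply: compact_setX; exact: segment_compact.
have A0 : A !=set0.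
  by exists (0, 0); split => /=; rewrite in_itv /= ?oppr_le0 ?r0 ?lexx ?(ltW pi2_gt0).
have [|c _ H] := compact_EVT_max (f := fun p : R * R => normc (f (p.1%:C * expi p.2))) A0 cA.
  apply: continuous_in_subspaceT => -[s t] /set_mem [/=]; rewrite !in_itv /= => hs ht.
  have [] : cont_at (fun p : R * R => normc (f (p.1%:C * expi p.2))) (s, t); last by [].
  apply: (@cont_comp _ _ _ _ (@normc R : R[i] -> R)); last exact: continuous_normc.
  by apply: cont_polar; apply: fc; rewrite normc_circle ler_norml.
exists (normc (f (c.1%:C * expi c.2)) + 1); first by rewrite ltr_wpDl ?normc_ge0.
move=> s t hs ht; rewrite ler_wpDr//; apply: (H (s, t)).
by apply/mem_set; split; rewrite /= in_itv//= -ler_norml.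
Qed.

(** Radius 0 is included: there the circle degenerates to its centre, which identifies the common
    value of the circle integrals. *)
Lemma circ_cont f r : (forall z, normc z < 1 -> cont_at f z) -> `|r| < 1 ->
  cont_at (circ f) r.
Proof.
move=> fc r1; pose v := (`|r| + 1) / 2.
have rv : `|r| < v by rewrite /v; lra.
have v1 : v < 1 by rewrite /v; lra.
have v0 : 0 <= v by rewrite /v; have := normr_ge0 r; lra.
have [|M M0 HM] := @disc_bounded f v v0.
  by move=> z zv; apply: fc; exact: le_lt_trans v1.
have Hi l : `]- v, v[%classic l -> cintegrable lebesgue_measure `[0, 2 * pi] (fun t => f (l%:C * expi t)).
  rewrite /= in_itv /= -ltr_norml => lv; apply: cont_cintegrable => t _.
  by apply: cont_on_circle => z zl; apply: fc; rewrite zl (lt_trans lv).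
have rin : r \in `]- v, v[%classic by rewrite inE /= in_itv /= -ltr_norml.
have Hb l : `]- v, v[%classic l -> forall t, `[0, 2 * pi]%classic t -> normc (f (l%:C * expi t)) <= M.
  by rewrite /= in_itv /= -ltr_norml => lv t /=; rewrite in_itv /= => ht; rewrite HM// ltW.
have Hc l t : `]- v, v[%classic l -> cont_at (fun l : R => f (l%:C * expi t)) l.
  rewrite /= in_itv /= -ltr_norml => lv.
  apply: (@cont_comp _ _ _ (fun l : R => l%:C * expi t) f); last first.
    by apply: fc; rewrite normc_circle (lt_trans lv).
  by apply: contM; [exact: cont_realC|exact: cont_cst].
apply/continuous_complex_ReIm; split; split.
  apply: (@continuity_under_integral R _ _ lebesgue_measure (fun l t => complex.Re (f (l%:C * expi t)))
    `[0, 2 * pi] _ (- v) v _ _ (fun=> M) _ _ r rin) => //.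
  - by move=> l /Hi[].
  - apply: aeW => t _ l /set_mem lv.
    by have /continuous_complex_ReIm[[]] := Hc _ t lv.
  - exact: integrable_itv_cst.
  - by move=> l lv; apply: aeW => t tp; rewrite (le_trans (normc_Re _))// Hb.
apply: (@continuity_under_integral R _ _ lebesgue_measure (fun l t => complex.Im (f (l%:C * expi t)))
    `[0, 2 * pi] _ (- v) v _ _ (fun=> M) _ _ r rin) => //.
- by move=> l /Hi[].
- apply: aeW => t _ l /set_mem lv.
  by have /continuous_complex_ReIm[_ []] := Hc _ t lv.
- exact: integrable_itv_cst.
- by move=> l lv; apply: aeW => t tp; rewrite (le_trans (normc_Im _))// Hb.
Qed.

Lemma cont_at_realP (p : R -> R[i]) r : cont_at p r -> forall e : R, 0 < e ->
  exists2 d : R, 0 < d & forall s, `|s - r| < d -> normc (p r - p s) < e.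
Proof.
move=> /cont_near H e /H /nbhs_ballP[d /= d0 dH]; exists d => // s sd.
by apply: dH; rewrite -ball_normE /= distrC.
Qed.

Lemma eq_normc_lt z w : (forall e : R, 0 < e -> normc (z - w) < e) -> z = w.
Proof.
move=> H; apply/eqP; rewrite -subr_eq0 -normc_eq0; apply/eqP.
apply/eqP; rewrite eq_le normc_ge0 andbT leNgt; apply/negP => n0.
by have := H _ n0; rewrite ltxx.
Qed.

(** Continuity carries the equality from open ranges of radii to their ends, across [r0] and down to
    0. *)
Lemma const_off_point (p : R -> R[i]) r0 : (forall r, `|r| < 1 -> cont_at p r) ->
  (forall r s, 0 < r -> r < s -> s < 1 -> (s < r0 \/ r0 < r) -> p r = p s) ->
  forall r, 0 <= r < 1 -> p r = p 0.
Proof.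
move=> pc pe.
have A a b : 0 <= a -> a < b -> b < 1 -> (b <= r0 \/ r0 <= a) -> p a = p b.
  move=> a0 ab b1 r0ab; apply: eq_normc_lt => e e0.
  have e2 : 0 < e / 2 by rewrite divr_gt0.
  have [d d0 H] := cont_at_realP (pc a (ltac:(rewrite ger0_norm//; lra))) e2.
  have [d' d'0 H'] := cont_at_realP (pc b (ltac:(rewrite ger0_norm//; lra))) e2.
  pose k := Num.min (Num.min d d') (b - a) / 3.
  have k0 : 0 < k by rewrite divr_gt0// !lt_min d0 d'0 subr_gt0.
  have [kd kd' kab] : [/\ k < d, k < d' & k < (b - a) / 2].
    have m1 : Num.min (Num.min d d') (b - a) <= d by rewrite !ge_min lexx.
    have m2 : Num.min (Num.min d d') (b - a) <= d' by rewrite !ge_min lexx orbT.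
    have m3 : Num.min (Num.min d d') (b - a) <= b - a by rewrite !ge_min lexx orbT.
    by rewrite /k; split; lra.
  have E : p (a + k) = p (b - k).
    by apply: pe; [lra|lra|lra|case: r0ab => ?; [left|right]; lra].
  apply: le_lt_trans (normc_triangle (p (a + k)) _ _) _.
  rewrite (splitr e) ltrD//; first by apply: H; rewrite addrAC subrr add0r gtr0_norm.
  rewrite E normcBC; apply: H'.
  by rewrite addrAC subrr add0r normrN gtr0_norm.
move=> r /andP[r_ge0 r1]; have [->//|rn0] := eqVneq r 0.
have r_gt0 : 0 < r by rewrite lt_neqAle eq_sym rn0.
have [h|h] := leP r r0; first by apply/esym/A => //; left.
have [h0|h0] := leP r0 0; first by apply/esym/A => //; right.
rewrite -(A r0 r) ?(ltW h0)//; last by right.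
by apply/esym/A => //; [lra|left].
Qed.

(** One exceptional circle is allowed because the slope of a function at [z0] is only known to be
    continuous at [z0]; with |z0| for [r0], the annuli used avoid that point. *)
Lemma circ_off f r0 : (forall z, normc z < 1 -> cont_at f z) ->
  (forall z, 0 < normc z < 1 -> normc z != r0 -> exists l, cdiff f z l) ->
  forall r, 0 <= r < 1 -> circ f r = (2 * pi)%:C * f 0.
Proof.
move=> fc fd r r01.
rewrite (@const_off_point (circ f) r0 _ _ r r01).
- rewrite /circ; under eq_cI do rewrite mul0r.
  by rewrite cI_cst ?(ltW pi2_gt0)// subr0 mulrC.
- by move=> s s1; exact: circ_cont.
- move=> a b a0 ab b1 r0ab; apply: circ_annulus => // z /andP[az zb].
  apply: fd; first by apply/andP; split; lra.
  by apply/eqP => zr0; case: r0ab; lra.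
Qed.

Lemma circ_mean f : (forall z, normc z < 1 -> exists l, cdiff f z l) ->
  forall r, 0 <= r < 1 -> circ f r = (2 * pi)%:C * f 0.
Proof.
move=> fd; apply: (@circ_off _ 2) => z.
  by move=> /fd[l]; exact: cdiff_continuous.
by move=> /andP[_ /fd[l fl]] _; exists l.
Qed.

Lemma circ_kernel z0 r : normc z0 < r -> circ (fun w => w / (w - z0)) r = (2 * pi)%:C.
Proof.
move=> z0r; have r0 : 0 < r by exact: le_lt_trans (normc_ge0 _) z0r.
have nz w : r <= normc w -> w - z0 != 0.
  move=> rw; apply/eqP => /eqP; rewrite subr_eq0 => /eqP wz.
  by move: rw; rewrite wz leNgt z0r.
have kd w : r <= normc w -> exists l, cdiff (fun w => w / (w - z0)) w l.
  move=> rw; eexists; apply: cdiffM; first exact: cdiff_id.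
  apply: (@cdiff_comp _ (fun w => w - z0)).
    exact: (cdiffB (cdiff_id w) (cdiff_cst _ _)).
  by apply: cdiffV; exact: nz.
apply: eq_normc_lt => e e0.
(* The integral is independent of the radius, and at radius [s] the integrand differs from 1 by at
   most |z0| / (s - |z0|); [s] is so large that 4 pi times this is below [e]. *)
pose s := Num.max (r + 1) (normc z0 * (1 + 8 * pi / e) + 1).
have rs : r < s by rewrite lt_max; apply/orP; left; lra.
have s1 : normc z0 * (1 + 8 * pi / e) + 1 <= s by rewrite le_max lexx orbT.
rewrite (circ_annulus r0 rs); last by move=> w /andP[/kd].
have -> : (2 * pi)%:C = cI 0 (2 * pi) (fun=> 1) :> R[i].
  by rewrite cI_cst ?(ltW pi2_gt0)// subr0 mul1r.
have s0 : 0 < s by exact: lt_trans rs.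
rewrite -cIB; last 2 first.
- move=> t _; apply: (@cont_on_circle (fun w => w / (w - z0))) => w ws.
  have [|l] := kd w; first by rewrite ws gtr0_norm// ltW.
  exact: cdiff_continuous.
- by move=> t _; exact: cont_cst.
have sz0 : 0 < s - normc z0 by rewrite subr_gt0 (lt_trans z0r).
have H t : 0 <= t <= 2 * pi ->
    normc ((s%:C * expi t) / (s%:C * expi t - z0) - 1) <= normc z0 / (s - normc z0).
  move=> _; set w := s%:C * expi t.
  have nw : normc w = s by rewrite normc_circle gtr0_norm.
  have wz : w - z0 != 0 by apply: nz; rewrite nw ltW.
  have -> : w / (w - z0) - 1 = z0 / (w - z0) by field.
  rewrite normc_div ler_wpM2l ?normc_ge0// lef_pV2 ?posrE//.
    by rewrite -nw normc_lerB.
  by rewrite normc_gt0.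
have := @normc_cI _ 0 (2 * pi) _ _ (ltW pi2_gt0) _ H.
move=> /(_ _)/le_lt_trans; apply.
  move=> t _; apply: contB; last exact: cont_cst.
  apply: (@cont_on_circle (fun w => w / (w - z0))) => w ws.
  have [|l] := kd w; first by rewrite ws gtr0_norm// ltW.
  exact: cdiff_continuous.
rewrite subr0 mulrAC mulrA ltr_pdivrMr//.
have z00 := normc_ge0 z0.
have E : normc z0 * (8 * pi) = normc z0 * (8 * pi / e) * e.
  by rewrite -mulrA divfK ?gt_eqF.
have : normc z0 * (8 * pi / e) * e < (s - normc z0) * e by rewrite ltr_pM2r//; lra.
by rewrite -E; have := mulr_ge0 z00 (pi_ge0 R); lra.
Qed.

(** With [q] the slope of [f] at [z0], the function w q(w) vanishes at 0, so its circle integral is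
    0. Writing it as (f w - f z0) w / (w - z0) leaves only [circ_kernel] to evaluate. *)
Lemma cauchy_formula f z0 r : (forall z, normc z < 1 -> exists l, cdiff f z l) ->
  normc z0 < r -> r < 1 ->
  circ (fun w => f w * (w / (w - z0))) r = (2 * pi)%:C * f z0.
Proof.
move=> fd z0r r1; have r0 : 0 < r by exact: le_lt_trans (normc_ge0 _) z0r.
have [l0 fl0] := fd z0 (lt_trans z0r r1).
have /cdiff_slope[q [qc ql fq]] := fl0.
have qE w : w != z0 -> q w = (f w - f z0) / (w - z0).
  by move=> wz; rewrite fq mulfK// subr_eq0.
have qd w : normc w < 1 -> w != z0 -> exists l, cdiff q w l.
  move=> w1 wz; have [l fl] := fd w w1; eexists.
  apply: (@cdiff_near _ (fun w => (f w - f z0) / (w - z0))).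
    apply/nbhs_complexP; exists (normc (w - z0)); first by rewrite normc_gt0 subr_eq0.
    move=> v vw; rewrite qE//; apply: contraTneq vw => ->.
    by rewrite normcBC ltxx.
  apply: cdiffM; first exact: cdiffB fl (cdiff_cst _ _).
  apply: (@cdiff_comp _ (fun w => w - z0)).
    exact: (cdiffB (cdiff_id w) (cdiff_cst _ _)).
  by apply: cdiffV; rewrite subr_eq0.
have qc' w : normc w < 1 -> cont_at q w.
  move=> w1; have [->//|wz] := eqVneq w z0.
  by have [l /cdiff_continuous] := qd w w1 wz.
have := @circ_off (fun w => w * q w) (normc z0) _ _ r.
rewrite mul0r mulr0 (ltW r0) r1 => H.
have {}H : circ (fun w => w * q w) r = 0.
  apply: H => //; first by move=> w w1; apply: contM (cont_id _) (qc' _ w1).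
  move=> w /andP[_ w1] wz; have [|l ql'] := qd w w1; first by apply: contra wz => /eqP ->.
  by eexists; exact: cdiffM (cdiff_id _) ql'.
have nz w : normc w = `|r| -> w - z0 != 0.
  rewrite gtr0_norm// => wr; rewrite subr_eq0; apply/eqP => wz.
  by move: z0r; rewrite -wz wr ltxx.
have kc w : normc w = `|r| -> cont_at (fun w => w / (w - z0)) w.
  move=> wr; apply: contM; first exact: cont_id.
  apply: contV; first exact: nz.
  by apply: contB; [exact: cont_id|exact: cont_cst].
have fc w : normc w = `|r| -> cont_at f w.
  by rewrite gtr0_norm// => wr; have [|l /cdiff_continuous] := fd w; rewrite ?wr.
have E : circ (fun w => f w * (w / (w - z0)) - f z0 * (w / (w - z0))) r = 0.
  rewrite -H /circ; apply: eq_cI => t _; set w := r%:C * expi t.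
  have wr : normc w = `|r| by rewrite normc_circle.
  have wz : w - z0 != 0 by exact: nz.
  by rewrite qE -1?subr_eq0// -mulrBl mulrCA.
move: E; rewrite /circ cIB.
- rewrite cIZ; last by move=> t _; exact: (@cont_on_circle (fun w => w / (w - z0)) r kc).
  have /= := circ_kernel z0r; rewrite /circ => ->.
  by move=> /eqP; rewrite subr_eq0 => /eqP ->; rewrite mulrC.
- move=> t _; apply: (@cont_on_circle (fun w => f w * (w / (w - z0)))) => w wr.
  by apply: contM; [exact: fc|exact: kc].
- move=> t _; apply: (@cont_on_circle (fun w => f z0 * (w / (w - z0)))) => w wr.
  by apply: contM; [exact: cont_cst|exact: kc].
Qed.

End CircleMeans.
#[global] Arguments circ : simpl never.

(** * Fourier coefficients and Bessel's identity *)

Section Fourier.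
Context {R : realType}.
Implicit Types (r s t : R) (z w : R[i]) (f g : R[i] -> R[i]) (p q : R -> R[i]).

Definition rint (u : R -> R) : R := \int[lebesgue_measure]_(t in `[0, 2 * pi]) u t.

Lemma expiN t : expi (- t) = (expi t)^-1 :> R[i].
Proof. by rewrite -expCN; congr expC; simpc. Qed.

Lemma expi_nat (n : nat) t : expi (n%:R * t) = expi t ^+ n :> R[i].
Proof.
elim: n => [|n IH]; first by rewrite mul0r expi0 expr0.
by rewrite -natr1 mulrDl mul1r expiD IH exprSr.
Qed.

Lemma cont_expi_lin (k : R) t : cont_at (fun t => expi (k * t)) t.
Proof. exact: pdiff_cont (pdiff_expi k t). Qed.

Lemma cI_expi (n m : nat) : n != m ->
  cI 0 (2 * pi) (fun t => expi (n%:R * t) * expi (- (m%:R * t))) = 0.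
Proof.
move=> nm; pose k : R := n%:R - m%:R.
have k0 : k != 0 by rewrite subr_eq0 eqr_nat.
have : cI 0 (2 * pi) (fun t => (0 +i* k) * expi (k * t)) = 0.
  rewrite (@cI_FTC _ _ _ (fun t => expi (k * t)) _ pi2_gt0).
  - rewrite mulr0 expi0 /k mulrBl expiD expiN (expi_nat n) (expi_nat m) expi2pi.
    by rewrite !expr1n divff ?oner_eq0// subrr.
  - by move=> t; exact: pdiff_expi.
  - by move=> t; apply: contM; [exact: cont_cst|exact: cont_expi_lin].
rewrite cIZ; last by move=> t _; exact: cont_expi_lin.
move=> /eqP; rewrite mulf_eq0 eq_complex /= eqxx (negbTE k0) /= => /eqP <-.
by apply: eq_cI => t _; rewrite -expiD mulrBl.
Qed.

Lemma rint_integrable (u : R -> R) : (forall t, cont_at u t) ->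
  lebesgue_measure.-integrable `[0, 2 * pi] (EFin \o u).
Proof.
move=> uc; apply: continuous_compact_integrable; first exact: segment_compact.
by apply: continuous_subspaceT => t; have [] := uc t.
Qed.

Lemma cont_real (p : R -> R[i]) t : cont_at p t -> cont_at (fun t => complex.Re (p t)) t.
Proof. by move=> /continuous_complex_ReIm[]. Qed.

Lemma cont_sqr_normc (T : topologicalType) (p : T -> R[i]) x : cont_at p x ->
  cont_at (fun x => normc (p x) ^+ 2) x.
Proof.
move=> pc; have [nc] := cont_comp pc (continuous_normc (p x)).
by split; under eq_fun do rewrite expr2; rewrite expr2; exact: (cvgM nc nc).
Qed.

Definition fcoef p (n : nat) : R[i] :=
  cI 0 (2 * pi) (fun t => p t * expi (- (n%:R * t))).

Lemma cont_fcoef p n t : cont_at p t -> cont_at (fun t => p t * expi (- (n%:R * t))) t.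
Proof.
move=> pc; apply: contM => //.
by under eq_fun do rewrite -mulNr; exact: cont_expi_lin.
Qed.

Lemma sqr_normcB_unit (a c e : R[i]) : normc e = 1 ->
  normc (a - c * e) ^+ 2 =
  normc a ^+ 2 - 2 * complex.Re (conjc c * (a * e^-1)) + normc c ^+ 2.
Proof.
move=> e1; have e2 : complex.Re e ^+ 2 + complex.Im e ^+ 2 = 1.
  by rewrite -sqr_normc e1 expr1n.
have -> : e^-1 = conjc e.
  have e0 : e != 0 by rewrite -normc_eq0 e1 oner_eq0.
  apply: (mulfI e0); rewrite divff//; case: e e2 {e0 e1} => x y /= e2; simpc.
  by rewrite -!expr2 e2 (mulrC y) addNr.
rewrite !sqr_normc; case: a => a1 a2; case: c => c1 c2; case: e e1 e2 => x y _ /= e2.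
have -> : c1 ^+ 2 + c2 ^+ 2 = (c1 ^+ 2 + c2 ^+ 2) * (x ^+ 2 + y ^+ 2) by rewrite e2 mulr1.
by ring.
Qed.

(** An identity and not just an inequality, because the left side is needed later as the exact size
    of a Taylor tail. Terms are removed one at a time: subtracting one leaves the coefficients of
    higher index unchanged. *)
Lemma bessel p (c : nat -> R[i]) : (forall t, cont_at p t) ->
  (forall n, fcoef p n = (2 * pi)%:C * c n) -> forall N,
  rint (fun t => normc (p t - \sum_(n < N) c n * expi (n%:R * t)) ^+ 2) =
  rint (fun t => normc (p t) ^+ 2) - 2 * pi * \sum_(n < N) normc (c n) ^+ 2.
Proof.
move=> pc cp N; pose pN N t := p t - \sum_(n < N) c n * expi (n%:R * t).
have pS M t : pN M.+1 t = pN M t - c M * expi (M%:R * t).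
  by rewrite /pN big_ord_recr /= opprD addrA.
have pNc M t : cont_at (pN M) t.
  elim: M => [|M IH].
    by rewrite /pN; under eq_fun do rewrite big_ord0 subr0.
  have -> : pN M.+1 = fun t => pN M t - c M * expi (M%:R * t) by apply/funext => ?; exact: pS.
  apply: contB => //; apply: contM; first exact: cont_cst.
  exact: cont_expi_lin.
have fN M m : (M <= m)%N -> fcoef (pN M) m = (2 * pi)%:C * c m.
  elim: M => [_|M IH Mm].
    by rewrite -cp; apply: eq_cI => t _; rewrite /pN big_ord0 subr0.
  rewrite -(IH (ltnW Mm)) /fcoef.
  under eq_cI do rewrite pS mulrBl.
  rewrite cIB; last 2 first.
  - by move=> t _; exact: cont_fcoef.
  - move=> t _; apply: (@cont_fcoef (fun t => c M * expi (M%:R * t))).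
    by apply: contM; [exact: cont_cst|exact: cont_expi_lin].
  under [X in _ - X]eq_cI do rewrite -mulrA.
  rewrite cIZ; last by move=> t _; apply: cont_fcoef; exact: cont_expi_lin.
  by rewrite cI_expi ?mulr0 ?subr0// ltn_eqF.
elim: N => [|N IH].
  rewrite big_ord0 mulr0 subr0; apply: eq_Rintegral => t _.
  by rewrite big_ord0 subr0.
rewrite big_ord_recr /= mulrDr opprD addrA -IH.
rewrite -/(pN N) -/(pN N.+1).
transitivity (rint (fun t => (normc (pN N t) ^+ 2 + normc (c N) ^+ 2) -
    2 * complex.Re (conjc (c N) * (pN N t * expi (- (N%:R * t)))))).
  apply: eq_Rintegral => t _; rewrite -/(pN N.+1 t) pS sqr_normcB_unit ?normc_expi//.
  by rewrite expiN addrAC.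
have i1 : lebesgue_measure.-integrable `[0, 2 * pi] (EFin \o (fun t => normc (pN N t) ^+ 2)).
  by apply: rint_integrable => t; exact: cont_sqr_normc.
have i2 := @integrable_itv_cst R 0 (2 * pi) (normc (c N) ^+ 2).
have fc : forall t, 0 <= t <= 2 * pi -> cont_at (fun t => pN N t * expi (- (N%:R * t))) t.
  by move=> t _; exact: cont_fcoef.
have i3 : lebesgue_measure.-integrable `[0, 2 * pi]
    (EFin \o (fun t => complex.Re (conjc (c N) * (pN N t * expi (- (N%:R * t)))))).
  apply: rint_integrable => t; apply: cont_real; apply: contM; first exact: cont_cst.
  exact: cont_fcoef.
rewrite /rint RintegralB//; last 2 first.
- by apply: eq_integrable (integrableD _ i1 i2) => //.
- by apply: eq_integrable (integrableZl _ 2 i3) => //.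
rewrite RintegralD// Rintegral_cst// RintegralZl//.
have -> : \int[lebesgue_measure]_(x in `[0, 2 * pi])
    complex.Re (conjc (c N) * (pN N x * expi (- (N%:R * x)))) =
    complex.Re (conjc (c N) * fcoef (pN N) N) by rewrite -cIZ.
rewrite fN//= measure_itvcc ?(ltW pi2_gt0)// subr0 /= sqr_normc.
by case: (c N) => a b /=; ring.
Qed.

Lemma rint_ge0 (u : R -> R) : (forall t, 0 <= u t) -> 0 <= rint u.
Proof. by move=> u0; apply: Rintegral_ge0. Qed.

Lemma le_rint (u v : R -> R) : (forall t, cont_at u t) -> (forall t, cont_at v t) ->
  (forall t, u t <= v t) -> rint u <= rint v.
Proof. by move=> uc vc uv; apply: le_Rintegral => //; exact: rint_integrable. Qed.

Lemma rint_cst (k : R) : rint (fun=> k) = 2 * pi * k.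
Proof.
by rewrite /rint Rintegral_cst//= measure_itvcc ?(ltW pi2_gt0)// subr0 /= mulrC.
Qed.

Lemma bessel_le p (c : nat -> R[i]) : (forall t, cont_at p t) ->
  (forall n, fcoef p n = (2 * pi)%:C * c n) -> forall N,
  2 * pi * \sum_(n < N) normc (c n) ^+ 2 <= rint (fun t => normc (p t) ^+ 2).
Proof.
move=> pc cp N; rewrite -subr_ge0 -(bessel pc cp).
by apply: rint_ge0 => t; exact: sqr_ge0.
Qed.

End Fourier.

(** * Taylor coefficients and Parseval's identity *)

Section Taylor.
Context {R : realType}.
Implicit Types (r s t : R) (z w : R[i]) (f g : R[i] -> R[i]).

Definition holo f := forall z, normc z < 1 -> exists l, cdiff f z l.

(** The radius 1/2 is arbitrary: [circ_tcoef] finds the same value at every radius strictly between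
    0 and 1. *)
Definition tcoef f (n : nat) : R[i] := (2 * pi)%:C^-1 * circ (fun z => f z * z ^- n) (2^-1).

Lemma pi2C_neq0 : (2 * pi)%:C != 0 :> R[i].
Proof. by rewrite eq_complex /= eqxx andbT gt_eqF// pi2_gt0. Qed.

Lemma holo_cont f : holo f -> forall z, normc z < 1 -> cont_at f z.
Proof. by move=> fh z /fh[l]; exact: cdiff_continuous. Qed.

Lemma cdiffX z n : exists l, cdiff (fun z => z ^+ n) z l.
Proof.
elim: n => [|n [l IH]].
  by exists 0; under eq_fun do rewrite expr0; exact: cdiff_cst.
by eexists; under eq_fun do rewrite exprS; exact: cdiffM (cdiff_id z) IH.
Qed.

Lemma circ_tcoef f n r : holo f -> 0 < r < 1 ->
  circ (fun z => f z * z ^- n) r = (2 * pi)%:C * tcoef f n.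
Proof.
move=> fh /andP[r0 r1]; rewrite /tcoef mulrA divff ?pi2C_neq0// mul1r.
have gd z : 0 < normc z < 1 -> exists l, cdiff (fun z => f z * z ^- n) z l.
  move=> /andP[z0 z1]; have [l fl] := fh z z1; have [m zm] := cdiffX z n.
  eexists; apply: (cdiffM fl).
  apply: (@cdiff_comp _ (fun z => z ^+ n)); first exact: zm.
  by apply: cdiffV; rewrite expf_neq0// -normc_gt0.
have [->//|rh] := eqVneq r 2^-1.
have [h|h] := ltP r 2^-1.
  by apply: circ_annulus => // z /andP[? ?]; apply: gd; apply/andP; split; lra.
apply/esym/circ_annulus; first by rewrite invr_gt0.
  by rewrite lt_neqAle eq_sym rh.
move=> z /andP[? ?]; apply: gd; apply/andP; split; last by lra.
by apply: lt_le_trans (_ : 2^-1 <= _).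
Qed.

Lemma fcoef_circle f n r : holo f -> 0 < r < 1 ->
  fcoef (fun t => f (r%:C * expi t)) n = (2 * pi)%:C * (tcoef f n * r%:C ^+ n).
Proof.
move=> fh r01; rewrite mulrA -(circ_tcoef _ fh r01) mulrC.
have /andP[r0 r1] := r01; have rC0 : r%:C != 0 :> R[i] by rewrite eq_complex /= eqxx andbT gt_eqF.
rewrite -cIZ; last first.
  move=> t _; apply: (@cont_on_circle _ (fun z => f z * z ^- n)) => z zr.
  apply: contM; first by apply: holo_cont => //; rewrite zr gtr0_norm.
  apply: contV; first by rewrite expf_neq0// -normc_gt0 zr gtr0_norm.
  by have [l /cdiff_continuous] := cdiffX z n.
apply: eq_cI => t _; rewrite expiN expi_nat.
move: (f (r%:C * expi t)) => F; move: (expi t) => e; rewrite exprMn invfM; move: (r%:C ^+ n) (expf_neq0 n rC0) => a a0.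
by rewrite (mulrCA a F) (mulrA a) divff// mul1r.
Qed.

Lemma geometric_remainder (z w : R[i]) N : w != 0 -> w - z != 0 ->
  w / (w - z) = \sum_(n < N) z ^+ n * w ^- n + z ^+ N * w ^- N * (w / (w - z)).
Proof.
move=> w0 wz; elim: N => [|N IH]; first by rewrite big_ord0 add0r !expr0 divr1 mul1r.
rewrite big_ord_recr /= {1}IH -addrA; congr (_ + _).
have wN : w ^+ N != 0 by rewrite expf_neq0.
rewrite !exprS; move: wN; move: (z ^+ N) (w ^+ N) => a b b0.
by field; rewrite b0 w0 wz.
Qed.

(** Cauchy's formula on the circle of radius [k], halfway between [r] and 1, with the geometric
    series of the kernel cut at N; the ratio is r / k. *)
Lemma taylor_remainder f r : holo f -> 0 < r < 1 -> exists C q : R,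
  [/\ 0 <= C, 0 <= q < 1 & forall z N, normc z <= r ->
  normc (f z - \sum_(n < N) tcoef f n * z ^+ n) <= C * q ^+ N].
Proof.
move=> fh /andP[r0 r1]; pose k := (r + 1) / 2.
have k1 : k < 1 by rewrite /k; lra.
have rk : r < k by rewrite /k; lra.
have k0 : 0 < k by exact: lt_trans rk.
have k01 : 0 < k < 1 by rewrite k0.
have [|M M0 HM] := @disc_bounded R f k (ltW k0).
  by move=> z zk; apply: holo_cont => //; exact: le_lt_trans k1.
exists (2 * M * (k / (k - r))), (r / k); split.
- have A : 0 <= k / (k - r) by rewrite divr_ge0 ?subr_ge0 ?(ltW k0) ?(ltW rk).
  by rewrite mulr_ge0// mulr_ge0// ltW.
- by rewrite divr_ge0 ?(ltW r0) ?(ltW k0)//= ltr_pdivrMr// mul1r.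
move=> z N zr; have zk : normc z < k by exact: le_lt_trans rk.
have wn0 w : normc w = `|k| -> w != 0 by rewrite -normc_gt0 => ->; rewrite gtr0_norm.
have wz w : normc w = `|k| -> w - z != 0.
  rewrite gtr0_norm// => wk; rewrite subr_eq0; apply/eqP => E.
  by move: zk; rewrite -E wk ltxx.
have fc w : normc w = `|k| -> cont_at f w.
  by rewrite gtr0_norm// => wk; apply: holo_cont => //; rewrite wk.
have Xc w n : normc w = `|k| -> cont_at (fun w => w ^- n) w.
  move=> wk; apply: contV; first by rewrite expf_neq0// wn0.
  by have [l /cdiff_continuous] := cdiffX w n.
have Kc w : normc w = `|k| -> cont_at (fun w => w / (w - z)) w.
  move=> wr; apply: contM; first exact: cont_id.
  apply: contV; first exact: wz.
  by apply: contB; [exact: cont_id|exact: cont_cst].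
pose E w := f w * (z ^+ N * w ^- N * (w / (w - z))).
have Ec t : cont_at (fun t => E (k%:C * expi t)) t.
  apply: cont_on_circle => w wk; apply: contM; first exact: fc.
  apply: contM; last exact: Kc.
  by apply: contM; [exact: cont_cst|exact: Xc].
have Sc t (n : nat) : cont_at (fun t => z ^+ n * (f (k%:C * expi t) * (k%:C * expi t) ^- n)) t.
  apply: contM; first exact: cont_cst.
  apply: (@cont_on_circle _ (fun w => f w * w ^- n)) => w wk.
  by apply: contM; [exact: fc|exact: Xc].
have H : (2 * pi)%:C * (f z - \sum_(n < N) tcoef f n * z ^+ n) = circ E k.
  rewrite mulrBr -(cauchy_formula fh zk k1).
  apply/eqP; rewrite subr_eq addrC; apply/eqP.
  rewrite mulr_sumr.
  under eq_bigr do rewrite (mulrC (tcoef f _)) mulrCA -(circ_tcoef _ fh k01).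
  have ci (n : 'I_N) : cintegrable lebesgue_measure `[0, 2 * pi]
      (fun t => z ^+ n * (f (k%:C * expi t) * (k%:C * expi t) ^- n)).
    by apply: cont_cintegrable => t _; exact: Sc.
  have [c1 c2] := @cint_sum R _ _ lebesgue_measure `[0, 2 * pi] _ (index_enum 'I_N) _ (measurable_itv _) ci.
  transitivity (cI 0 (2 * pi) (fun t => \sum_(n < N) z ^+ n * (f (k%:C * expi t) * (k%:C * expi t) ^- n))
      + circ E k).
    rewrite -cintD//; last by apply: cont_cintegrable => t _; exact: Ec.
    apply: eq_cI => t _; rewrite /E; set w := k%:C * expi t.
    have wk : normc w = `|k| by rewrite normc_circle.
    rewrite {1}(geometric_remainder N (wn0 _ wk) (wz _ wk)) mulrDr mulr_sumr.
    by congr (_ + _); apply: eq_bigr => n _; rewrite mulrCA.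
  congr (_ + _); rewrite /cI c2; apply: eq_bigr => n _.
  rewrite -cIZ//; move=> t _; apply: (@cont_on_circle _ (fun w => f w * w ^- n)) => w wk.
  by apply: contM; [exact: fc|exact: Xc].
have pi2 := @pi2_gt0 R.
rewrite -(ler_pM2l pi2) -{1}(gtr0_norm pi2) -normc_real -normcM H.
have := @normc_cI R 0 (2 * pi) (fun t => E (k%:C * expi t)) (M * ((r / k) ^+ N * (k / (k - r)))) (ltW pi2).
rewrite subr0 => /(_ _ _)/le_trans; apply.
- by move=> t _; exact: Ec.
- move=> t t01; rewrite /E; set w := k%:C * expi t.
  have wk : normc w = `|k| by rewrite normc_circle.
  have wk' : normc w = k by rewrite wk gtr0_norm.
  rewrite normcM ler_pM ?normc_ge0//.
    by apply: HM => //; rewrite gtr0_norm.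
  rewrite normcM ler_pM ?normc_ge0//.
    rewrite normc_div !normcX wk' -expr_div_n lerXn2r//.
    - by rewrite nnegrE divr_ge0 ?normc_ge0 ?(ltW k0).
    - by rewrite nnegrE divr_ge0 ?(ltW r0) ?(ltW k0).
    - by rewrite ler_pM2r ?invr_gt0.
  rewrite normc_div wk' ler_wpM2l ?(ltW k0)// lef_pV2 ?posrE ?subr_gt0// ?normc_gt0 ?wz//.
  by have := normc_lerB w z; rewrite wk'; lra.
- by rewrite le_eqVlt; apply/orP; left; apply/eqP; ring.
Qed.

Definition sqmean f r := rint (fun t => normc (f (r%:C * expi t)) ^+ 2).

Definition tsum f N r := \sum_(n < N) normc (tcoef f n) ^+ 2 * r ^+ (2 * n).

Lemma holo_circle_cont f r : holo f -> 0 < r < 1 -> forall t, cont_at (fun t => f (r%:C * expi t)) t.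
Proof.
move=> fh /andP[r0 r1]; apply: cont_on_circle => z zr; apply: holo_cont => //.
by rewrite zr gtr0_norm.
Qed.

Lemma bessel_holo f r N : holo f -> 0 < r < 1 ->
  rint (fun t => normc (f (r%:C * expi t) -
    \sum_(n < N) tcoef f n * (r%:C * expi t) ^+ n) ^+ 2) = sqmean f r - 2 * pi * tsum f N r.
Proof.
move=> fh r01; have := bessel (holo_circle_cont fh r01) (fun n => fcoef_circle n fh r01) N.
have -> : \sum_(n < N) normc (tcoef f n * r%:C ^+ n) ^+ 2 = tsum f N r.
  apply: eq_bigr => n _; have /andP[r0 _] := r01.
  by rewrite normcM normcX normc_real gtr0_norm// exprMn -exprM mulnC.
move=> <-; apply: eq_Rintegral => t _; congr (normc (_ - _) ^+ 2).
by apply: eq_bigr => n _; rewrite exprMn expi_nat mulrA.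
Qed.

Lemma tsum_le f r N : holo f -> 0 < r < 1 -> 2 * pi * tsum f N r <= sqmean f r.
Proof.
move=> fh r01; rewrite -subr_ge0 -bessel_holo//.
by apply: rint_ge0 => t; exact: sqr_ge0.
Qed.

Lemma exprn_lt_eps (q e : R) : 0 <= q < 1 -> 0 < e -> exists N, q ^+ N < e.
Proof.
move=> /andP[q0 q1] e0; have := @cvg_geometric R 1 q; rewrite ger0_norm// => /(_ q1).
move=> /cvgrPdist_lt /(_ _ e0) [N _ /(_ N (leqnn _))]; rewrite /geometric /= mul1r sub0r normrN.
by rewrite ger0_norm ?exprn_ge0//; exists N.
Qed.

(** Bessel's identity leaves the mean of the squared Taylor remainder, which is uniformly small. A
    finite N with an error [e] keeps infinite sums out of all later estimates. *)
Lemma parseval f r e : holo f -> 0 < r < 1 -> 0 < e ->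
  exists N, sqmean f r <= 2 * pi * tsum f N r + e.
Proof.
move=> fh r01 e0; have /andP[r0 r1] := r01.
have [C [q [C0 /andP[q0 q1] H]]] := taylor_remainder fh r01.
have q2 : 0 <= q ^+ 2 < 1 by rewrite exprn_ge0// expr_lt1//.
have K0 : 0 < 2 * pi * C ^+ 2 + 1 by rewrite ltr_wpDl// mulr_ge0 ?sqr_ge0// ltW ?pi2_gt0.
have [N HN] := exprn_lt_eps q2 (divr_gt0 e0 K0).
exists N; rewrite -lerBlDl -bessel_holo//.
apply: (@le_trans _ _ (rint (fun=> C ^+ 2 * (q ^+ 2) ^+ N))).
  apply: le_rint => t; last 2 first.
  - exact: (@ContAt _ _ _ _ (cvg_cst _)).
  - rewrite exprAC -exprMn lerXn2r ?nnegrE ?normc_ge0 ?mulr_ge0 ?exprn_ge0//.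
    by apply: H; rewrite normc_circle gtr0_norm.
  apply: cont_sqr_normc; apply: contB; first exact: holo_circle_cont.
  elim: N {HN} => [|N IH]; first by under eq_fun do rewrite big_ord0; exact: cont_cst.
  under eq_fun do rewrite big_ord_recr /=; apply: contD; first exact: IH.
  apply: contM; first exact: cont_cst.
  apply: (@cont_comp _ _ _ (fun y => r%:C * expi y) (fun z => z ^+ N)); first exact: cont_circle.
  by have [l /cdiff_continuous] := cdiffX (r%:C * expi t) N.
rewrite rint_cst mulrA; move: HN; rewrite ltr_pdivlMr// => HN; apply: le_trans (ltW HN).
rewrite mulrC ler_wpM2l ?lerDl// exprn_ge0//.
by have /andP[] := q2.
Qed.

End Taylor.

(** * Differentiation of Cauchy kernels under the integral sign *)

Section Kernel.
Context {R : realType} {d : measure_display} {T : measurableType d}.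
Variable mu : {measure set T -> \bar R}.
Implicit Types (D : set T) (phi a b : T -> R[i]) (z w h : R[i]).

Lemma cintegrable_bounded D phi b (B : R) : measurable D -> cintegrable mu D phi ->
  cmeas D b -> (forall x, D x -> normc (b x) <= B) ->
  cintegrable mu D (fun x => phi x * b x) /\
  normc (cint mu D (fun x => phi x * b x)) <=
    2 * (B * \int[mu]_(x in D) normc (phi x)).
Proof.
move=> mD iphi mb bB.
have inphi := integrable_normc mD iphi.
have iB : mu.-integrable D (EFin \o (fun x => B * normc (phi x))).
  by apply: eq_integrable (integrableZl mD B inphi).
have pb x : D x -> normc (phi x * b x) <= B * normc (phi x).
  by move=> Dx; rewrite normcM mulrC ler_wpM2r ?normc_ge0// bB.
have ip : cintegrable mu D (fun x => phi x * b x).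
  by apply: le_cintegrable iB => //; apply: cmeasM => //; exact: cintegrable_cmeas iphi.
by split => //; rewrite -RintegralZl//; exact: normc_cint.
Qed.

Section fixed.
Variables (D : set T) (phi a : T -> R[i]) (z : R[i]) (e : R).
Hypotheses (mD : measurable D) (iphi : cintegrable mu D phi) (ma : cmeas D a)
  (e0 : 0 < e) (az : forall x, D x -> 2 * e <= normc (a x - z)).

Lemma kernel_far h x : D x -> normc h < e -> e <= normc (a x - (z + h)).
Proof.
move=> Dx he; have := az Dx; have := normc_lerB (a x - z) h.
by rewrite opprD addrA; lra.
Qed.

Lemma kernel_neq0 h x : D x -> normc h < e -> a x - (z + h) != 0.
Proof. by move=> Dx he; rewrite -normc_gt0 (lt_le_trans e0)// kernel_far. Qed.

Lemma kernel_inv h x : D x -> normc h < e -> normc (a x - (z + h))^-1 <= e^-1.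
Proof.
by move=> Dx he; rewrite normcV lef_pV2 ?posrE ?kernel_far// normc_gt0 kernel_neq0.
Qed.

Lemma cmeas_kernel h n : cmeas D (fun x => (a x - (z + h))^-1 ^+ n).
Proof.
elim: n => [|n IH]; first by under eq_fun do rewrite expr0; exact: cmeas_cst.
under eq_fun do rewrite exprS; apply: cmeasM => //; apply: cmeasV.
by apply: cmeasB => //; exact: cmeas_cst.
Qed.

Lemma kernel_integrable h n : normc h < e ->
  cintegrable mu D (fun x => phi x * (a x - (z + h))^-1 ^+ n) /\
  normc (cint mu D (fun x => phi x * (a x - (z + h))^-1 ^+ n)) <=
    2 * (e^-1 ^+ n * \int[mu]_(x in D) normc (phi x)).
Proof.
move=> he; apply: cintegrable_bounded => //; first exact: cmeas_kernel.
by move=> x Dx; rewrite normcX lerXn2r ?nnegrE ?normc_ge0 ?invr_ge0 ?(ltW e0)// kernel_inv.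
Qed.

Let n0 : normc (0 : R[i]) < e. Proof. by rewrite normc0. Qed.

(** No limit is taken under the integral: the second-order remainder is h^2 times an explicit
    bounded factor [q], so it integrates to O(h^2). *)
Lemma cdiff_cint (u : R[i] -> T -> R[i]) (v : T -> R[i]) (q : R[i] -> T -> R[i]) (B : R) :
  0 <= B -> (forall h, normc h < e -> cintegrable mu D (u (z + h))) ->
  cintegrable mu D v -> (forall h, normc h < e -> cmeas D (q h)) ->
  (forall h x, D x -> normc h < e -> normc (q h x) <= B) ->
  (forall h x, D x -> normc h < e ->
    u (z + h) x - u z x - h * v x = phi x * (h ^+ 2 * q h x)) ->
  cdiff (fun w => cint mu D (u w)) z (cint mu D v).
Proof.
move=> B0 iu iv mq qB E; pose I := \int[mu]_(x in D) normc (phi x).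
have I0 : 0 <= I by apply: Rintegral_ge0 => x _; exact: normc_ge0.
pose K := 2 * (B * I) + 1.
have K0 : 0 < K by rewrite ltr_wpDl// !mulr_ge0.
split=> c c0; exists (Num.min e (c / K)); first by rewrite lt_min e0 divr_gt0.
move=> h; rewrite lt_min => /andP[he hc].
have ih := iu _ he; have i0 := iu _ n0; rewrite addr0 in i0.
rewrite -cintB// (mulrC _ h) -cintZ// -cintB//; last 2 first.
- exact: cintegrableB.
- exact: cintegrableZ.
rewrite (eq_cint _ (fun x Dx => E h x Dx he)).
have [||_] := @cintegrable_bounded D phi (fun x => h ^+ 2 * q h x) (normc h ^+ 2 * B) mD iphi.
- by apply: cmeasM; [exact: cmeas_cst|exact: mq].
- by move=> x Dx; rewrite normcM normcX ler_wpM2l ?exprn_ge0 ?normc_ge0// qB.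
move=> /le_trans; apply; rewrite -/I expr2 -!mulrA mulrCA mulrC ler_wpM2r ?normc_ge0//.
apply: (@le_trans _ _ (normc h * K)); last by rewrite -ler_pdivlMr// ltW.
by rewrite mulrCA ler_wpM2l ?normc_ge0// /K lerDl.
Qed.

Let kernel_inv0 x : D x -> normc (a x - z)^-1 <= e^-1.
Proof. by move=> Dx; have := kernel_inv Dx n0; rewrite addr0. Qed.

Let kernel_neq00 x : D x -> a x - z != 0.
Proof. by move=> Dx; have := kernel_neq0 Dx n0; rewrite addr0. Qed.

Let ei0 : 0 <= e^-1. Proof. by rewrite invr_ge0 ltW. Qed.

Lemma cdiff_kernel : cdiff (fun w => cint mu D (fun x => phi x * (a x - w)^-1)) z
  (cint mu D (fun x => phi x * (a x - z)^-1 ^+ 2)).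
Proof.
have m0 := cmeas_kernel 0 2; have i0 := (kernel_integrable 2 n0).1; rewrite addr0 in m0 i0.
apply: (cdiff_cint (q := fun h x => (a x - z)^-1 ^+ 2 * (a x - (z + h))^-1 ^+ 1)
    (B := e^-1 ^+ 3)) => //; first exact: exprn_ge0.
- by move=> h he; exact: (kernel_integrable 1 he).1.
- by move=> h he; apply: cmeasM => //; exact: cmeas_kernel.
- move=> h x Dx he; rewrite normcM [leRHS]exprSr ler_pM ?normc_ge0// ?expr1 ?kernel_inv//.
  by rewrite normcX lerXn2r ?nnegrE ?normc_ge0 ?kernel_inv0.
move=> h x Dx he; have := kernel_neq0 Dx he; have := kernel_neq00 Dx; rewrite opprD addrA.
by move: (a x - z) (phi x) => y p y0 yh0; field; rewrite y0 yh0.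
Qed.

(** The squared kernel represents derivatives of holomorphic functions; differentiating it is what
    makes those derivatives holomorphic. *)
Lemma cdiff_kernel2 : exists l,
  cdiff (fun w => cint mu D (fun x => phi x * (a x - w)^-1 ^+ 2)) z l.
Proof.
have m1 y : cmeas D (fun x => (a x - (z + y))^-1) by exact: cmeas_kernel y 1.
have m0 := m1 0; have m2 := cmeas_kernel 0 2; have i0 := (kernel_integrable 3 n0).1.
rewrite addr0 in m0 m2 i0; exists (cint mu D (fun x => 2 * (phi x * (a x - z)^-1 ^+ 3))).
(* With y = a x - z this [q] equals (3 y - 2 h) / (y^3 (y - h)^2), the remainder of (y - h)^-2 after
   its first-order part, divided by h^2. *)
apply: (cdiff_cint (q := fun h x => (a x - (z + h))^-1 * ((a x - z)^-1 ^+ 2 *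
  ((a x - (z + h))^-1 + ((a x - z)^-1 + (a x - z)^-1)))) (B := 3 * e^-1 ^+ 4)) => //.
- by rewrite mulr_ge0 ?exprn_ge0.
- by move=> h he; exact: (kernel_integrable 2 he).1.
- exact: cintegrableZ.
- by move=> h he; apply: cmeasM => //; apply: cmeasM => //; apply: cmeasD => //; exact: cmeasD.
- move=> h x Dx he; have A := kernel_inv Dx he; have B := kernel_inv0 Dx.
  rewrite [leRHS](_ : _ = e^-1 * (e^-1 ^+ 2 * (3 * e^-1))); last by ring.
  rewrite normcM ler_pM ?normc_ge0// normcM ler_pM ?normc_ge0//.
    by rewrite normcX lerXn2r ?nnegrE ?normc_ge0.
  apply: le_trans (normcD _ _) _.
  by have := normcD (a x - z)^-1 (a x - z)^-1; lra.
move=> h x Dx he; have := kernel_neq0 Dx he; have := kernel_neq00 Dx; rewrite opprD addrA.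
by move: (a x - z) (phi x) => y p y0 yh0; field; rewrite y0 yh0.
Qed.

End fixed.
End Kernel.

Section Derivative.
Context {R : realType}.
Implicit Types (r s t : R) (z w : R[i]) (f g : R[i] -> R[i]).

Lemma cdiff_derive1 f z l : cdiff f z l -> derive1 f z = l.
Proof. by move=> /cdiff_derivable[]. Qed.

Lemma holo_derive f : holo f -> forall z, normc z < 1 -> cdiff f z (derive1 f z).
Proof. by move=> fh z /fh[l fl]; rewrite (cdiff_derive1 fl). Qed.

(** Cauchy's formula on the circle of radius [k] writes [f] as a kernel integral; one
    differentiation gives the squared kernel, which can be differentiated once more. *)
Lemma holo_derive1 f : holo f -> holo (derive1 f).
Proof.
move=> fh z z1; pose k := (1 + normc z) / 2.
have zk : normc z < k by rewrite /k; lra.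
have k1 : k < 1 by rewrite /k; lra.
have k0 : 0 < k by exact: le_lt_trans (normc_ge0 _) zk.
have fc t : cont_at (fun t => f (k%:C * expi t)) t.
  by apply: holo_circle_cont => //; rewrite k0.
pose phi t := f (k%:C * expi t) * (k%:C * expi t).
have iphi : cintegrable lebesgue_measure `[0, 2 * pi] phi.
  by apply: cont_cintegrable => t _; apply: contM => //; exact: cont_circle.
have ma : @cmeas R _ (measurableTypeR R) `[0, 2 * pi]%classic (fun t => k%:C * expi t).
  apply: (@cintegrable_cmeas _ _ _ lebesgue_measure).
  by apply: cont_cintegrable => t _; exact: cont_circle.
have E w : normc w < k -> f w = (2 * pi)%:C^-1 *
    cint lebesgue_measure `[0, 2 * pi] (fun t => phi t * (k%:C * expi t - w)^-1).
  move=> wk; have := cauchy_formula fh wk k1; rewrite /circ /cI => H.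
  under eq_cint do rewrite -mulrA.
  by rewrite H mulrA mulVf ?pi2C_neq0// mul1r.
have D w : normc w < k -> derive1 f w = (2 * pi)%:C^-1 *
    cint lebesgue_measure `[0, 2 * pi] (fun t => phi t * (k%:C * expi t - w)^-1 ^+ 2).
  move=> wk; apply: cdiff_derive1; pose e := (k - normc w) / 2.
  have e0 : 0 < e by rewrite divr_gt0// subr_gt0.
  have := @cdiff_kernel _ _ _ lebesgue_measure `[0, 2 * pi] phi _ w e (measurable_itv _) iphi ma e0.
  move=> /(_ _)/(cdiffZ (2 * pi)%:C^-1) H; apply: cdiff_near (H _) => {H}.
    by apply: filterS (near_normc_lt wk) => v vk; rewrite E.
  move=> t _; have := normc_lerB (k%:C * expi t) w.
  by rewrite normc_circle gtr0_norm// /e (mulrC 2) divfK.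
pose e := (k - normc z) / 2.
have e0 : 0 < e by rewrite divr_gt0// subr_gt0.
have := @cdiff_kernel2 _ _ _ lebesgue_measure `[0, 2 * pi] phi _ z e (measurable_itv _) iphi ma e0.
move=> /(_ _)[|l /(cdiffZ (2 * pi)%:C^-1) H]; last first.
  eexists; apply: cdiff_near H.
  by apply: filterS (near_normc_lt zk) => w wk; rewrite D.
move=> t _; have := normc_lerB (k%:C * expi t) z.
by rewrite normc_circle gtr0_norm// /e (mulrC 2) divfK.
Qed.

(** Integration by parts over a period: f(r e^(it)) e^(-i(n+1)t) takes equal values at 0 and 2 pi,
    and its derivative is the sum of the two integrands to be compared. *)
Lemma fcoef_derive f r n : holo f -> 0 < r < 1 ->
  fcoef (fun t => derive1 f (r%:C * expi t)) n =
  (2 * pi)%:C * (n.+1%:R * tcoef f n.+1 * r%:C ^+ n).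
Proof.
move=> fh r01; have /andP[r0 r1] := r01.
have rC0 : r%:C != 0 :> R[i] by rewrite eq_complex /= eqxx andbT gt_eqF.
have dc t : cont_at (fun t => derive1 f (r%:C * expi t)) t.
  by apply: cont_on_circle => z zr; apply: (holo_cont (holo_derive1 fh)); rewrite zr gtr0_norm.
have fc := holo_circle_cont fh r01.
pose p t := f (r%:C * expi t) * expi (- n.+1%:R * t).
pose p1 t := (0 +i* 1) * r%:C * (derive1 f (r%:C * expi t) * expi (- (n%:R * t))).
pose p2 t := (0 +i* (- n.+1%:R)) * (f (r%:C * expi t) * expi (- (n.+1%:R * t))).
have dp t : pdiff p t (p1 t + p2 t).
  have d1 : pdiff (fun t => r%:C * expi t) t (r%:C * ((0 +i* 1) * expi t)).
    have H := pdiffM (pdiff_cst t r%:C) (pdiff_expi 1 t).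
    rewrite mul0r add0r mul1r in H.
    by move: H; under [X in pdiff X]eq_fun do rewrite mul1r.
  have d2 : pdiff (fun t => f (r%:C * expi t)) t (derive1 f (r%:C * expi t) * (r%:C * ((0 +i* 1) * expi t))).
    apply: cdiff_pdiff d1; apply: holo_derive => //.
    by rewrite normc_circle gtr0_norm.
  apply: pdiff_eq (pdiffM d2 (pdiff_expi (- n.+1%:R) t)); congr (_ + _).
    have -> : - n.+1%:R * t = - (n%:R * t) - t by rewrite -natr1; ring.
    rewrite expiD (expiN t) /p1; move: (derive1 f _) (expi (- (n%:R * t))) (expi_neq0 t) => A B.
    by move: (expi t) => e e0; field.
  by rewrite /p2 mulrCA mulNr.
have p1c t : cont_at p1 t.
  by apply: contM; [exact: cont_cst|exact: cont_fcoef].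
have p2c t : cont_at p2 t.
  by apply: contM; [exact: cont_cst|exact: cont_fcoef].
have : cI 0 (2 * pi) (fun t => p1 t + p2 t) = 0.
  rewrite (@cI_FTC _ _ _ p _ pi2_gt0 dp); last by move=> t; exact: contD.
  rewrite /p !mulr0 expi2pi expi0 mulNr expiN expi_nat expi2pi expr1n invr1.
  by rewrite subrr.
rewrite cID//= /p1 cIZ; last by move=> t _; exact: cont_fcoef.
rewrite /p2 cIZ; last by move=> t _; exact: cont_fcoef.
rewrite -/(fcoef (fun t => derive1 f (r%:C * expi t)) n).
rewrite -/(fcoef (fun t => f (r%:C * expi t)) n.+1) (fcoef_circle n.+1 fh r01).
move=> /eqP; rewrite addr_eq0 => /eqP H.
have i0 : (0 +i* 1) * r%:C != 0 :> R[i].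
  by rewrite mulf_neq0// eq_complex /= oner_eq0 andbF.
apply: (mulfI i0); rewrite H.
have -> : 0 +i* (- n.+1%:R) = - ((0 +i* 1) * n.+1%:R) :> R[i].
  rewrite -[n.+1%:R in RHS](rmorph_nat (real_complex R)); simpc.
  by [].
by rewrite mulNr opprK exprS; ring.
Qed.

Lemma bessel_derive f r N : holo f -> 0 < r < 1 ->
  2 * pi * \sum_(n < N) n.+1%:R ^+ 2 * normc (tcoef f n.+1) ^+ 2 * r ^+ (2 * n) <=
  rint (fun t => normc (derive1 f (r%:C * expi t)) ^+ 2).
Proof.
move=> fh r01; have /andP[r0 r1] := r01.
have dc t : cont_at (fun t => derive1 f (r%:C * expi t)) t.
  by apply: cont_on_circle => z zr; apply: (holo_cont (holo_derive1 fh)); rewrite zr gtr0_norm.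
apply: le_trans (bessel_le dc (fun n => fcoef_derive n fh r01) N).
rewrite le_eqVlt; apply/orP; left; apply/eqP; congr (_ * _); apply: eq_bigr => n _.
rewrite !normcM normcX -(rmorph_nat (real_complex R)) !normc_real.
by rewrite (gtr0_norm r0) ger0_norm// !exprMn -exprM (mulnC n).
Qed.

End Derivative.

(** * The Dirichlet integral in polar coordinates *)

Section Rotation.
Context {R : realType}.
Local Notation mu := (@lebesgue_measure R).
Local Notation mu2 := (mu \x mu)%E.
Local Notation R2 := (measurableTypeR R * measurableTypeR R)%type.
Implicit Types (F : R -> \bar R) (G : R2 -> \bar R) (a b c k s x y : R).

Lemma measurable_shift a : measurable_fun [set: measurableTypeR R] (fun x => x + a : measurableTypeR R).
Proof. by apply: measurable_funD => //; exact: measurable_cst. Qed.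

Lemma lebesgue_measure_shift a (A : set (measurableTypeR R)) : measurable A ->
  mu A = pushforward mu (fun x => x + a : measurableTypeR R) A.
Proof.
pose mf := isMeasurableFun.Build _ _ _ _ _ (measurable_shift a).
pose f : {mfun measurableTypeR R >-> measurableTypeR R} := HB.pack (fun x : measurableTypeR R => x + a : measurableTypeR R) mf.
move=> mA; apply: (@lebesgue_measure_unique R (pushforward mu f)) => //= _ [[x y]] _ <-.
rewrite /pushforward /=.
have -> : (fun z => z + a) @^-1` `]x, y] = `]x - a, y - a]%classic.
  by apply/seteqP; split => z /=; rewrite !in_itv /= ltrBlDr lerBrDr.
by rewrite !lebesgue_measure_itv /= !lte_fin ltrD2r; case: ifP => // _; rewrite -!EFinD; congr (_%:E); ring.
Qed.

Lemma integral_shift F a : measurable_fun [set: measurableTypeR R] F -> (forall x, (0 <= F x)%E) ->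
  (\int[mu]_x F (x + a)%R = \int[mu]_x F x)%E.
Proof.
move=> mF F0.
pose mf := isMeasurableFun.Build _ _ _ _ _ (measurable_shift a).
pose f : {mfun measurableTypeR R >-> measurableTypeR R} := HB.pack (fun x : measurableTypeR R => x + a : measurableTypeR R) mf.
transitivity (\int[pushforward mu f]_x F x)%E.
  by rewrite ge0_integral_pushforward//=; exact: measurable_shift.
by apply: eq_measure_integral => A mA _; exact/esym/lebesgue_measure_shift.
Qed.

Lemma measurable_pair_lin a b c k : measurable_fun [set: R2]
  (fun p : R2 => (a * p.1 + b * p.2, c * p.1 + k * p.2)).
Proof.
apply: measurable_fun_pair; apply: measurable_funD; apply: measurable_funM => //;
  exact: measurable_cst.
Qed.

(** On each horizontal line the shear is a translation, so Tonelli reduces the claim to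
    [integral_shift]. *)
Lemma shear1 G k : measurable_fun [set: R2] G -> (forall p, (0 <= G p)%E) ->
  (\int[mu2]_p G ((p.1 + k * p.2)%R, p.2) = \int[mu2]_p G p)%E.
Proof.
move=> mG G0.
have mk : measurable_fun [set: R2] (fun p : R2 => (p.1 + k * p.2, p.2)).
  have := measurable_pair_lin 1 k 0 1; apply: eq_measurable_fun => p _.
  by rewrite !mul1r mul0r add0r.
have G0' p : (0 <= G ((p.1 + k * p.2)%R, p.2))%E by exact: G0.
apply: (etrans (fubini_tonelli2 (m1 := mu) (m2 := mu) _ (measurableT_comp mG mk) G0')).
apply/esym; apply: (etrans (fubini_tonelli2 (m1 := mu) (m2 := mu) _ mG G0)).
apply/esym/eq_integral => y _.
rewrite /fubini_G /= (integral_shift (F := fun x => G (x, y)))//.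
exact: measurableT_comp mG (measurable_pair2 y).
Qed.

Lemma shear2 G k : measurable_fun [set: R2] G -> (forall p, (0 <= G p)%E) ->
  (\int[mu2]_p G (p.1, (p.2 + k * p.1)%R) = \int[mu2]_p G p)%E.
Proof.
move=> mG G0.
have mk : measurable_fun [set: R2] (fun p : R2 => (p.1, p.2 + k * p.1)).
  have := measurable_pair_lin 1 0 k 1; apply: eq_measurable_fun => p _.
  by rewrite !mul1r mul0r addr0 addrC.
have G0' p : (0 <= G (p.1, (p.2 + k * p.1)%R))%E by exact: G0.
apply: (etrans (fubini_tonelli1 (m1 := mu) (m2 := mu) _ (measurableT_comp mG mk) G0')).
apply/esym; apply: (etrans (fubini_tonelli1 (m1 := mu) (m2 := mu) _ mG G0)).
apply/esym/eq_integral => x _.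
rewrite /fubini_F /= (integral_shift (F := fun y => G (x, y)))//.
exact: measurableT_comp mG (measurable_pair1 x).
Qed.

Definition rot c s (p : R2) := (c * p.1 - s * p.2, s * p.1 + c * p.2).

Lemma measurable_rot c s : measurable_fun [set: R2] (rot c s).
Proof.
have := measurable_pair_lin c (- s) s c; apply: eq_measurable_fun => p _.
by rewrite mulNr.
Qed.

(* A rotation other than the half turn is a product of three shears. *)
Lemma rotation_invariance_generic G c s : c != -1 -> c ^+ 2 + s ^+ 2 = 1 ->
  measurable_fun [set: R2] G -> (forall p, (0 <= G p)%E) ->
  (\int[mu2]_p G (rot c s p) = \int[mu2]_p G p)%E.
Proof.
move=> c1 cs mG G0; have c1' : 1 + c != 0 by rewrite addrC addr_eq0.
(* For the angle theta this is - tan (theta / 2); the shears have parameters [k], [s] and [k]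
   again. *)
pose k := - s / (1 + c).
have mk : measurable_fun [set: R2] (fun p : R2 => (p.1 + k * p.2, p.2)).
  have := measurable_pair_lin 1 k 0 1; apply: eq_measurable_fun => p _.
  by rewrite !mul1r mul0r add0r.
have ms : measurable_fun [set: R2] (fun p : R2 => (p.1, p.2 + s * p.1)).
  have := measurable_pair_lin 1 0 s 1; apply: eq_measurable_fun => p _.
  by rewrite !mul1r mul0r addr0 addrC.
rewrite -(shear1 k mG G0) -(shear2 s (G := fun p => G (p.1 + k * p.2, p.2)))//; last exact: measurableT_comp mk.
rewrite -(shear1 k (G := fun p => G (p.1 + k * (p.2 + s * p.1), p.2 + s * p.1)))//; last first.
  exact: (measurableT_comp (measurableT_comp mG mk) ms).
apply: eq_integral => -[x y] _; congr (G _); rewrite /rot /=.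
have hk : (1 + c) * k = - s by rewrite /k mulrC divfK.
have ks : 1 + k * s = c.
  apply: (mulfI c1'); rewrite mulrDr mulrA hk mulr1.
  have -> : - s * s = c ^+ 2 - 1 by rewrite -cs; ring.
  ring.
have -> : y + s * (x + k * y) = s * x + (1 + k * s) * y by ring.
have -> : x + k * y + k * (s * x + (1 + k * s) * y) =
  (1 + k * s) * x + (1 + (1 + k * s)) * k * y by ring.
by rewrite ks hk mulNr.
Qed.

(** The half turn, where the parameter of the shears blows up, is the square of a quarter turn. *)
Lemma rotation_invariance G c s : c ^+ 2 + s ^+ 2 = 1 ->
  measurable_fun [set: R2] G -> (forall p, (0 <= G p)%E) ->
  (\int[mu2]_p G (rot c s p) = \int[mu2]_p G p)%E.
Proof.
move=> cs mG G0.
have [c1|c1] := eqVneq c (-1); last exact: rotation_invariance_generic.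
have s0 : s = 0.
  by apply/eqP; rewrite -sqrf_eq0; apply/eqP; move: cs; rewrite c1; lra.
have n1 : (0 : R) != -1 by rewrite eq_sym oppr_eq0 oner_eq0.
have e1 : (0 : R) ^+ 2 + 1 ^+ 2 = 1 by rewrite expr0n expr1n add0r.
rewrite -(rotation_invariance_generic n1 e1 mG G0).
rewrite -(rotation_invariance_generic (G := fun p => G (rot 0 1 p)) n1 e1)//; last first.
  exact: (measurableT_comp mG (measurable_rot 0 1)).
apply: eq_integral => -[x y] _; rewrite c1 s0 /rot /=; congr (G (_, _)); ring.
Qed.

End Rotation.

(** * Measurability on the disc and area moments *)

Section Area.
Context {R : realType}.
Local Notation mu := (@lebesgue_measure R).
Local Notation mu2 := (mu \x mu)%E.
Local Notation R2 := (measurableTypeR R * measurableTypeR R)%type.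
Implicit Types (r s t x y : R) (z w : R[i]) (f g : R[i] -> R[i]) (p : R2).

Definition p2c (p : R2) : R[i] := p.1 +i* p.2.

Lemma analytic_holo f : analytic_disc f <-> holo f.
Proof.
split => fh z z1; first by exists (derive1 f z); apply/derivable_cdiff/fh/discE.
by have [|l /cdiff_derivable[]] := fh z; first exact/discE.
Qed.

Lemma cmeas_p2c : cmeas [set: R2] p2c.
Proof. by split; [exact: measurable_fst|exact: measurable_snd]. Qed.

Lemma measurable_p2c_ball r : measurable [set p : R2 | normc (p2c p) < r].
Proof.
have := measurable_fun_ltr (measurable_normc cmeas_p2c) (@measurable_cst _ _ R2 R setT r).
move=> /(_ measurableT [set true]); rewrite setTI; apply.
by [].
Qed.

(** On the disc the function is a pointwise limit of its Taylor polynomials, which are measurable on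
    the whole plane. *)
Lemma cmeas_holo f : holo f -> cmeas [set p | normc (p2c p) < 1] (fun p => f (p2c p)).
Proof.
move=> fh; pose P N p := \sum_(n < N) tcoef f n * p2c p ^+ n.
have mD := measurable_p2c_ball 1.
have mP N : cmeas [set p | normc (p2c p) < 1] (P N).
  apply: (@cmeas_subset _ _ _ setT) => //; rewrite /P.
  elim: N => [|N IH]; first by under eq_fun do rewrite big_ord0; exact: cmeas_cst.
  under eq_fun do rewrite big_ord_recr /=; apply: cmeasD => //.
  apply: cmeasM; first exact: cmeas_cst.
  elim: N {IH} => [|N IH]; first by under eq_fun do rewrite expr0; exact: cmeas_cst.
  by under eq_fun do rewrite exprS; apply: cmeasM => //; exact: cmeas_p2c.
have H p : normc (p2c p) < 1 -> P n p @[n --> \oo] --> f (p2c p).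
  move=> p1; apply/cvg_complexP => e e0.
  pose r := (normc (p2c p) + 1) / 2.
  have np := normc_ge0 (p2c p).
  have r01 : 0 < r < 1 by rewrite /r; apply/andP; split; lra.
  have [C [q [C0 /andP[q0 q1] HC]]] := taylor_remainder fh r01.
  have q01 : 0 <= q < 1 by rewrite q0.
  have C1 : 0 < C + 1 by lra.
  have [N HN] := exprn_lt_eps q01 (divr_gt0 e0 C1).
  exists N => // n /= Nn; apply: le_lt_trans (HC _ _ _) _; first by rewrite /r; lra.
  apply: (@le_lt_trans _ _ ((C + 1) * q ^+ N)); last by rewrite mulrC -ltr_pdivlMr.
  rewrite ler_pM ?exprn_ge0//; first by lra.
  by apply: ler_wiXn2l => //; exact: ltW.
split.
  apply: (measurable_fun_cvg (h := fun n p => complex.Re (P n p))) => [n|p p1].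
    by have [] := mP n.
  by have /cvg_complex_ReIm[] := H p p1.
apply: (measurable_fun_cvg (h := fun n p => complex.Im (P n p))) => [n|p p1].
  by have [] := mP n.
by have /cvg_complex_ReIm[] := H p p1.
Qed.

(** This bounds the height, above abscissa [x], of the ring q < |p|^2 < 1. The two square roots have
    squares differing by 1 - q and a sum of at most 2. *)
Lemma sqrt_gap x (q : R) : 0 <= x <= 2^-1 -> 2^-1 <= q <= 1 ->
  (1 - q) / 2 <= Num.sqrt (1 - x ^+ 2) - Num.sqrt (q - x ^+ 2).
Proof.
move=> /andP[x0 x1] /andP[q0 q1].
have x2 : x ^+ 2 <= 4^-1 by have : x * x <= 2^-1 * 2^-1 by [exact: ler_pM]; rewrite expr2; lra.
have x20 := sqr_ge0 x.
have a0 : 0 <= 1 - x ^+ 2 by lra.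
have b0 : 0 <= q - x ^+ 2 by lra.
have ab : Num.sqrt (q - x ^+ 2) <= Num.sqrt (1 - x ^+ 2) by rewrite ler_wsqrtr//; lra.
have s1 : Num.sqrt (1 - x ^+ 2) <= 1 by rewrite -[leRHS]sqrtr1 ler_wsqrtr//; lra.
have := sqr_sqrtr a0; have := sqr_sqrtr b0; have := sqrtr_ge0 (q - x ^+ 2).
move: (Num.sqrt (1 - x ^+ 2)) (Num.sqrt (q - x ^+ 2)) ab s1 => u v uv u1 v0 e1 e2.
have -> : 1 - q = (u - v) * (u + v) by rewrite -subr_sqr e1 e2; ring.
rewrite ler_pdivrMr// ler_wpM2l ?subr_ge0//; lra.
Qed.

(** Bernoulli's inequality. It keeps |p|^(2n) above one half on the ring where |p|^2 > 1 - 1 / (2 (n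
    + 1)). *)
Lemma bernoulli_half (n : nat) : 2^-1 <= (1 - (2 * n.+1%:R)^-1) ^+ n :> R.
Proof.
have B (m : nat) (u : R) : 0 <= u <= 1 -> 1 - m%:R * u <= (1 - u) ^+ m.
  move=> /andP[u0 u1]; elim: m => [|m IH]; first by rewrite mul0r subr0 expr0.
  rewrite exprS; apply: (@le_trans _ _ ((1 - u) * (1 - m%:R * u))); last first.
    by rewrite ler_wpM2l// subr_ge0.
  rewrite -natr1; have : 0 <= m%:R * (u * u) by rewrite mulr_ge0// mulr_ge0.
  lra.
have n1 : 0 < n.+1%:R :> R by rewrite ltr0n.
apply: le_trans (B n _ _); last first.
  rewrite invr_ge0 mulr_ge0//= ?(ltW n1)// invf_le1 ?mulr_gt0//.
  have : 1 <= n.+1%:R :> R by rewrite ler1n.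
  lra.
rewrite invfM mulrCA; have : n%:R / n.+1%:R <= 1 :> R.
  by rewrite ler_pdivrMr// mul1r ler_nat.
by move: (n%:R / n.+1%:R) => u; lra.
Qed.

(** The origin is left out because it has no polar angle and Bessel's inequality is stated for
    circles of positive radius. *)
Definition punctured : set R2 := [set p | 0 < normc (p2c p) < 1].

Lemma measurable_punctured : measurable punctured.
Proof.
rewrite (_ : punctured = [set p | normc (p2c p) < 1] `&` [set p | 0 < normc (p2c p)]).
  apply: measurableI; first exact: measurable_p2c_ball.
  have := measurable_fun_ltr (@measurable_cst _ _ R2 R setT 0) (measurable_normc cmeas_p2c).
  move=> /(_ measurableT [set true]); rewrite setTI; apply.
  by [].
by apply/seteqP; split => p /=; [move=> /andP[? ?]|move=> [? ?]; apply/andP].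
Qed.

(** Polar coordinates would give pi / (n + 1). The order of magnitude is enough, and is seen on a
    piece of a thin ring of width 1/2 and height at least 1 / (4 (n + 1)), where the integrand is at
    least 1/2. *)
Lemma moment_ge (n : nat) :
  ((16 * n.+1%:R)^-1%:E <= \int[mu2]_(p in punctured) (normc (p2c p) ^+ (2 * n))%:E)%E.
Proof.
pose q : R := 1 - (2 * n.+1%:R)^-1.
have n1 : 0 < n.+1%:R :> R by rewrite ltr0n.
have q01 : 2^-1 <= q <= 1.
  rewrite /q; apply/andP; split; last by rewrite gerBl invr_ge0 ltW// mulr_gt0.
  have : (2 * n.+1%:R)^-1 <= 2^-1 :> R.
    by rewrite lef_pV2 ?posrE ?mulr_gt0// ler_peMr// ler1n.
  by move: (2 * n.+1%:R)^-1 => u; lra.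
pose A := [set p : R2 | (0 <= p.1 <= 2^-1) /\ (q < normc (p2c p) ^+ 2 < 1)].
have mb (b : R2 -> bool) : measurable_fun setT b -> measurable [set p | b p].
  by move=> /(_ measurableT [set true]); rewrite setTI; apply; by [].
have mA : measurable A.
  have -> : A = ([set p | 0 <= p.1] `&` [set p | p.1 <= 2^-1]) `&`
      ([set p | q < normc (p2c p) ^+ 2] `&` [set p | normc (p2c p) ^+ 2 < 1]).
    apply/seteqP; split => p; first by move=> [/andP[? ?] /andP[? ?]].
    by move=> [[/= ? ?] [/= ? ?]]; split; apply/andP.
  have ms := measurable_sqr_normc cmeas_p2c.
  apply: measurableI; apply: measurableI; apply: mb.
  - by apply: measurable_fun_ler; [exact: measurable_cst|exact: measurable_fst].
  - by apply: measurable_fun_ler; [exact: measurable_fst|exact: measurable_cst].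
  - by apply: measurable_fun_ltr; [exact: measurable_cst|exact: ms].
  - by apply: measurable_fun_ltr; [exact: ms|exact: measurable_cst].
pose k p : \bar R := (2^-1 * \1_A p)%:E.
have mk : measurable_fun setT k.
  by apply/measurable_EFinP/measurable_funM; [exact: measurable_cst|exact: measurable_indic].
have k0 p : (0 <= k p)%E by rewrite lee_fin mulr_ge0// ?invr_ge0.
apply: (@le_trans _ _ (\int[mu2]_p k p)%E).
  apply: le_trans (_ : _ <= \int[mu]_x fubini_F mu k x)%E _; last first.
    by rewrite le_eqVlt; apply/orP; left; apply/eqP/esym; exact: fubini_tonelli1.
  apply: (@le_trans _ _ (\int[mu]_(x in `[0%R, 2^-1%R]) (8 * n.+1%:R)^-1%:E)%E).
    rewrite integral_cst//= lebesgue_measure_itv /= lte_fin invr_gt0 ltr0n /= sube0 -EFinM lee_fin.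
    by rewrite -invfM lef_pV2 ?posrE ?mulr_gt0//; lra.
  rewrite [leRHS](_ : _ = \int[mu]_(x in setT) fubini_F mu k x)%E//.
  apply: (@le_trans _ _ (\int[mu]_(x in `[0%R, 2^-1%R]) fubini_F mu k x)%E); last first.
    apply: ge0_subset_integral => //; first exact: measurable_fun_fubini_tonelli_F.
    by move=> x _; apply: integral_ge0 => y _; exact: k0.
  apply: ge0_le_integral => //.
  - by apply: measurable_funTS; exact: measurable_fun_fubini_tonelli_F.
  - move=> x /=; rewrite in_itv /= => x01.
    have := sqrt_gap x01 q01; set a := Num.sqrt (1 - _); set b := Num.sqrt _ => gap.
    have ba : b < a.
      have : 0 < (1 - q) / 2 by rewrite /q opprB addrCA subrr addr0 divr_gt0// invr_gt0 mulr_gt0.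
      by move=> ?; rewrite -subr_gt0; exact: lt_le_trans gap.
    apply: (@le_trans _ _ (\int[mu]_(y in `]b, a[) (2^-1)%:E)%E).
      rewrite integral_cst//= lebesgue_measure_itv /= lte_fin ba -EFinB -EFinM lee_fin.
      apply: le_trans (_ : _ <= 2^-1 * ((1 - q) / 2)) _; last by rewrite ler_pM2l// invr_gt0.
      rewrite /q opprB addrCA subrr addr0 -invfM -invfM lef_pV2 ?posrE ?mulr_gt0//.
      by lra.
    apply: (@le_trans _ _ (\int[mu]_(y in `]b, a[) k (x, y))%E).
      apply: ge0_le_integral => //.
      - by apply: measurable_funTS; exact: (measurableT_comp mk (measurable_pair1 x)).
      - move=> y /=; rewrite in_itv /= => /andP[yb ya].
        rewrite lee_fin indicE mem_set ?mulr1//; split => //=.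
        have x2 : x ^+ 2 <= 4^-1.
          by case/andP: x01 => ? ?; have : x * x <= 2^-1 * 2^-1 by [exact: ler_pM]; rewrite expr2; lra.
        have y0 : 0 <= y by rewrite (le_trans (sqrtr_ge0 _) (ltW yb)).
        rewrite sqr_normc /=; case/andP: q01 => q0 q1.
        have b2 : b ^+ 2 = q - x ^+ 2 by rewrite sqr_sqrtr//; lra.
        have a2 : a ^+ 2 = 1 - x ^+ 2 by rewrite sqr_sqrtr//; lra.
        have : b ^+ 2 < y ^+ 2 by rewrite ltrXn2r// ?nnegrE ?sqrtr_ge0.
        have : y ^+ 2 < a ^+ 2 by rewrite ltrXn2r// ?nnegrE ?sqrtr_ge0.
        by rewrite a2 b2 => ? ?; apply/andP; split; lra.
    rewrite /fubini_F; apply: ge0_subset_integral => //.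
    exact: (measurableT_comp mk (measurable_pair1 x)).
rewrite [leRHS]integral_mkcond; apply: ge0_le_integral => //.
  apply: (iffLR (measurable_restrictT _ measurable_punctured)).
  apply: measurable_funTS; apply/measurable_EFinP.
  exact: measurable_funX (measurable_normc cmeas_p2c).
move=> p _; rewrite /k patchE indicE; case: ifPn => [pp|pp].
  rewrite lee_fin; have [/set_mem [_ /andP[pq _]]|_] := boolP (p \in A); last first.
    by rewrite mulr0 exprn_ge0// normc_ge0.
  rewrite mulr1 (le_trans (bernoulli_half n))// exprM lerXn2r// ?nnegrE ?sqr_ge0//.
    by rewrite -/q (le_trans _ (andP q01).1)// invr_ge0.
  by rewrite ltW.
have [/set_mem [_ /andP[pq p1]]|_] := boolP (p \in A); last by rewrite mulr0.
case/negP: pp; apply/mem_set; rewrite /punctured /=.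
have np := normc_ge0 (p2c p).
have q0 : 0 < q by apply: lt_le_trans (andP q01).1; rewrite invr_gt0.
apply/andP; split; last by rewrite -(@ltr_pXn2r _ 2)// ?nnegrE ?expr1n.
by rewrite lt_neqAle np andbT; apply/eqP => E; move: pq; rewrite -E expr0n /=; lra.
Qed.

End Area.

Section DirichletCoefficients.
Context {R : realType}.
Local Notation mu := (@lebesgue_measure R).
Local Notation mu2 := (mu \x mu)%E.
Local Notation R2 := (measurableTypeR R * measurableTypeR R)%type.
Implicit Types (r s t x y : R) (z w : R[i]) (f g : R[i] -> R[i]) (p : R2).

Lemma p2c_rot t p : p2c (rot (cos t) (sin t) p) = expi t * p2c p.
Proof.
rewrite expi_cos_sin; case: p => x y; apply/eqP; rewrite eq_complex /=.
by apply/andP; split; apply/eqP; ring.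
Qed.

Lemma polar z : z != 0 -> exists2 t, 0 <= t <= 2 * pi & z = (normc z)%:C * expi t.
Proof.
move=> z0; have n0 : 0 < normc z by rewrite normc_gt0.
have [|t t01 zt] := @expi_surj R (z / (normc z)%:C).
  by rewrite normc_div normc_real gtr0_norm// divff// gt_eqF.
exists t => //; rewrite -zt mulrC divfK// eq_complex /= eqxx andbT gt_eqF//.
Qed.

Lemma mem_itvcc (a b u : R) : (u \in `[a, b]%classic) = (a <= u <= b).
Proof.
apply/idP/idP => [/set_mem|] /=; first by rewrite in_itv.
by move=> h; apply/mem_set; rewrite /= in_itv.
Qed.

Lemma indic_itv (a b u : R) : \1_(`[a, b]%classic) u = ((a <= u <= b)%R : nat)%:R :> R.
Proof. by rewrite indicE mem_itvcc. Qed.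

(** The angle makes two turns because [p] has its own angle [tau] in [0, 2 pi]: the window from tau
    to tau + 4 pi always contains the fixed turn [2 pi, 4 pi], and no wrap-around has to be
    treated. *)
Lemma circle_average_ge f p N : holo f -> punctured p ->
  ((2 * pi * \sum_(n < N) n.+1%:R ^+ 2 * normc (tcoef f n.+1) ^+ 2 * normc (p2c p) ^+ (2 * n))%:E
   <= \int[mu]_t ((\1_(`[0%R, (4 * pi)%R]%classic) t : R)%:E *
      (normc (derive1 f (expi t * p2c p)) ^+ 2)%:E))%E.
Proof.
move=> fh pp; set r := normc (p2c p); have r01 : 0 < r < 1 := pp.
have [|tau /andP[tau0 tau1] ptau] := @polar (p2c p).
  by rewrite -normc_gt0; case/andP: r01.
have r00 : 0 < r by case/andP: r01.
pose k u := normc (derive1 f (r%:C * expi u)) ^+ 2.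
have kc u : cont_at k u.
  apply: cont_sqr_normc; apply: cont_on_circle => z zr.
  apply: (holo_cont (holo_derive1 fh)); rewrite zr gtr0_norm//.
  by case/andP: r01.
have mk : measurable_fun [set: measurableTypeR R] k.
  by apply: continuous_measurable_fun => u; have [] := kc u.
have k0 u : 0 <= k u by exact: sqr_ge0.
have pi0 := @pi_gt0 R.
pose F1 (u : R) := ((\1_(`[tau, (4 * pi + tau)%R]%classic) u * k u)%:E : \bar R).
pose F2 (u : R) := ((\1_(`[(2 * pi)%R, (4 * pi)%R]%classic) u * k u)%:E : \bar R).
have mF a b : measurable_fun [set: measurableTypeR R] (fun u : R => (\1_(`[a, b]%classic) u * k u)%:E).
  by apply/measurable_EFinP/measurable_funM => //; exact: measurable_indic.
have F0 a b u : (0 <= (\1_(`[a, b]%classic) u * k u)%:E)%E by rewrite lee_fin mulr_ge0.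
rewrite (_ : (\int[mu]_t _)%E = (\int[mu]_t F1 (t + tau)%R)%E); last first.
  have E t : r%:C * expi (t + tau) = expi t * p2c p.
    by rewrite expiD [in RHS]ptau /r; ring.
  apply: eq_integral => t _; rewrite -EFinM /F1 /k E; congr (_ * _)%:E.
  by rewrite !indic_itv lerDr lerD2r.
rewrite (integral_shift _ (mF _ _) (F0 _ _)).
apply: (@le_trans _ _ (\int[mu]_u F2 u)%E); last first.
  apply: ge0_le_integral => //; [by move=> u _; exact: F0|exact: mF|].
  move=> u _; rewrite lee_fin ler_wpM2r// !indic_itv ler_nat.
  have [u2|_] := boolP (2 * pi <= u <= 4 * pi); last by [].
  by have -> : tau <= u <= 4 * pi + tau by lra.
rewrite -(integral_shift (2 * pi) (mF _ _) (F0 _ _)).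
rewrite (_ : (\int[mu]_x _)%E = (\int[mu]_(t in `[0%R, (2 * pi)%R]) (k t)%:E)%E); last first.
  rewrite [RHS]integral_mkcond; apply: eq_integral => t _.
  rewrite patchE indicE /k expiD expi2pi mulr1 (_ : (_ \in _) = (t \in `[0, 2 * pi]%classic)).
    by case: ifP => _; rewrite ?mul1r ?mul0r.
  by rewrite !mem_itvcc; apply/idP/idP => ?; lra.
have ik : mu.-integrable `[0, 2 * pi] (EFin \o k) by exact: rint_integrable.
rewrite -(fineK (integrable_fin_num _ ik)) //.
rewrite lee_fin; exact: bessel_derive.
Qed.

Lemma sigma_finite_plane : sigma_finite [set: R2] mu2.
Proof.
exists (fun n => `[- n%:R, n%:R]%classic `*` `[- n%:R, n%:R]%classic).
  apply/esym/seteqP; split=> // -[x y] _.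
  have [n Hn] : exists n : nat, `|x| + `|y| < n%:R.
    by exists (Num.bound (`|x| + `|y|)); apply: archi_boundP; rewrite addr_ge0.
  have xn : `|x| <= n%:R by have := normr_ge0 y; lra.
  have yn : `|y| <= n%:R by have := normr_ge0 x; lra.
  by exists n => //; split; rewrite /= in_itv /= -ler_norml.
move=> n; pose I : set (measurableTypeR R) := `[- n%:R, n%:R]%classic; have mI : measurable I by exact: measurable_itv.
split; first exact: (measurableX mI mI).
rewrite -/I; apply: (le_lt_trans (y := (n%:R + n%:R)%:E * (n%:R + n%:R)%:E)%E); last by rewrite -EFinM ltry.
have nn : - n%:R <= n%:R :> R by rewrite (le_trans _ (ler0n R n))// oppr_le0.
have -> : (mu2 (I `*` I) = mu I * mu I)%E by exact: product_measure1E.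
by have := measure_itvcc nn; rewrite opprK => ->.
Qed.

(** Averaging over rotations takes the place of a change to polar coordinates. The area integral is
    rotation invariant; after exchanging angle and area, Bessel's inequality for the derivative
    bounds the angular integral at each point, and [moment_ge] integrates the remaining powers of
    |p|. *)
Lemma dirichlet_tcoef f : dirichlet_space f ->
  exists A, forall N, \sum_(n < N) n.+1%:R * normc (tcoef f n.+1) ^+ 2 <= A.
Proof.
move=> [/analytic_holo fh DI].
pose D : set R2 := [set p | normc (p2c p) < 1].
have mD : measurable D by exact: measurable_p2c_ball.
pose g p : \bar R := (normc (derive1 f (p2c p)) ^+ 2)%:E.
have mg : measurable_fun D g.
  by apply/measurable_EFinP/measurable_sqr_normc/cmeas_holo/holo_derive1.
pose G := g \_ D.
have mG : measurable_fun [set: R2] G by apply: (iffLR (measurable_restrictT _ mD)).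
have G0 p : (0 <= G p)%E by rewrite /G patchE; case: ifP => // _; rewrite lee_fin sqr_ge0.
have pi0 := @pi_gt0 R.
have [i i0 iE] : exists2 i : R, 0 <= i & (\int[mu2]_p G p = i%:E)%E.
  have I0 : (0 <= \int[mu2]_p G p)%E by exact: integral_ge0.
  move: DI; rewrite /dirichlet_integral.
  rewrite (_ : [set p | disc (p.1 +i* p.2)] = D); last by apply/seteqP; split => p /discE.
  rewrite integral_mkcond -/g -/G; move: I0; case: (\int[mu2]_p G p)%E => [i||] //.
    by rewrite lee_fin => i0 _; exists i.
  by rewrite gt0_muley ?lte_fin ?invr_gt0// ltxx.
(* The n-th term contributes 2 pi (n+1)^2 |a|^2 / (16 (n+1)) = (pi / 8) (n+1) |a|^2 to a total of at
   most 4 pi i, where [i] is the area integral before division by pi. *)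
exists (32 * i) => N.
pose H (q : measurableTypeR R * R2) : \bar R :=
  ((\1_(`[0%R, (4 * pi)%R]%classic) q.1 : R)%:E * G (rot (cos q.1) (sin q.1) q.2))%E.
have mH : measurable_fun [set: (measurableTypeR R * R2)%type] H.
  apply: emeasurable_funM.
    apply/measurable_EFinP; apply: (@measurableT_comp _ _ _ _ _ _ (\1_(`[0%R, (4 * pi)%R]%classic) : measurableTypeR R -> R)).
      exact: measurable_indic.
    exact: measurable_fst.
  apply: (measurableT_comp mG).
  have mc : measurable_fun [set: (measurableTypeR R * R2)%type] (fun q => cos q.1).
    by apply: (measurableT_comp (continuous_measurable_fun (@continuous_cos R))); exact: measurable_fst.
  have ms : measurable_fun [set: (measurableTypeR R * R2)%type] (fun q => sin q.1).
    by apply: (measurableT_comp (continuous_measurable_fun (@continuous_sin R))); exact: measurable_fst.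
  have m1 : measurable_fun [set: (measurableTypeR R * R2)%type] (fun q => q.2.1).
    exact: (measurableT_comp measurable_fst measurable_snd).
  have m2 : measurable_fun [set: (measurableTypeR R * R2)%type] (fun q => q.2.2).
    exact: (measurableT_comp measurable_snd measurable_snd).
  apply: measurable_fun_pair.
    exact: (measurable_funB (measurable_funM mc m1) (measurable_funM ms m2)).
  exact: (measurable_funD (measurable_funM ms m1) (measurable_funM mc m2)).
have H0 q : (0 <= H q)%E by apply: mule_ge0 => //; rewrite lee_fin.
have E1 : (\int[mu]_t \int[mu2]_p H (t, p) = (4 * pi * i)%:E)%E.
  transitivity (\int[mu]_t ((\1_(`[0%R, (4 * pi)%R]%classic) t : R)%:E * i%:E))%E.
    apply: eq_integral => t _.
    have j0 : (0 <= (\1_(`[0%R, (4 * pi)%R]%classic) t : R)%:E)%E by rewrite lee_fin.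
    have mGr := measurableT_comp mG (measurable_rot (cos t) (sin t)).
    apply: (etrans (ge0_integralZl mu2 measurableT mGr (fun p _ => G0 _) j0)).
    by congr (_ * _)%E; rewrite -iE; apply: rotation_invariance => //; exact: cos2Dsin2.
  rewrite ge0_integralZr//.
  - have -> : (\int[mu]_x (\1_(`[0%R, (4 * pi)%R]%classic) x)%:E = (4 * pi)%R%:E)%E.
      apply: etrans (integral_indic mu measurableT (measurable_itv `[0%R, 4 * pi])) _.
      rewrite setIT; apply: etrans (lebesgue_measure_itv `[0%R, 4 * pi]) _.
      by rewrite /= lte_fin mulr_gt0//= sube0.
    by rewrite -EFinM.
  - by apply/measurable_EFinP; exact: measurable_indic.
pose c n := 2 * pi * (n.+1%:R ^+ 2 * normc (tcoef f n.+1) ^+ 2).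
have c0 n : 0 <= c n by rewrite /c; apply: mulr_ge0; [lra|apply: mulr_ge0; exact: sqr_ge0].
have E2 : (\int[mu2]_(p in punctured) \sum_(n < N) (c n * normc (p2c p) ^+ (2 * n))%:E
    <= (4 * pi * i)%:E)%E.
  pose m2 : {sigma_finite_measure set R2 -> \bar R} :=
    HB.pack (mu2 : set R2 -> \bar R) (Measure.on mu2)
      (Measure_isSigmaFinite.Build _ _ _ _ sigma_finite_plane).
  rewrite -E1 [X in (_ <= X)%E](fubini_tonelli (m1 := mu) (m2 := m2) H mH H0).
  apply: (@le_trans _ _ (\int[mu2]_(p in punctured) \int[mu]_t H (t, p))%E); last first.
    apply: ge0_subset_integral => //; first exact: measurable_punctured.
      exact: (measurable_fun_fubini_tonelli_G (m1 := mu) H mH H0).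
    by move=> p _; apply: integral_ge0.
  apply: ge0_le_integral => //.
  - exact: measurable_punctured.
  - by move=> p _; apply: sume_ge0 => n _; rewrite lee_fin mulr_ge0// exprn_ge0// normc_ge0.
  - apply: measurable_funTS; apply: emeasurable_sum => n; apply/measurable_EFinP.
    apply: measurable_funM; first exact: measurable_cst.
    exact: measurable_funX (measurable_normc cmeas_p2c).
  - apply: measurable_funTS.
    exact: (measurable_fun_fubini_tonelli_G (m1 := mu) H mH H0).
  move=> p pp; have := circle_average_ge N fh pp.
  rewrite mulr_sumr -sumEFin.
  under eq_bigr do rewrite (mulrA (2 * pi)).
  rewrite (_ : (\int[mu]_t H (t, p))%E = (\int[mu]_t ((\1_(`[0%R, (4 * pi)%R]%classic) t : R)%:E *
      (normc (derive1 f (expi t * p2c p)) ^+ 2)%:E))%E)//.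
  apply: eq_integral => t _; rewrite /H /= /G patchE ifT /g ?p2c_rot//.
  by apply/mem_set; rewrite /D /= p2c_rot normcM normc_expi mul1r; case/andP: pp.
have E3 : ((\sum_(n < N) c n * (16 * n.+1%:R)^-1)%:E <= (4 * pi * i)%:E)%E.
  apply: le_trans E2; rewrite ge0_integral_sum; last 3 first.
  - exact: measurable_punctured.
  - move=> n; apply: measurable_funTS; apply/measurable_EFinP.
    apply: measurable_funM; first exact: measurable_cst.
    exact: measurable_funX (measurable_normc cmeas_p2c).
  - by move=> n p _; rewrite lee_fin mulr_ge0// exprn_ge0// normc_ge0.
  rewrite -sumEFin; apply: lee_sum => n _.
  under eq_integral do rewrite EFinM.
  rewrite ge0_integralZl//.
  - by rewrite EFinM lee_wpmul2l ?lee_fin// moment_ge.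
  - exact: measurable_punctured.
  - apply: measurable_funTS; apply/measurable_EFinP.
    exact: measurable_funX (measurable_normc cmeas_p2c).
  - by move=> p _; rewrite lee_fin exprn_ge0// normc_ge0.
  - by rewrite lee_fin.
move: E3; rewrite lee_fin => E3.
have pi8 : 0 < pi / 8 :> R by rewrite divr_gt0.
rewrite -(ler_pM2l pi8) mulr_sumr.
apply: le_trans (_ : _ <= 4 * pi * i) _; last by rewrite le_eqVlt; apply/orP; left; apply/eqP; field.
apply: le_trans E3; rewrite le_eqVlt; apply/orP; left; apply/eqP.
apply: eq_bigr => n _; rewrite /c; field.
by rewrite nat1r pnatr_eq0.
Qed.

End DirichletCoefficients.

Section RealMeans.
Context {R : realType}.
Implicit Types (u v : R -> R) (t : R).

Lemma rcont_cst (k : R) t : cont_at (fun _ : R => k) t.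
Proof. by split; exact: cvg_cst. Qed.

Lemma rcontD u v t : cont_at u t -> cont_at v t -> cont_at (fun t => u t + v t) t.
Proof. by move=> [uc] [vc]; split; exact: (cvgD uc vc). Qed.

Lemma rcontB u v t : cont_at u t -> cont_at v t -> cont_at (fun t => u t - v t) t.
Proof. by move=> [uc] [vc]; split; exact: (cvgB uc vc). Qed.

Lemma rcontM u v t : cont_at u t -> cont_at v t -> cont_at (fun t => u t * v t) t.
Proof. by move=> [uc] [vc]; split; exact: (cvgM uc vc). Qed.

Lemma rintD u v : (forall t, cont_at u t) -> (forall t, cont_at v t) ->
  rint (fun t => u t + v t) = rint u + rint v.
Proof. by move=> uc vc; rewrite /rint RintegralD//; exact: rint_integrable. Qed.

Lemma rintB u v : (forall t, cont_at u t) -> (forall t, cont_at v t) ->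
  rint (fun t => u t - v t) = rint u - rint v.
Proof. by move=> uc vc; rewrite /rint RintegralB//; exact: rint_integrable. Qed.

Lemma rintZ (k : R) u : (forall t, cont_at u t) -> rint (fun t => k * u t) = k * rint u.
Proof. by move=> uc; rewrite /rint RintegralZl//; exact: rint_integrable. Qed.

Lemma eq_rint u v : u =1 v -> rint u = rint v.
Proof. by move=> uv; apply: eq_Rintegral => t _. Qed.

End RealMeans.

(** * Growth of quadratic means towards the unit circle *)

Section HardyMeans.
Context {R : realType}.
Implicit Types (r s t : R) (z w : R[i]) (f h S : R[i] -> R[i]).

Lemma bernoulli r (n : nat) : 0 <= r <= 1 -> 1 - r ^+ n <= n%:R * (1 - r).
Proof.
move=> /andP[r0 r1]; elim: n => [|n IH]; first by rewrite expr0 subrr mul0r.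
have p0 : 0 <= r ^+ n by exact: exprn_ge0.
have : r * (1 - r ^+ n) <= 1 - r ^+ n by rewrite ler_piMl// subr_ge0 exprn_ile1.
rewrite exprS -natr1; lra.
Qed.

(** Termwise, s^(2n) - r^(2n) <= 1 - r^(2n) <= 2 n (1 - r); the factor n is exactly what the
    Dirichlet bound absorbs. *)
Lemma tsum_growth f A N r s : 0 < r -> r < s -> s < 1 ->
  (forall N, \sum_(n < N) n.+1%:R * normc (tcoef f n.+1) ^+ 2 <= A) ->
  tsum f N s - tsum f N r <= 2 * (1 - r) * A.
Proof.
move=> r0 rs s1 HA.
have A0 : 0 <= A by have := HA 0%N; rewrite big_ord0.
have k0 : 0 <= 2 * (1 - r) by lra.
rewrite /tsum -sumrB; case: N => [|N]; first by rewrite big_ord0 mulr_ge0.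
apply: (@le_trans _ _ (\sum_(n < N.+1) 2 * (1 - r) * (n%:R * normc (tcoef f n) ^+ 2))).
  apply: ler_sum => n _; rewrite -mulrBr mulrCA mulrA mulrC ler_wpM2r ?sqr_ge0//.
  have r01 : 0 <= r <= 1 by lra.
  have := bernoulli (2 * n) r01; rewrite natrM.
  have : s ^+ (2 * n) <= 1 by apply: exprn_ile1; lra.
  lra.
rewrite -mulr_sumr big_ord_recl mul0r add0r ler_wpM2l//; exact: HA.
Qed.

Lemma sqmean_growth f A r s : holo f -> 0 < r -> r < s -> s < 1 ->
  (forall N, \sum_(n < N) n.+1%:R * normc (tcoef f n.+1) ^+ 2 <= A) ->
  sqmean f s - sqmean f r <= 4 * pi * A * (1 - r).
Proof.
move=> fh r0 rs s1 HA; apply/ler_addgt0Pr => e e0.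
have s01 : 0 < s < 1 by lra.
have r01 : 0 < r < 1 by lra.
have [N HN] := parseval fh s01 e0.
have := tsum_le N fh r01; have := tsum_growth N r0 rs s1 HA.
have := @pi2_gt0 R; move: HN.
move: (sqmean f s) (sqmean f r) (tsum f N s) (tsum f N r) => a b c d H1 p0 H2 H3.
have : 2 * pi * (c - d) <= 2 * pi * (2 * (1 - r) * A) by rewrite ler_pM2l.
lra.
Qed.

Lemma sqmean_le h r s : holo h -> 0 < r -> r <= s -> s < 1 -> sqmean h r <= sqmean h s.
Proof.
move=> hh r0 rs s1; apply/ler_addgt0Pr => e e0.
have r01 : 0 < r < 1 by lra.
have [N HN] := parseval hh r01 e0; apply: le_trans HN _; rewrite lerD2r.
apply: (@le_trans _ _ (2 * pi * tsum h N s)); last by apply: tsum_le => //; lra.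
rewrite ler_wpM2l ?(ltW pi2_gt0)//; apply: ler_sum => n _.
by rewrite ler_wpM2l ?sqr_ge0// lerXn2r ?nnegrE; lra.
Qed.

(** One N serves all radii near 1: some [r0] nearly attains the supremum of the means, Parseval at
    [r0] fixes N, and beyond [r0] the partial sum only increases while the mean stays below the
    supremum. *)
Lemma hardy_tail h M e : holo h -> (forall r, 0 < r < 1 -> sqmean h r <= M) -> 0 < e ->
  exists (N : nat) (r0 : R), 0 < r0 < 1 /\
    forall r, r0 <= r < 1 -> sqmean h r - 2 * pi * tsum h N r <= e.
Proof.
move=> hh hM e0; pose Q := [set sqmean h r | r in [set r | 0 < r < 1]].
have Qs : has_sup Q.
  split; first by exists (sqmean h 2^-1); exists 2^-1 => //=; lra.
  by exists M => _ [r r01 <-]; exact: hM.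
have e2 : 0 < e / 2 by rewrite divr_gt0.
have [_ [r0 /= r01 <-] Hr] := sup_adherent e2 Qs.
have [N HN] := parseval hh r01 e2.
exists N, r0; split => // r /andP[rr r1].
have r2 : 0 < r < 1 by lra.
have : sqmean h r <= sup Q by apply: ub_le_sup; [by case: Qs|exists r].
have : 2 * pi * tsum h N r0 <= 2 * pi * tsum h N r.
  rewrite ler_wpM2l ?(ltW pi2_gt0)//; apply: ler_sum => n _.
  by rewrite ler_wpM2l ?sqr_ge0// lerXn2r ?nnegrE; lra.
lra.
Qed.

(** Replaces dominated convergence on the boundary. Up to a part small in mean square uniformly in
    r, [h] is a polynomial, hence bounded; the weight has small mean against the polynomial and is
    at most 1 against the rest. *)
Lemma weighted_mean_small h M (g : R -> R -> R) : holo h ->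
  (forall r, 0 < r < 1 -> sqmean h r <= M) ->
  (forall r t, 0 < r < 1 -> cont_at (g r) t) ->
  (forall r t, 0 < r < 1 -> 0 <= g r t <= 1) ->
  (forall e r0, 0 < e -> 0 < r0 < 1 -> exists2 r, r0 < r < 1 & rint (g r) <= e) ->
  forall e r0, 0 < e -> 0 < r0 < 1 -> exists2 r, r0 < r < 1 &
    rint (fun t => g r t * normc (h (r%:C * expi t)) ^+ 2) <= e.
Proof.
move=> hh hM gc g01 gs e r0 e0 r01.
have e4 : 0 < e / 4 by rewrite divr_gt0.
have [N [r1 [r11 HN]]] := hardy_tail hh hM e4.
pose B := (\sum_(n < N) normc (tcoef h n)) ^+ 2.
have B0 : 0 <= B by exact: sqr_ge0.
(* The final bound is 2 B times the mean of the weight plus twice the tail; each of the two is kept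
   below e / 2. *)
have eB : 0 < e / (4 * (B + 1)) by rewrite divr_gt0// mulr_gt0//; lra.
have m01 : 0 < Num.max r0 r1 < 1 by rewrite lt_max gt_max; lra.
have [r /andP[rm r2] Hr] := gs _ _ eB m01.
have /andP[rr0 rr1] : (r0 < r) && (r1 < r) by rewrite -gt_max.
exists r; first by rewrite rr0.
have r02 : 0 < r < 1 by lra.
pose P t := \sum_(n < N) tcoef h n * (r%:C * expi t) ^+ n.
have hc := holo_circle_cont hh r02.
have Pc t : cont_at P t.
  rewrite /P; elim: N {HN B B0 eB Hr} @P => [|N IH] /=.
    by under eq_fun do rewrite big_ord0; exact: cont_cst.
  under eq_fun do rewrite big_ord_recr /=; apply: contD; first exact: IH.
  apply: contM; first exact: cont_cst.
  apply: (@cont_comp _ _ _ (fun y => r%:C * expi y) (fun z => z ^+ N)); first exact: cont_circle.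
  by have [l /cdiff_continuous] := cdiffX (r%:C * expi t) N.
have PB t : normc (P t) ^+ 2 <= B.
  rewrite lerXn2r ?nnegrE ?normc_ge0//; first by apply: sumr_ge0 => n _; exact: normc_ge0.
  rewrite /P; elim/big_ind2: _ => [|x a y b ax yb|n _].
  - by rewrite normc0.
  - by apply: le_trans (normcD _ _) _; exact: lerD.
  - rewrite normcM normcX normc_circle ler_piMr ?normc_ge0// exprn_ile1 ?normr_ge0//.
    by rewrite gtr0_norm; lra.
have Qc t : cont_at (fun t => normc (h (r%:C * expi t) - P t) ^+ 2) t.
  by apply: cont_sqr_normc; apply: contB.
apply: (@le_trans _ _ (rint (fun t => 2 * B * g r t + 2 * normc (h (r%:C * expi t) - P t) ^+ 2))).
  apply: le_rint => t.
  - by apply: rcontM; [exact: gc|exact: cont_sqr_normc].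
  - apply: rcontD; apply: rcontM; [exact: rcont_cst|exact: gc|exact: rcont_cst|exact: Qc].
  have /andP[g0 g1] := g01 r t r02.
  have : normc (h (r%:C * expi t)) <= normc (h (r%:C * expi t) - P t) + normc (P t).
    by apply: le_trans (normcD _ _); rewrite subrK.
  have := PB t; have := normc_ge0 (h (r%:C * expi t) - P t); have := normc_ge0 (P t).
  have := normc_ge0 (h (r%:C * expi t)).
  move: (normc (h _)) (normc (_ - _)) (normc (P t)) (g r t) g0 g1 => a b c k k0 k1 a0 c0 b0 cB ab.
  have h1 : a ^+ 2 <= 2 * c ^+ 2 + 2 * b ^+ 2.
    have : a ^+ 2 <= (b + c) ^+ 2 by rewrite lerXn2r ?nnegrE// addr_ge0.
    by have := sqr_ge0 (b - c); rewrite !expr2; lra.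
  have h2 : k * a ^+ 2 <= k * (2 * B + 2 * b ^+ 2) by rewrite ler_wpM2l//; lra.
  have : k * b ^+ 2 <= b ^+ 2 by rewrite ler_piMl// sqr_ge0.
  lra.
rewrite rintD; [|by move=> t; apply: rcontM; [exact: rcont_cst|exact: gc]
  |by move=> t; apply: rcontM; [exact: rcont_cst|exact: Qc]].
rewrite rintZ; last by move=> t; exact: gc.
rewrite rintZ// bessel_holo//.
have : sqmean h r - 2 * pi * tsum h N r <= e / 4 by apply: HN; lra.
have : B * rint (g r) <= e / 4.
  apply: (@le_trans _ _ (B * (e / (4 * (B + 1))))); first by rewrite ler_wpM2l.
  rewrite invfM mulrCA ler_pM2l// mulrA mulrAC ger_pMl ?invr_gt0//.
  by rewrite ler_pdivrMr; lra.
lra.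
Qed.

(** The left side is the mean of |h|^2 minus that of |f|^2. Some s > r makes this difference at most
    [e]; from r to s the first mean cannot decrease, and the second grows by at most a constant
    times 1 - r. *)
Lemma product_mean_bound f h S A M : holo f -> holo h ->
  (forall z, normc z < 1 -> f z = S z * h z) ->
  (forall z, normc z < 1 -> normc (S z) <= 1) ->
  (forall r t, 0 < r < 1 -> cont_at (fun t => S (r%:C * expi t)) t) ->
  (forall N, \sum_(n < N) n.+1%:R * normc (tcoef f n.+1) ^+ 2 <= A) ->
  (forall r, 0 < r < 1 -> sqmean h r <= M) ->
  (forall e r0, 0 < e -> 0 < r0 < 1 -> exists2 r, r0 < r < 1 &
    rint (fun t => 1 - normc (S (r%:C * expi t)) ^+ 2) <= e) ->
  forall r, 0 < r < 1 ->
    rint (fun t => (1 - normc (S (r%:C * expi t)) ^+ 2) * normc (h (r%:C * expi t)) ^+ 2)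
      <= 4 * pi * A * (1 - r).
Proof.
move=> fh hh fSh S1 Sc HA hM Ss r r01.
pose g s t := 1 - normc (S (s%:C * expi t)) ^+ 2.
have disc s t : 0 < s < 1 -> normc (s%:C * expi t : R[i]) < 1.
  by move=> s01; rewrite normc_circle gtr0_norm; lra.
have gc s t : 0 < s < 1 -> cont_at (g s) t.
  by move=> s01; apply: rcontB; [exact: rcont_cst|apply: cont_sqr_normc; exact: Sc].
have g01 s t : 0 < s < 1 -> 0 <= g s t <= 1.
  move=> s01; rewrite subr_ge0 gerBl sqr_ge0 andbT.
  by rewrite exprn_ile1 ?normc_ge0// S1// disc.
have E s : 0 < s < 1 -> rint (fun t => g s t * normc (h (s%:C * expi t)) ^+ 2) =
    sqmean h s - sqmean f s.
  move=> s01; rewrite -rintB; last 2 first.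
  - by move=> t; apply: cont_sqr_normc; exact: holo_circle_cont.
  - by move=> t; apply: cont_sqr_normc; exact: holo_circle_cont.
  apply: eq_rint => t; rewrite fSh ?disc// normcM exprMn /g; ring.
rewrite -/(g r) E//; apply/ler_addgt0Pr => e e0.
have [s /andP[rs s1] Hs] := weighted_mean_small hh hM gc g01 Ss e0 r01.
have /andP[r0 r1] := r01; have s01 : 0 < s < 1 by lra.
have := sqmean_growth fh r0 rs s1 HA; have := sqmean_le hh r0 (ltW rs) s1.
move: Hs; rewrite E//; lra.
Qed.

End HardyMeans.

(** * Herglotz integrals and singular inner functions *)

Section Herglotz.
Context {R : realType} {d : measure_display} {T : measurableType d}.
Variable mu : {measure set T -> \bar R}.
Variables (D : set T) (a : T -> R[i]) (phi : T -> R) (B : R).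
Hypotheses (mD : measurable D) (ma : cmeas D a)
  (a1 : forall x, D x -> 1 <= normc (a x)) (aB : forall x, D x -> normc (a x) <= B)
  (phi_int : mu.-integrable D (EFin \o phi)) (phi0 : forall x, D x -> 0 <= phi x).
Implicit Types (z w : R[i]) (x : T).

Definition herg z := cint mu D (fun x => (phi x)%:C * ((a x + z) / (a x - z))).

Lemma normc2 : normc (2 : R[i]) = 2.
Proof.
have -> : 2 = (2 : R)%:C :> R[i] by rewrite rmorph_nat.
by rewrite normc_real ger0_norm.
Qed.

Lemma herg_density : cintegrable mu D (fun x => 2 * ((phi x)%:C * a x)).
Proof.
have mphi : measurable_fun D phi by apply/measurable_EFinP; exact: measurable_int phi_int.
have mB : mu.-integrable D (EFin \o (fun x => 2 * B * phi x)).
  by apply: eq_integrable (integrableZl mD (2 * B) phi_int).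
apply: (le_cintegrable mD _ _ mB).
  by apply: cmeasM; [exact: cmeas_cst|apply: cmeasM => //; exact: cmeas_real].
move=> x Dx; rewrite !normcM normc_real (ger0_norm (phi0 Dx)).
rewrite normc2 -mulrA ler_wpM2l//.
by rewrite mulrC ler_wpM2r ?phi0 ?aB.
Qed.

Lemma herg_gap z : normc z < 1 -> exists2 e : R, 0 < e &
  forall x, D x -> 2 * e <= normc (a x - z).
Proof.
move=> z1; exists ((1 - normc z) / 2); first by lra.
by move=> x Dx; have := normc_lerB (a x) z; have := a1 Dx; lra.
Qed.

Lemma herg_neq0 z x : normc z < 1 -> D x -> a x - z != 0.
Proof.
move=> z1 Dx; rewrite -normc_gt0.
by have := normc_lerB (a x) z; have := a1 Dx; lra.
Qed.

(** Splitting off a constant leaves a Cauchy kernel; the exponent 1 matches the form of the kernel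
    lemmas. *)
Lemma herg_kernelE z x : normc z < 1 -> D x -> (phi x)%:C * ((a x + z) / (a x - z)) =
  2 * ((phi x)%:C * a x) * (a x - z)^-1 ^+ 1 - (phi x)%:C.
Proof. by move=> z1 Dx; have := herg_neq0 z1 Dx => az; field. Qed.

Lemma cintegrable_phi : cintegrable mu D (fun x => (phi x)%:C).
Proof.
split; first exact: phi_int.
by apply: eq_integrable (integrable0 mu D).
Qed.

Lemma herg_integrable z : normc z < 1 ->
  cintegrable mu D (fun x => (phi x)%:C * ((a x + z) / (a x - z))).
Proof.
move=> z1; have [e e0 He] := herg_gap z1.
have n0 : normc (0 : R[i]) < e by rewrite normc0.
have [ik _] := kernel_integrable mD herg_density ma e0 He 1 n0.
have [ir ii] := cintegrableB mD ik cintegrable_phi.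
by split; [apply: eq_integrable ir|apply: eq_integrable ii] => // x /set_mem Dx /=;
  rewrite herg_kernelE ?addr0.
Qed.

Lemma hergE z : normc z < 1 -> herg z =
  cint mu D (fun x => 2 * ((phi x)%:C * a x) * (a x - z)^-1) - cint mu D (fun x => (phi x)%:C).
Proof.
move=> z1; have [e e0 He] := herg_gap z1.
have n0 : normc (0 : R[i]) < e by rewrite normc0.
have [ik _] := kernel_integrable mD herg_density ma e0 He 1 n0.
rewrite -cintB//; last exact: cintegrable_phi.
  by apply: eq_cint => x Dx; rewrite herg_kernelE// expr1.
case: ik => ir ii.
by split; [apply: eq_integrable ir|apply: eq_integrable ii] => // x /set_mem Dx /=;
  rewrite addr0 expr1.
Qed.

Lemma cdiff_herg z : normc z < 1 ->
  cdiff herg z (cint mu D (fun x => 2 * ((phi x)%:C * a x) * (a x - z)^-1 ^+ 2)).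
Proof.
move=> z1; have [e e0 He] := herg_gap z1.
have := cdiffB (cdiff_kernel mD herg_density ma e0 He)
  (cdiff_cst (cint mu D (fun x => (phi x)%:C)) z).
rewrite subr0; apply: cdiff_near.
by apply: filterS (near_normc_lt z1) => w w1; rewrite hergE.
Qed.

Lemma holo_herg : holo herg.
Proof. by move=> z z1; eexists; exact: cdiff_herg. Qed.

Lemma herg_derive_le z (e : R) : normc z < 1 -> 0 < e ->
  (forall x, D x -> 2 * e <= normc (a x - z)) ->
  normc (cint mu D (fun x => 2 * ((phi x)%:C * a x) * (a x - z)^-1 ^+ 2)) <=
    4 * B * (\int[mu]_(x in D) phi x) / e ^+ 2.
Proof.
move=> z1 e0 He.
have n0 : normc (0 : R[i]) < e by rewrite normc0.
have [_] := kernel_integrable mD herg_density ma e0 He 2 n0.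
under eq_cint do rewrite addr0.
move=> /le_trans; apply.
have : \int[mu]_(x in D) normc (2 * ((phi x)%:C * a x)) <= 2 * B * \int[mu]_(x in D) phi x.
  rewrite -RintegralZl//; apply: le_Rintegral => //.
  - exact: integrable_normc mD herg_density.
  - by apply: eq_integrable (integrableZl mD (2 * B) phi_int).
  move=> x Dx; rewrite !normcM normc_real (ger0_norm (phi0 Dx)).
  rewrite normc2 -mulrA ler_wpM2l//.
  by rewrite mulrC ler_wpM2r ?phi0 ?aB.
have : 0 <= e^-1 ^+ 2 by exact: sqr_ge0.
rewrite -exprVn; set u := e^-1 ^+ 2; set v := \int[mu]_(x in D) normc _; set w := Rintegral _ _ phi.
move=> u0 vw; have : u * v <= u * (2 * B * w) by rewrite ler_wpM2l.
lra.
Qed.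

Lemma Re_kernel (w z : R[i]) : w - z != 0 ->
  complex.Re ((w + z) / (w - z)) = (normc w ^+ 2 - normc z ^+ 2) / normc (w - z) ^+ 2.
Proof.
move=> wz; have n0 : normc (w - z) ^+ 2 != 0 by rewrite expf_neq0// normc_eq0.
apply: (mulIf n0); rewrite divfK//.
have -> : normc (w - z) ^+ 2 = complex.Re ((w - z) * ((w - z)^*)).
  by rewrite sqr_normc; case: (w - z) => x y /=; ring.
have E : (normc (w - z) ^+ 2)%:C = (w - z) * (w - z)^*.
  rewrite sqr_normc; case: (w - z) => x y; apply/eqP; rewrite eq_complex /=.
  by apply/andP; split; apply/eqP; ring.
have F : (w + z) / (w - z) * (normc (w - z) ^+ 2)%:C = (w + z) * (w - z)^*.
  by rewrite E mulrA divfK.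
have G : complex.Re ((w + z) / (w - z) * (normc (w - z) ^+ 2)%:C) =
    complex.Re ((w + z) / (w - z)) * normc (w - z) ^+ 2.
  by case: (_ / _) => x y /=; ring.
have -> : complex.Re ((w - z) * (w - z)^*) = normc (w - z) ^+ 2 by rewrite -E.
rewrite -G F !sqr_normc; case: w {wz n0 E F G} => x y; case: z => x' y' /=; ring.
Qed.

Lemma Re_herg z : normc z < 1 -> complex.Re (herg z) =
  \int[mu]_(x in D) (phi x * ((normc (a x) ^+ 2 - normc z ^+ 2) / normc (a x - z) ^+ 2)).
Proof.
move=> z1; apply: eq_Rintegral => x /set_mem Dx.
rewrite -Re_kernel ?herg_neq0//; case: (_ / _) => u v /=; ring.
Qed.

Lemma poisson_integrable z : normc z < 1 -> mu.-integrable D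
  (EFin \o (fun x => phi x * ((normc (a x) ^+ 2 - normc z ^+ 2) / normc (a x - z) ^+ 2))).
Proof.
move=> z1; case: (herg_integrable z1) => ir _; apply: eq_integrable ir => //.
move=> x /set_mem Dx /=; rewrite -Re_kernel ?herg_neq0//.
by congr EFin; case: (_ / _) => u v /=; ring.
Qed.

Lemma poisson_kernel_ge0 z x : normc z < 1 -> D x ->
  0 <= (normc (a x) ^+ 2 - normc z ^+ 2) / normc (a x - z) ^+ 2.
Proof.
move=> z1 Dx; rewrite divr_ge0 ?sqr_ge0// subr_ge0 lerXn2r ?nnegrE ?normc_ge0//.
by have := a1 Dx; lra.
Qed.

Lemma Re_herg_ge0 z : normc z < 1 -> 0 <= complex.Re (herg z).
Proof.
move=> z1; rewrite Re_herg//; apply: Rintegral_ge0 => x Dx.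
by rewrite mulr_ge0 ?phi0 ?poisson_kernel_ge0.
Qed.

Lemma herg0 : herg 0 = (\int[mu]_(x in D) phi x)%:C.
Proof.
have E x : D x -> (phi x)%:C * ((a x + 0) / (a x - 0)) = (phi x)%:C.
  move=> Dx; rewrite addr0 subr0 divff ?mulr1//.
  by rewrite -normc_gt0 (lt_le_trans _ (a1 Dx)).
rewrite /herg (eq_cint _ E) /cint /=; congr (_ +i* _).
by rewrite Rintegral_cst// mul0r.
Qed.

(** The mean value property, the kernel being 1 at the origin. *)
Lemma rint_Re_herg r : 0 <= r < 1 ->
  rint (fun t => complex.Re (herg (r%:C * expi t))) = 2 * pi * \int[mu]_(x in D) phi x.
Proof.
move=> r01; have := circ_mean holo_herg r01.
rewrite herg0 => /(congr1 (@complex.Re R)) /=.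
by rewrite mul0r subr0.
Qed.

End Herglotz.

Section Borel.
Context {R : realType}.
Implicit Types (z w : R[i]) (E : set R[i]).

Lemma measurable_real_part (u : R[i] -> R) : (forall z, cont_at u z) ->
  measurable_fun [set: borelC R] (u : borelC R -> measurableTypeR R).
Proof.
move=> uc; apply: (measurability (@RGenOInfty.G R)); first exact: RGenOInfty.measurableE.
move=> _ [_ [x ->] <-]; rewrite setTI; apply: sub_sigma_algebra => /=.
apply: open_comp; last exact: rray_open.
by move=> z _; have [] := uc z.
Qed.

Lemma cmeas_borel_id : cmeas [set: borelC R] (fun w : borelC R => w : R[i]).
Proof.
split; apply: measurable_real_part => z; [exact: continuous_Re|exact: continuous_Im].
Qed.

Lemma borel_closed E : closed E -> measurable (E : set (borelC R)).
Proof.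
move=> cE; rewrite -(setCK E); apply: measurableC; apply: sub_sigma_algebra.
exact: closed_openC.
Qed.

Lemma closed_circle : closed (@circle R).
Proof.
have -> : @circle R = @normc R @^-1` [set 1].
  by apply/seteqP; split => z /circleE.
apply: preimage_closed; last exact: closed_eq.
by move=> z _; have [] := continuous_normc z.
Qed.

Lemma borel_compact E : compact E -> measurable (E : set (borelC R)).
Proof.
move=> cE; apply: borel_closed; by apply: compact_closed.
Qed.

End Borel.

(** * Singular inner functions of measures carried by a compact set *)

Section SingularInner.
Context {R : realType}.
Variable mu : {finite_measure set (borelC R) -> \bar R}.
Variable E : set R[i].
Hypotheses (E_compact : compact E) (E_circle : E `<=` circle) (muE : mu (~` E) = 0%E).
Implicit Types (z w : R[i]).

(** Integrating over [E] and not over the whole circle lets the distance to [E] bound the kernel;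
    [singular_innerE] reconciles the two, the complement being null. *)
Definition sherg z := herg mu (E : set (borelC R)) (fun w : borelC R => w : R[i]) (fun=> 1) z.

Let mE : measurable (E : set (borelC R)). Proof. exact: borel_compact. Qed.

Lemma cmeas_idE D : measurable D -> cmeas (D : set (borelC R)) (fun w : borelC R => w : R[i]).
Proof. by move=> mD; apply: cmeas_subset cmeas_borel_id. Qed.

Lemma normc_onE (w : borelC R) : E w -> 1 <= normc (w : R[i]).
Proof. by move=> /E_circle/circleE ->. Qed.

Lemma normc_onE' (w : borelC R) : E w -> normc (w : R[i]) <= 1.
Proof. by move=> /E_circle/circleE ->. Qed.

Lemma integrable_one (D : set (borelC R)) : measurable D -> mu.-integrable D (EFin \o (fun=> 1)).
Proof. by move=> mD; exact: finite_measure_integrable_cst. Qed.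

Lemma Rintegral_null (u : borelC R -> R) : mu.-integrable circle (EFin \o u) ->
  \int[mu]_(w in circle) u w = \int[mu]_(w in E) u w.
Proof.
move=> iu; have mC : measurable (@circle R : set (borelC R)) by apply: borel_closed; exact: closed_circle.
congr fine; rewrite (negligible_integral (measurableC mE) mC iu muE).
by congr (integral _ _ _); rewrite setDE setCK; apply/setIidPr.
Qed.

Lemma singular_innerE z : normc z < 1 -> singular_inner mu z = expC (- sherg z).
Proof.
move=> z1; have mC : measurable (@circle R : set (borelC R)) by apply: borel_closed; exact: closed_circle.
have c1 (w : borelC R) : circle w -> 1 <= normc (w : R[i]) by move=> /circleE ->.
have cB (w : borelC R) : circle w -> normc (w : R[i]) <= 1 by move=> /circleE ->.
have [ir ii] := herg_integrable mC (cmeas_idE mC) c1 cB (integrable_one mC) (fun _ _ => ler01) z1.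
have hr : \int[mu]_(w in circle) complex.Re ((w + z) / (w - z)) = complex.Re (sherg z).
  have -> : \int[mu]_(w in circle) complex.Re ((w + z) / (w - z)) =
      \int[mu]_(w in circle) complex.Re ((1 : R)%:C * ((w + z) / (w - z))).
    by apply: eq_Rintegral => w _; rewrite mul1r.
  exact: (Rintegral_null ir).
have hi : \int[mu]_(w in circle) complex.Im ((w + z) / (w - z)) = complex.Im (sherg z).
  have -> : \int[mu]_(w in circle) complex.Im ((w + z) / (w - z)) =
      \int[mu]_(w in circle) complex.Im ((1 : R)%:C * ((w + z) / (w - z))).
    by apply: eq_Rintegral => w _; rewrite mul1r.
  exact: (Rintegral_null ii).
rewrite /singular_inner hr hi; congr (expC (- _)); by case: (sherg z).
Qed.

Lemma holo_sherg : holo sherg.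
Proof.
exact: (holo_herg mE (cmeas_idE mE) normc_onE normc_onE' (integrable_one mE) (fun _ _ => ler01)).
Qed.

Lemma Re_sherg_ge0 z : normc z < 1 -> 0 <= complex.Re (sherg z).
Proof. exact: (Re_herg_ge0 _ normc_onE (fun _ _ => ler01)). Qed.

Lemma normc_singular_inner z : normc z < 1 ->
  normc (singular_inner mu z) = expR (- complex.Re (sherg z)).
Proof.
by move=> z1; rewrite singular_innerE// normc_expC; case: (sherg z).
Qed.

Lemma normc_singular_inner_le1 z : normc z < 1 -> normc (singular_inner mu z) <= 1.
Proof.
by move=> z1; rewrite normc_singular_inner// -[leRHS]expR0 ler_expR oppr_le0 Re_sherg_ge0.
Qed.

Lemma cdiff_singular_inner z l : normc z < 1 -> cdiff sherg z l ->
  cdiff (singular_inner mu) z (singular_inner mu z * - l).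
Proof.
move=> z1 hl; rewrite singular_innerE//.
apply: cdiff_near (cdiff_comp (cdiffN hl) (cdiff_expC _)).
by apply: filterS (near_normc_lt z1) => w w1; rewrite singular_innerE.
Qed.

Lemma holo_singular_inner : holo (singular_inner mu).
Proof. by move=> z z1; have [l hl] := holo_sherg z1; eexists; exact: cdiff_singular_inner hl. Qed.

Lemma rint_Re_sherg r : 0 <= r < 1 ->
  rint (fun t => complex.Re (sherg (r%:C * expi t))) = 2 * pi * fine (mu E).
Proof.
move=> r01; rewrite /sherg.
rewrite (rint_Re_herg mE (cmeas_idE mE) normc_onE normc_onE' (integrable_one mE) (fun _ _ => ler01) r01).
by rewrite Rintegral_cst// mul1r.
Qed.

Lemma sherg_derive_le z (e : R) : normc z < 1 -> 0 < e ->
  (forall w, E w -> 2 * e <= normc (w - z)) ->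
  exists2 l, cdiff sherg z l & normc l <= 4 * fine (mu E) / e ^+ 2.
Proof.
move=> z1 e0 He.
exists (cint mu (E : set (borelC R)) (fun w : borelC R => 2 * ((1 : R)%:C * (w : R[i])) * ((w : R[i]) - z)^-1 ^+ 2)).
  exact: (cdiff_herg mE (cmeas_idE mE) normc_onE normc_onE' (integrable_one mE) (fun _ _ => ler01) z1).
have := herg_derive_le mE (cmeas_idE mE) normc_onE' (integrable_one mE) (fun _ _ => ler01) z1 e0 He.
by rewrite Rintegral_cst// mulr1 mul1r.
Qed.

End SingularInner.

Section Distance.
Context {R : realType}.
Variable E : set R[i].
Hypotheses (E_circle : E `<=` circle) (E0 : E !=set0).
Implicit Types (z w : R[i]).

(** A real infimum, which agrees with [dist] for nonempty [E] ([distE]); the empty set is treated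
    apart. *)
Definition rdist z := inf [set normc (z - w) | w in E].

Lemma rdist_has_inf z : has_inf [set normc (z - w) | w in E].
Proof.
split; first by case: E0 => w Ew; exists (normc (z - w)); exists w.
by exists 0 => _ [w _ <-]; exact: normc_ge0.
Qed.

Lemma rdist_le z w : E w -> rdist z <= normc (z - w).
Proof. by move=> Ew; apply: ge_inf; [case: (rdist_has_inf z)|exists w]. Qed.

Lemma rdist_ge z (x : R) : (forall w, E w -> x <= normc (z - w)) -> x <= rdist z.
Proof.
move=> Hx; apply: lb_le_inf; first by case: (rdist_has_inf z).
by move=> _ [w Ew <-]; exact: Hx.
Qed.

Lemma rdist_ge0 z : 0 <= rdist z.
Proof. by apply: rdist_ge => w _; exact: normc_ge0. Qed.

Lemma rdist_approx z (e : R) : 0 < e -> exists2 w, E w & normc (z - w) < rdist z + e.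
Proof.
move=> e0; have [_ [w Ew <-] H] := inf_adherent e0 (rdist_has_inf z).
by exists w.
Qed.

Lemma rdist_lip z w : rdist z <= rdist w + normc (z - w).
Proof.
rewrite -lerBlDr; apply: rdist_ge => x Ex.
by have := rdist_le z Ex; have := normc_triangle w z x; lra.
Qed.

Lemma rdist_lipN z w : `|rdist z - rdist w| <= normc (z - w).
Proof.
have := rdist_lip z w; have := rdist_lip w z; rewrite (normcBC w z).
by rewrite ler_norml; lra.
Qed.

Lemma rdist_disc z : 1 - normc z <= rdist z.
Proof.
apply: rdist_ge => w /E_circle/circleE w1.
by have := normc_lerB w z; rewrite w1 normcBC.
Qed.

Lemma rdist_le2 z : rdist z <= 1 + normc z.
Proof.
case: E0 => w Ew; apply: le_trans (rdist_le z Ew) _.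
by have := normcB z w; have /circleE -> := E_circle Ew; lra.
Qed.

Lemma distE z : dist z E = (rdist z)%:E.
Proof.
apply/eqP; rewrite eq_le; apply/andP; split.
  apply/lee_addgt0Pr => e e0; have [w Ew We] := rdist_approx z e0.
  rewrite -EFinD; apply: (@le_trans _ _ (normc (z - w))%:E); last by rewrite lee_fin ltW.
  by apply: ereal_inf_lbound; exists w.
by apply: le_ereal_inf_tmp => _ [w Ew <-]; rewrite lee_fin rdist_le.
Qed.

Lemma cont_rdist_expi (t : R) : cont_at (fun t => rdist (expi t)) t.
Proof.
split; apply/cvgrPdist_lt => e e0.
have [] := cont_near (@expi R) t => /(_ (cont_expi t)) /(_ _ e0) + _.
apply: filterS => s; apply: le_lt_trans; exact: rdist_lipN.
Qed.

End Distance.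

(** * Factors force the Carleson condition *)

Section AtomicMeasure.
Context {R : realType}.
Implicit Types (c : nat -> R[i]) (A : set (borelC R)) (z w : R[i]).

(* The masses telescope: those of index at least [n] add up to [(n + 1)^(-1/2)]. *)
Definition weight (n : nat) : R := (Num.sqrt n.+1%:R)^-1 - (Num.sqrt n.+2%:R)^-1.

Lemma weight_ge0 n : 0 <= weight n.
Proof. by rewrite subr_ge0 lef_pV2 ?posrE ?sqrtr_gt0// ler_wsqrtr// ler_nat. Qed.

Lemma sum_weight N : \sum_(n < N) weight n = 1 - (Num.sqrt N.+1%:R)^-1.
Proof.
rewrite -(big_mkord xpredT weight) (@telescope_sumr_eq _ 0 N (fun n => - (Num.sqrt n.+1%:R)^-1))//.
  by rewrite opprK sqrtr1 invr1 addrC.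
by move=> n _; rewrite /weight opprK addrC.
Qed.

Lemma weight_le1 n : weight n <= 1.
Proof.
have : 0 <= (Num.sqrt n.+2%:R)^-1 :> R by rewrite invr_ge0 sqrtr_ge0.
have : (Num.sqrt n.+1%:R)^-1 <= 1 :> R.
  by rewrite invf_le1 ?sqrtr_gt0// -[leLHS]sqrtr1 ler_wsqrtr// ler1n.
by rewrite /weight; move: (Num.sqrt n.+1%:R)^-1 (Num.sqrt n.+2%:R)^-1 => u v; lra.
Qed.

Definition atom c n : {measure set (borelC R) -> \bar R} :=
  mscale (NngNum (weight_ge0 n)) (dirac (c n : borelC R)).

Definition atomic c : set (borelC R) -> \bar R := mseries (atom c) 0.

Lemma atomE c n A : atom c n A = (weight n * \1_A (c n))%:E.
Proof. by rewrite /atom /= /mscale /= diracE indicE -EFinM. Qed.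

Lemma atomic_le c A (x : R) : (forall N, \sum_(n < N) weight n * \1_A (c n) <= x) ->
  (atomic c A <= x%:E)%E.
Proof.
move=> H; apply: lime_le; first exact: is_cvg_nneseries.
near=> N; rewrite big_mkord.
under eq_bigr do rewrite atomE.
by rewrite sumEFin lee_fin; exact: H.
Unshelve. all: by end_near. Qed.

Lemma atomic_setT c : (atomic c [set: borelC R] <= 1)%E.
Proof.
apply: atomic_le => N; under eq_bigr do rewrite indicE in_setT mulr1.
by rewrite sum_weight gerBl invr_ge0 sqrtr_ge0.
Qed.

Lemma atomic_null c A : (forall n, ~ A (c n)) -> atomic c A = 0%E.
Proof.
move=> nA; apply/eqP; rewrite eq_le measure_ge0 andbT; apply: atomic_le => N.
rewrite big1// => n _; rewrite indicE memNset ?mulr0//; exact: nA.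
Qed.

HB.instance Definition _ c := Measure.on (atomic c).

Lemma atomic_fin c : fin_num_fun (atomic c).
Proof.
move=> A mA; rewrite ge0_fin_numE ?measure_ge0//.
apply: (@le_lt_trans _ _ (atomic c setT)); first by apply: le_measure => //; rewrite inE.
exact: le_lt_trans (atomic_setT c) (ltry _).
Qed.

HB.instance Definition _ c := Measure_isFinite.Build _ _ _ (atomic c) (atomic_fin c).

Lemma atomic_sum_le c (D : set (borelC R)) (u : borelC R -> R) N : measurable D ->
  (forall n, D (c n)) -> (forall x, D x -> 0 <= u x) ->
  (atomic c).-integrable D (EFin \o u) ->
  \sum_(n < N) weight n * u (c n) <= \int[atomic c]_(x in D) u x.
Proof.
move=> mD cD u0 iu.
have mu : measurable_fun D (EFin \o u) by exact: measurable_int iu.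
have u0' x : D x -> (0 <= (EFin \o u) x)%E by move=> Dx; rewrite lee_fin u0.
rewrite -lee_fin fineK; last exact: integrable_fin_num.
rewrite [leRHS](_ : _ = \int[mseries (atom c) 0]_(x in D) (EFin \o u) x)%E//.
rewrite (ge0_integral_measure_series (atom c) mD u0' mu).
have E n : (\int[atom c n]_(x in D) (EFin \o u) x = (weight n * u (c n))%:E)%E.
  rewrite (ge0_integral_mscale (dirac (c n : borelC R)) mD (NngNum (weight_ge0 n)) mu u0') /=.
  by rewrite (integral_dirac (c n : borelC R) mD mu) diracE mem_set// mul1e -EFinM.
under eq_eseriesr do rewrite E.
rewrite -sumEFin -(big_mkord xpredT (fun n => (weight n * u (c n))%:E)).
by apply: nneseries_lim_ge => n _ _; rewrite lee_fin mulr_ge0 ?weight_ge0// u0.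
Qed.

(** The atoms form a countable set, and [expi] is injective on [0, 2 pi), so the angles involved are
    countable as well. *)
Lemma atomic_singular c : singular (atomic c).
Proof.
exists (range c : set (borelC R)); split.
- rewrite (_ : range c = \bigcup_n [set c n]).
    apply: bigcup_measurable => n _; apply: borel_compact; exact: compact_set1.
  by apply/seteqP; split=> [_ [n _ <-]|_ [n _ ->]]; exists n.
- rewrite /arc_length; apply: countable_lebesgue_measure0; apply/countable_injP.
  have [f Hf] : exists f : R -> nat, forall t, range c (expi t) -> c (f t) = expi t.
    suff /choice[f Hf] : forall t, exists n, range c (expi t) -> c n = expi t by exists f.
    move=> t.
    by have [[n _ cn]|nc] := pselect (range c (expi t)); [exists n|exists 0%N].
  exists f => s t /set_mem[s0 cs] /set_mem[t0 ct] fst.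
  by apply: expi_inj => //; rewrite -Hf// fst Hf.
- by apply: atomic_null => n; apply; exists n.
Qed.

End AtomicMeasure.

(** * The atomic inner function has modulus close to one in mean *)

Section AtomicMeans.
Context {R : realType}.
Implicit Types (r s t x y : R) (z w c : R[i]).

Definition poisson c r t := (1 - r ^+ 2) / normc (c - r%:C * expi t) ^+ 2.

Lemma poisson_kernelE c r t : normc c = 1 -> 0 <= r < 1 ->
  poisson c r t = complex.Re ((c + r%:C * expi t) / (c - r%:C * expi t)).
Proof.
move=> c1 /andP[r0 r1]; have n : normc (r%:C * expi t) = r by rewrite normc_circle ger0_norm.
rewrite Re_kernel ?c1 ?n ?expr1n// -normc_gt0.
by have := normc_lerB c (r%:C * expi t); rewrite c1 n; lra.
Qed.

Lemma holo_kernel c : normc c = 1 -> holo (fun z => (c + z) / (c - z)).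
Proof.
move=> c1 z z1; eexists; apply: (@cdiffM _ (fun w => c + w) (fun w => (c - w)^-1)).
  by apply: cdiffD; [exact: cdiff_cst|exact: cdiff_id].
apply: (@cdiff_comp _ (fun w => c - w)); last apply: cdiffV.
  by apply: cdiffB; [exact: cdiff_cst|exact: cdiff_id].
by rewrite -normc_gt0; have := normc_lerB c z; rewrite c1; lra.
Qed.

Lemma cont_poisson c r t : normc c = 1 -> 0 < r < 1 -> cont_at (poisson c r) t.
Proof.
move=> c1 r01; have r01' : 0 <= r < 1 by lra.
have -> : poisson c r = fun t => complex.Re ((c + r%:C * expi t) / (c - r%:C * expi t)).
  by apply/funext => u; exact: poisson_kernelE.
apply: cont_real; exact: holo_circle_cont (holo_kernel c1) r01 t.
Qed.

Lemma poisson_mean c r : normc c = 1 -> 0 <= r < 1 -> rint (poisson c r) = 2 * pi.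
Proof.
move=> c1 r01; have := circ_mean (holo_kernel c1) r01.
have c0 : c != 0 by rewrite -normc_gt0 c1.
rewrite addr0 subr0 divff// mulr1 => /(congr1 (@complex.Re R)) /= <-.
by apply: eq_rint => t; exact: poisson_kernelE.
Qed.

Lemma poisson_ge0 c r t : 0 <= r < 1 -> 0 <= poisson c r t.
Proof.
move=> /andP[r0 r1]; rewrite divr_ge0 ?sqr_ge0// subr_ge0 expr_le1//; exact: ltW.
Qed.

Lemma poisson_denom c r t : normc c = 1 ->
  normc (c - r%:C * expi t) ^+ 2 = 1 + r ^+ 2 - 2 * r * complex.Re (c * (expi t)^*).
Proof.
move=> c1; have := sqr_normc c; rewrite c1 expr1n => c2.
have e2 := cos2Dsin2 t; rewrite expi_cos_sin; move: e2; move: (cos t) (sin t) => u v e2.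
rewrite sqr_normc; case: c c1 c2 => a b c1 /= c2.
transitivity (a ^+ 2 + b ^+ 2 + r ^+ 2 * (u ^+ 2 + v ^+ 2) - 2 * r * (a * u + b * v)); first by ring.
by rewrite -c2 e2; ring.
Qed.

(* With [s = 2 r / (1 + r^2)], the function [P_s / (1 + P_s)] is a multiple of
   the Poisson kernel of radius [r], so that its mean is explicit. *)
Lemma poisson_quotient c r t : normc c = 1 -> 0 <= r < 1 ->
  let s := 2 * r / (1 + r ^+ 2) in
  poisson c s t / (1 + poisson c s t) = (1 - r ^+ 2) / (2 * (1 + r ^+ 2)) * poisson c r t.
Proof.
move=> c1 r01 s; have r2 : 0 < 1 + r ^+ 2 by rewrite ltr_pwDl// sqr_ge0.
have s01 : 0 <= s < 1.
  have /andP[r0 r1] := r01.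
  rewrite /s divr_ge0/=; [|lra|exact: ltW].
  rewrite ltr_pdivrMr// mul1r -subr_gt0 (_ : _ - _ = (1 - r) ^+ 2); last by ring.
  by rewrite exprn_gt0// subr_gt0.
have gt0 q : 0 <= q < 1 -> 0 < normc (c - q%:C * expi t) ^+ 2.
  move=> /andP[q0 q1]; rewrite exprn_gt0//.
  have := normc_lerB c (q%:C * expi t).
  by rewrite c1 normc_circle ger0_norm//; lra.
have := gt0 _ r01; have := gt0 _ s01; rewrite /poisson !poisson_denom//.
move: (complex.Re _) => x nr ns.
have ns' : 1 + s ^+ 2 - 2 * s * x + (1 - s ^+ 2) != 0.
  rewrite gt_eqF// ltr_wpDr// subr_ge0 expr_le1//; by case/andP: s01 => // _ /ltW.
have h1 : (1 - s ^+ 2) / (1 + s ^+ 2 - 2 * s * x) / (1 + (1 - s ^+ 2) / (1 + s ^+ 2 - 2 * s * x)) =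
    (1 - s ^+ 2) / (1 + s ^+ 2 - 2 * s * x + (1 - s ^+ 2)).
  have F (M K : R) : K != 0 -> K + M != 0 -> M / K / (1 + M / K) = M / (K + M).
    by move=> K0 KM; field; rewrite K0 KM.
  by apply: F; first exact: lt0r_neq0.
rewrite h1.
have h2 : 1 + s ^+ 2 - 2 * s * x + (1 - s ^+ 2) = 2 * (1 + r ^+ 2 - 2 * r * x) / (1 + r ^+ 2).
  by rewrite /s; field; rewrite gt_eqF.
rewrite h2 /s; field.
by rewrite (gt_eqF r2) (gt_eqF ns).
Qed.

(** With a_n = 1 - exp (- y n) in [0, 1], this is the inequality 1 - prod (1 - a_n) <= sum a_n. *)
Lemma one_sub_exp_sum (N : nat) (y q : nat -> R) : (forall n, 0 <= y n) ->
  (forall n, 1 - expR (- y n) <= q n) ->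
  1 - expR (- \sum_(n < N) y n) <= \sum_(n < N) q n.
Proof.
move=> y0 yq; elim: N => [|N IH]; first by rewrite !big_ord0 oppr0 expR0 subrr.
rewrite !big_ord_recr /= opprD expRD.
have a1 : expR (- \sum_(n < N) y n) <= 1.
  by rewrite -[leRHS]expR0 ler_expR oppr_le0; apply: sumr_ge0 => n _.
have b1 : expR (- y N) <= 1 by rewrite -[leRHS]expR0 ler_expR oppr_le0.
have : 0 <= (1 - expR (- \sum_(n < N) y n)) * (1 - expR (- y N)).
  by rewrite mulr_ge0// subr_ge0.
by have := yq N; lra.
Qed.

(** Both 1 and 2 x bound the left side. The quotient on the right stays bounded where the Poisson
    kernel is large, and [poisson_quotient] gives its mean. *)
Lemma one_sub_exp_quotient (x w : R) : 0 <= x -> 0 <= w <= 1 ->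
  1 - expR (- (2 * (w * x))) <= 4 * (x / (1 + x)).
Proof.
move=> x0 /andP[w0 w1]; have x1 : 0 < 1 + x by lra.
rewrite [leRHS]mulrA ler_pdivlMr//; have e0 := expR_gt0 (- (2 * (w * x))).
have := expR_ge1Dx (- (2 * (w * x))).
have wx : w * x <= x by rewrite ler_piMl.
move: (expR _) e0 => e e0 h; have [x2|x2] := leP x 1.
  have : (1 - e) * (1 + x) <= 2 * x * (1 + x) by rewrite ler_wpM2r//; lra.
  have : x * x <= x by rewrite ler_piMl.
  lra.
have : 0 <= e * (1 + x) by rewrite mulr_ge0// ltW.
lra.
Qed.

Lemma rcont_sum (N : nat) (u : nat -> R -> R) t : (forall n, cont_at (u n) t) ->
  cont_at (fun t => \sum_(n < N) u n t) t.
Proof.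
move=> uc; elim: N => [|N IH]; first by under eq_fun do rewrite big_ord0; exact: rcont_cst.
by under eq_fun do rewrite big_ord_recr /=; exact: rcontD.
Qed.

Lemma rint_sum (N : nat) (u : nat -> R -> R) : (forall n t, cont_at (u n) t) ->
  rint (fun t => \sum_(n < N) u n t) = \sum_(n < N) rint (u n).
Proof.
move=> uc; elim: N => [|N IH].
  rewrite big_ord0 (eq_rint (v := fun=> 0)) ?rint_cst ?mulr0// => t.
  by rewrite big_ord0.
rewrite big_ord_recr /= -IH -rintD//; last by move=> t; exact: rcont_sum.
by apply: eq_rint => t; rewrite big_ord_recr.
Qed.

Variables (E : set R[i]) (c : nat -> R[i]).
Hypotheses (E_compact : compact E) (E_circle : E `<=` circle) (cE : forall n, E (c n)).
Local Notation S := (singular_inner (atomic c)).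
Local Notation H := (sherg (atomic c) E).

Let c1 n : normc (c n) = 1. Proof. exact/circleE/E_circle/cE. Qed.

Lemma atomic_supported : atomic c (~` E) = 0%E.
Proof. by apply: atomic_null => n; apply; exact: cE. Qed.

Lemma atomic_poisson_le N r t : 0 <= r < 1 ->
  \sum_(n < N) weight n * poisson (c n) r t <= complex.Re (H (r%:C * expi t)).
Proof.
move=> r01; have /andP[r0 r1] := r01.
have n : normc (r%:C * expi t : R[i]) = r by rewrite normc_circle ger0_norm.
have z1 : normc (r%:C * expi t : R[i]) < 1 by rewrite n.
have mE := borel_compact E_compact.
have := poisson_integrable mE (cmeas_idE mE) (normc_onE E_circle) (normc_onE' E_circle)
  (integrable_one (atomic c) mE) (fun _ _ => ler01) z1.
rewrite /sherg (Re_herg _ _ (normc_onE E_circle) z1).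
set u := (fun x : borelC R => _ * _) => iu.
have u0 (x : borelC R) : E x -> 0 <= u x.
  move=> Ex; rewrite /u mul1r.
  exact: (poisson_kernel_ge0 (normc_onE E_circle)).
apply: le_trans (atomic_sum_le N mE cE u0 iu).
by apply: ler_sum => k _; rewrite /u mul1r c1 n expr1n.
Qed.

(** The first N atoms are handled one by one through [poisson_quotient]. The others enter linearly,
    through a Poisson integral whose mean is at most 2 pi / sqrt (N + 1), that is 2 pi times the
    remaining mass. *)
Lemma atomic_mean_small e r0 : 0 < e -> 0 < r0 < 1 ->
  exists2 r, r0 < r < 1 & rint (fun t => 1 - normc (S (r%:C * expi t)) ^+ 2) <= e.
Proof.
move=> e0 r01; have p0 := @pi_gt0 R.
have [N HN] : exists N : nat, 4 * pi / Num.sqrt N.+1%:R <= e / 2.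
  pose k := (8 * pi / e) ^+ 2.
  exists (Num.bound k).
  have kB : k < (Num.bound k).+1%:R.
    apply: (@lt_trans _ _ (Num.bound k)%:R); last by rewrite ltr_nat.
    by apply: archi_boundP; exact: sqr_ge0.
  have : 8 * pi / e <= Num.sqrt (Num.bound k).+1%:R.
    have -> : 8 * pi / e = Num.sqrt k.
      by rewrite /k sqrtr_sqr ger0_norm// divr_ge0 ?mulr_ge0//; lra.
    by rewrite ler_wsqrtr// ltW.
  have s0 : 0 < Num.sqrt (Num.bound k).+1%:R :> R by rewrite sqrtr_gt0.
  rewrite ler_pdivrMr// ler_pdivrMr//; move: s0; move: (Num.sqrt _) => s s0 h; lra.
have N0 : 0 < 16 * pi * N.+1%:R :> R by rewrite !mulr_gt0.
(* An auxiliary radius: the witness is s = 2 r / (1 + r^2) >= r, dictated by [poisson_quotient]. The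
   second entry makes 8 pi (1 - r) N at most e / 2. *)
pose r := Num.max ((1 + r0) / 2) (1 - e / (16 * pi * N.+1%:R)).
have rr0 : r0 < r by rewrite lt_max; apply/orP; left; lra.
have r1 : r < 1.
  rewrite gt_max; apply/andP; split; first by lra.
  by rewrite gtrBl divr_gt0.
have r02 : 0 <= r < 1 by lra.
have r2 : 0 < 1 + r ^+ 2 by rewrite ltr_pwDl// sqr_ge0.
pose s := 2 * r / (1 + r ^+ 2).
have s1 : s < 1.
  rewrite ltr_pdivrMr// mul1r -subr_gt0 (_ : _ - _ = (1 - r) ^+ 2); last by ring.
  by rewrite exprn_gt0// subr_gt0.
have rs : r <= s.
  rewrite ler_pdivlMr//; have : r ^+ 2 <= 1 by rewrite expr_le1//; lra.
  have : 0 <= r by lra.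
  move: (r ^+ 2) => k ? ?; have : r * k <= r by rewrite ler_piMr.
  lra.
have s01 : 0 < s < 1 by lra.
have s01' : 0 <= s < 1 by lra.
exists s; first by lra.
pose Q n t := 4 * (poisson (c n) s t / (1 + poisson (c n) s t)).
pose u t := complex.Re (H (s%:C * expi t)) - \sum_(n < N) weight n * poisson (c n) s t.
have u0 t : 0 <= u t by rewrite subr_ge0 atomic_poisson_le.
have Hc t : cont_at (fun t => complex.Re (H (s%:C * expi t))) t.
  by apply: cont_real; apply: holo_circle_cont => //; exact: holo_sherg.
have Sh := holo_singular_inner E_compact E_circle atomic_supported.
have wc n t : cont_at (fun t => weight n * poisson (c n) s t) t.
  by apply: rcontM; [exact: rcont_cst|exact: cont_poisson].
have wp0 n t : 0 <= 2 * (weight n * poisson (c n) s t).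
  by apply: mulr_ge0 => //; apply: mulr_ge0; [exact: weight_ge0|exact: poisson_ge0].
have uc t : cont_at u t by apply: rcontB (Hc t) (rcont_sum N (u := fun n t => weight n * poisson (c n) s t) (wc^~ t)).
have QE n t : Q n t = 4 * ((1 - r ^+ 2) / (2 * (1 + r ^+ 2)) * poisson (c n) r t).
  by rewrite /Q poisson_quotient.
have r01' : 0 < r < 1 by lra.
have Qc n t : cont_at (Q n) t.
  rewrite (_ : Q n = fun t => 4 * ((1 - r ^+ 2) / (2 * (1 + r ^+ 2)) * poisson (c n) r t)); last first.
    by apply/funext => y; exact: QE.
  by apply: rcontM; [exact: rcont_cst|apply: rcontM; [exact: rcont_cst|exact: cont_poisson]].
apply: (@le_trans _ _ (rint (fun t => 2 * u t + \sum_(n < N) Q n t))).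
  apply: le_rint => t.
  - by apply: rcontB; [exact: rcont_cst|apply: cont_sqr_normc; exact: holo_circle_cont].
  - by apply: rcontD; [apply: rcontM; [exact: rcont_cst|exact: uc]|exact: rcont_sum].
  rewrite (normc_singular_inner E_compact E_circle atomic_supported); last first.
    by rewrite normc_circle ger0_norm//; lra.
  rewrite -expRM_natr.
  have -> : - complex.Re (H (s%:C * expi t)) * 2 =
      - (2 * u t) + - \sum_(n < N) 2 * (weight n * poisson (c n) s t).
    by rewrite -mulr_sumr /u; ring.
  have A : 1 - expR (- \sum_(n < N) 2 * (weight n * poisson (c n) s t)) <= \sum_(n < N) Q n t.
    apply: (one_sub_exp_sum N (y := fun n => 2 * (weight n * poisson (c n) s t)) (q := Q^~ t)) => n.
      exact: wp0.
    apply: one_sub_exp_quotient; first exact: poisson_ge0.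
    by rewrite weight_ge0 weight_le1.
  rewrite expRD; set X := expR (- \sum_(n < N) _) in A *.
  have X1 : X <= 1.
    rewrite -[leRHS]expR0 ler_expR oppr_le0; apply: sumr_ge0 => n _.
    exact: wp0.
  have := expR_ge1Dx (- (2 * u t)); have := expR_gt0 (- (2 * u t)).
  have X0 : 0 <= X by exact: expR_ge0.
  move: (expR _) => Y Y0 Y1; have : (1 - 2 * u t) * X <= Y * X by rewrite ler_wpM2r//; lra.
  have : u t * X <= u t by rewrite ler_piMr.
  lra.
rewrite rintD; [|by move=> t; apply: rcontM; [exact: rcont_cst|exact: uc]|by move=> t; exact: rcont_sum].
rewrite rintZ// rintB//; last by move=> t; exact: (rcont_sum N (u := fun n t => weight n * poisson (c n) s t) (wc^~ t)).
rewrite rint_Re_sherg// (rint_sum N (u := fun n t => weight n * poisson (c n) s t))// rint_sum//.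
have -> : \sum_(n < N) rint (fun t => weight n * poisson (c n) s t) =
    2 * pi * (1 - (Num.sqrt N.+1%:R)^-1).
  rewrite -sum_weight mulr_sumr; apply: eq_bigr => n _.
  rewrite rintZ ?poisson_mean//; first by rewrite mulrC.
  by move=> t; exact: cont_poisson.
have QB : \sum_(n < N) rint (Q n) <= 8 * pi * (1 - r) * N%:R.
  apply: (@le_trans _ _ (\sum_(n < N) 8 * pi * (1 - r))); last first.
    by rewrite sumr_const card_ord mulr_natr.
  apply: ler_sum => n _; rewrite (eq_rint (QE n)) rintZ; last first.
    by move=> t; apply: rcontM; [exact: rcont_cst|exact: cont_poisson].
  rewrite rintZ ?poisson_mean//; last by move=> t; exact: cont_poisson.
  have : (1 - r ^+ 2) / (2 * (1 + r ^+ 2)) <= 1 - r.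
    rewrite ler_pdivrMr ?mulr_gt0//.
    have -> : 1 - r ^+ 2 = (1 - r) * (1 + r) by ring.
    rewrite ler_wpM2l//; first by lra.
    by have := sqr_ge0 r; lra.
  move=> h; have : (1 - r ^+ 2) / (2 * (1 + r ^+ 2)) * pi <= (1 - r) * pi by rewrite ler_pM2r.
  lra.
have mE1 : fine (atomic c E) <= 1.
  rewrite -lee_fin fineK; last by apply: atomic_fin; exact: borel_compact.
  apply: le_trans (atomic_setT c); apply: le_measure; rewrite ?inE//.
  exact: borel_compact.
have NB : 8 * pi * (1 - r) * N%:R <= e / 2.
  have : 1 - r <= e / (16 * pi * N.+1%:R).
    by rewrite lerBlDl -lerBlDr le_max lexx orbT.
  rewrite ler_pdivlMr// -natr1 => h.
  have : 0 <= (1 - r) * pi by rewrite mulr_ge0; lra.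
  lra.
have : pi * fine (atomic c E) <= pi * 1 by rewrite ler_pM2l.
move: HN; move: (Num.sqrt N.+1%:R)^-1 => q HN; lra.
Qed.

End AtomicMeans.

(** * Points exp(i log n) and the lower bound for the defect of the atomic inner function *)

Section LogNet.
Context {R : realType}.
Implicit Types (r s t x y D : R) (z w : R[i]).

(** In [log_net] the number exp (t + 2 pi m) exceeds 4 / D by a factor of at most exp (4 pi): one
    turn for rounding up to whole turns, one for [t] itself. *)
Definition net_constant : R := 4 * expR (4 * pi).

(* The angles [ln n], [x <= n <= expR (2 * pi) * x], go once around the circle
   with steps at most [1 / x]. *)
Lemma log_net t D : 0 <= t <= 2 * pi -> 0 < D <= 2 -> exists n : nat,
  [/\ n.+1%:R * D <= net_constant, 2 <= n.+1%:R * D &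
      normc (expi (ln n.+1%:R) - expi t) <= D].
Proof.
move=> /andP[t0 t1] /andP[D0 D1]; have p0 := @pi2_gt0 R.
pose L := ln (4 / D); have D4 : 0 < 4 / D by rewrite divr_gt0.
have L0 : 0 <= L by apply: ln_ge0; rewrite ler_pdivlMr//; lra.
(* The least number of whole turns with 2 pi m > ln (4 / D). Then [y] is at least 4 / D, and the
   index is its integer part minus one. *)
pose m := (Num.truncn (L / (2 * pi))).+1.
have Lp : 0 <= L / (2 * pi) by rewrite divr_ge0// ltW.
have /andP[m1 m2] := truncn_itv Lp.
have {}m1 : 2 * pi * m%:R <= L + 2 * pi.
  have -> : m%:R = (Num.truncn (L / (2 * pi)))%:R + 1 :> R by rewrite natr1.
  rewrite mulrDr mulr1 lerD2r mulrC -ler_pdivlMr//.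
have {}m2 : L < 2 * pi * m%:R by rewrite mulrC -ltr_pdivrMr.
pose y := expR (t + 2 * pi * m%:R).
have y1 : 4 / D <= y.
  by rewrite -[leLHS]lnK ?posrE// ler_expR -/L; lra.
have y2 : y <= 4 / D * expR (4 * pi).
  by rewrite -[4 / D]lnK ?posrE// -expRD ler_expR -/L; lra.
have y3 : 2 <= y by apply: le_trans y1; rewrite ler_pdivlMr//; lra.
have y0 : 0 <= y by lra.
have /andP[k1 k2] := truncn_itv y0.
have k0 : (0 < Num.truncn y)%N by rewrite -(ltr_nat R); move: k2; rewrite -natr1; lra.
exists (Num.truncn y).-1; rewrite prednK//.
move: k1 k2 k0; rewrite -natr1; set k := Num.truncn y => k1 k2 k0.
have kp : 0 < k%:R :> R by rewrite ltr0n.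
have yD : 4 <= y * D by rewrite -ler_pdivrMr.
have kD : 2 <= k%:R * D.
  have : (y - 1) * D <= k%:R * D by rewrite ler_pM2r//; lra.
  lra.
split=> //.
  apply: (@le_trans _ _ (y * D)); first by rewrite ler_pM2r.
  by rewrite /net_constant -ler_pdivlMr// mulrAC.
have -> : expi t = expi (ln y).
  by rewrite /y expRK expiD (mulrC _ m%:R) expi_nat expi2pi expr1n mulr1.
apply: le_trans (normc_expiB _ _) _; rewrite distrC ger0_norm; last first.
  by rewrite subr_ge0 ler_ln ?posrE//; lra.
rewrite -ln_div ?posrE//; last by lra.
have : ln (y / k%:R) <= y / k%:R - 1.
  have := @le_ln1Dx R (y / k%:R - 1); rewrite addrCA subrr addr0; apply.
  by rewrite ltrBrDr addNr divr_gt0//; lra.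
have : y / k%:R - 1 <= D / 2.
  rewrite lerBlDr ler_pdivrMr//; lra.
lra.
Qed.

(** For a = sqrt (n + 1) and b = sqrt (n + 2), b^2 - a^2 = 1 gives 1/a - 1/b = 1 / (a b (a + b));
    both are at most sqrt (2 x), as n + 2 <= 2 (n + 1). *)
Lemma weight_ge (n : nat) x : n.+1%:R <= x -> (4 * (2 * x) * Num.sqrt (2 * x))^-1 <= weight n.
Proof.
move=> nx; have n1 : 1 <= n.+1%:R :> R by rewrite ler1n.
have n2 : n.+2%:R = n.+1%:R + 1 :> R by rewrite natr1.
rewrite /weight; set a := Num.sqrt n.+1%:R; set b := Num.sqrt n.+2%:R; set c := Num.sqrt (2 * x).
have a0 : 0 < a by rewrite sqrtr_gt0; lra.
have b0 : 0 < b by rewrite sqrtr_gt0; lra.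
have c0 : 0 < c by rewrite sqrtr_gt0; lra.
have ab : a <= b by rewrite ler_wsqrtr//; lra.
have bc : b <= c by rewrite ler_wsqrtr//; lra.
have a2 : a ^+ 2 = n.+1%:R by rewrite sqr_sqrtr//; lra.
have b2 : b ^+ 2 = n.+2%:R by rewrite sqr_sqrtr//; lra.
have c2 : c ^+ 2 = 2 * x by rewrite sqr_sqrtr//; lra.
have -> : a^-1 - b^-1 = (a * b * (a + b))^-1.
  have e1 : b ^+ 2 - a ^+ 2 = 1 by rewrite a2 b2 n2; lra.
  rewrite -[RHS]mul1r -e1; field; rewrite !gt_eqF//=; lra.
rewrite -c2 lef_pV2 ?posrE; last 2 first.
- by rewrite !mulr_gt0// exprn_gt0.
- by rewrite !mulr_gt0// addr_gt0.
apply: (@le_trans _ _ (c * c * (c + c))); last first.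
  have : 0 <= c * c * c by rewrite !mulr_ge0// ltW.
  by rewrite expr2; lra.
by rewrite !ler_pM ?lerD ?mulr_ge0 ?addr_ge0//; lra.
Qed.

End LogNet.

Section Defect.
Context {R : realType}.
Implicit Types (r s t x y D : R) (z w : R[i]).

Lemma one_sub_exp_ge (y : R) : 0 <= y <= 1 -> y / 2 <= 1 - expR (- y).
Proof.
move=> /andP[y0 y1]; have e0 := expR_gt0 (- y); have := expR_ge1Dx y.
have : expR (- y) * expR y = 1 by rewrite expRN mulVf// gt_eqF// expR_gt0.
move: (expR (- y)) (expR y) e0 => a b a0 ab b1.
have h : a * (1 + y) <= 1 by rewrite -[leRHS]ab ler_wpM2l// ltW.
have y1' : 0 < 1 + y by lra.
have : a * (1 + y) <= (1 - y / 2) * (1 + y).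
  apply: le_trans h _; have : y * y <= y by rewrite ler_piMl.
  lra.
rewrite ler_pM2r//; lra.
Qed.

Variables (E : set R[i]) (c : nat -> R[i]).
Hypotheses (E_compact : compact E) (E_circle : E `<=` circle) (E0 : E !=set0)
  (cE : forall n, E (c n)) (c_near : forall n : nat,
    normc (expi (ln n.+1%:R) - c n) < rdist E (expi (ln n.+1%:R)) + n.+1%:R^-1).
Local Notation S := (singular_inner (atomic c)).

(** With K = [net_constant], the weight at scale D is at least D^(3/2) / (8 K sqrt (2 K)) and the
    Poisson kernel at distance 5 D at least (1 - r) / (25 D^2); 200 is 8 times 25. *)
Definition defect_constant : R :=
  (200 * net_constant * Num.sqrt (2 * net_constant))^-1.

Lemma net_constant_ge1 : 1 <= net_constant :> R.
Proof.
have : 1 <= expR (4 * pi) :> R.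
  by rewrite -[leLHS]expR0 ler_expR; have := @pi_gt0 R; lra.
rewrite /net_constant; lra.
Qed.

Lemma defect_constant_bounds : 0 < defect_constant <= 200^-1.
Proof.
rewrite /defect_constant; move: net_constant net_constant_ge1 => K K1.
have K0 : 0 < K by lra.
have s1 : 1 <= Num.sqrt (2 * K) by rewrite -[leLHS]sqrtr1 ler_wsqrtr//; lra.
have s0 : 0 < Num.sqrt (2 * K) by lra.
have h : 200 <= 200 * K * Num.sqrt (2 * K).
  rewrite -mulrA ler_peMr//; apply: le_trans K1 _; rewrite ler_peMr//; exact: ltW.
have p2 : 0 < 200 :> R by lra.
have p := mulr_gt0 (mulr_gt0 p2 K0) s0.
by rewrite invr_gt0 p /= lef_pV2.
Qed.

(** A single atom suffices, the one whose index [log_net] adapts to the scale D; the remaining atoms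
    can only increase the real part of the Herglotz integral. *)
Lemma singular_defect_ge r t D : 0 < r < 1 -> 0 <= t <= 2 * pi ->
  rdist E (expi t) <= D -> 1 - r <= D -> D <= 2 ->
  defect_constant * (1 - r) / Num.sqrt D <= 1 - normc (S (r%:C * expi t)) ^+ 2.
Proof.
move=> r01 t01 dD rD D2; have D0 : 0 < D by lra.
have D02 : 0 < D <= 2 by rewrite D0.
have [n [n1 n2 n3]] := log_net t01 D02.
have r01' : 0 <= r < 1 by lra.
have nz : normc (r%:C * expi t : R[i]) = r by rewrite normc_circle ger0_norm//; lra.
have K1 := net_constant_ge1.
set K := net_constant in n1 K1 *.
have np : 0 < n.+1%:R :> R by rewrite ltr0n.
have c1 : normc (c n) = 1 by exact/circleE/E_circle/cE.
(* From r e^(it) to e^(it), then to exp (i ln (n + 1)), costs at most D each; from there to [c n] it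
   is at most 2 D, the distance to E, plus 1 / (n + 1) <= D / 2. *)
have far : normc (c n - r%:C * expi t) <= 5 * D.
  have := normc_triangle (expi (ln n.+1%:R)) (c n) (r%:C * expi t).
  have := normc_triangle (expi t) (expi (ln n.+1%:R)) (r%:C * expi t).
  have := c_near n; rewrite normcBC.
  have := rdist_lip E0 (expi (ln n.+1%:R)) (expi t).
  have : normc (expi t - r%:C * expi t) = 1 - r.
    rewrite -{1}[expi t]mul1r -mulrBl normcM normc_expi mulr1.
    by rewrite -(rmorph1 (real_complex R)) -rmorphB normc_real ger0_norm//; lra.
  have : n.+1%:R^-1 <= D / 2 by rewrite -[leLHS]mul1r ler_pdivrMr//; lra.
  move: (n.+1%:R^-1) => i; lra.
have near : 0 < normc (c n - r%:C * expi t).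
  by have := normc_lerB (c n) (r%:C * expi t); rewrite c1 nz; lra.
have P : (1 - r) / (5 * D) ^+ 2 <= poisson (c n) r t.
  rewrite /poisson; apply: ler_pM => //.
  - by rewrite subr_ge0; lra.
  - by rewrite invr_ge0 sqr_ge0.
  - rewrite lerD2l lerN2 expr2 ler_piMl//; lra.
  rewrite lef_pV2 ?posrE ?exprn_gt0//; last by rewrite mulr_gt0.
  by rewrite lerXn2r ?nnegrE// ltW// mulr_gt0.
pose x := K / D.
have nx : n.+1%:R <= x by rewrite ler_pdivlMr.
have W := weight_ge nx.
have H : defect_constant * (1 - r) / Num.sqrt D <=
    complex.Re (sherg (atomic c) E (r%:C * expi t)).
  apply: le_trans (atomic_poisson_le E_compact E_circle cE n.+1 t r01').
  rewrite big_ord_recr /=; apply: (@le_trans _ _ (weight n * poisson (c n) r t)); last first.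
    rewrite lerDr; apply: sumr_ge0 => k _.
    by apply: mulr_ge0; [exact: weight_ge0|exact: poisson_ge0].
  have -> : defect_constant * (1 - r) / Num.sqrt D =
      (4 * (2 * x) * Num.sqrt (2 * x))^-1 * ((1 - r) / (5 * D) ^+ 2).
    have qD := sqr_sqrtr (ltW D0); have q0 : 0 < Num.sqrt D by rewrite sqrtr_gt0.
    have K0 : 0 < K by lra.
    have -> : Num.sqrt (2 * x) = Num.sqrt (2 * K) / Num.sqrt D.
      by rewrite /x mulrA sqrtrM ?sqrtrV ?mulr_ge0//; lra.
    have k0 : 0 < Num.sqrt (2 * K) by rewrite sqrtr_gt0; lra.
    rewrite /x /defect_constant -/K.
    move: (Num.sqrt D) (Num.sqrt (2 * K)) q0 k0 qD => q k q0 k0 qD.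
    by rewrite -qD; field; rewrite !gt_eqF.
  apply: ler_pM => //.
    rewrite invr_ge0 !mulr_ge0 ?sqrtr_ge0//; rewrite ?invr_ge0; lra.
  by rewrite divr_ge0 ?sqr_ge0//; lra.
have atE := atomic_supported cE.
rewrite (normc_singular_inner E_compact E_circle atE); last by rewrite nz; lra.
rewrite -expRM_natr.
have /andP[d0 d1] := defect_constant_bounds.
have q0 : 0 < Num.sqrt D by rewrite sqrtr_gt0.
set y := defect_constant * (1 - r) / Num.sqrt D in H *.
have y0 : 0 <= y by rewrite /y divr_ge0 ?sqrtr_ge0// mulr_ge0 ?ltW//; lra.
(* It places 2 y in the range where 1 - exp (- 2 y) >= y. *)
have y1 : y <= 100^-1.
  rewrite /y ler_pdivrMr//.
  have : defect_constant * (1 - r) <= 200^-1 * (1 - r) by rewrite ler_wpM2r//; lra.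
  have qD := sqr_sqrtr (ltW D0).
  have q2 : Num.sqrt D <= 2.
    rewrite -(@ler_pXn2r _ 2)// ?nnegrE ?ltW// qD; lra.
  have : Num.sqrt D * Num.sqrt D <= 2 * Num.sqrt D by rewrite ler_pM2r.
  rewrite -expr2 qD; lra.
have y2 : 0 <= 2 * y <= 1 by lra.
have h := one_sub_exp_ge y2.
have : expR (- complex.Re (sherg (atomic c) E (r%:C * expi t)) * 2) <= expR (- (2 * y)).
  by rewrite ler_expR; lra.
lra.
Qed.

End Defect.

Section FactorBound.
Context {R : realType}.
Implicit Types (r s t x y D : R) (z w : R[i]) (h : R[i] -> R[i]).

Lemma hardy2_bounded h : hardy2 h ->
  exists M : R, forall r, 0 < r < 1 -> sqmean h r <= M.
Proof.
move=> [/analytic_holo hh]; set s := ereal_sup _ => soo.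
have E r : 0 < r < 1 -> hardy_mean h r = ((2 * pi)^-1 * sqmean h r)%:E.
  move=> r01; rewrite /hardy_mean EFinM; congr (_ * _)%E.
  rewrite /sqmean /rint /Rintegral fineK//; apply: integrable_fin_num => //.
  apply: rint_integrable => t; apply: cont_sqr_normc; exact: holo_circle_cont.
have le_s r : 0 < r < 1 -> (((2 * pi)^-1 * sqmean h r)%:E <= s)%E.
  by move=> r01; rewrite -E//; apply: ereal_sup_ubound; exists r => //=; lra.
(* The radius 1/2 excludes the value -oo for the supremum. *)
have h2 : 0 < (2^-1 : R) < 1 by lra.
move: s le_s soo => [M||] // H; last by move: (H _ h2); rewrite leeNy_eq.
move=> _; exists (2 * pi * M) => r r01.
by have := H _ r01; rewrite lee_fin ler_pdivrMl// pi2_gt0.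
Qed.

Lemma le_rint_itv (u v : R -> R) : (forall t, cont_at u t) -> (forall t, cont_at v t) ->
  (forall t, 0 <= t <= 2 * pi -> u t <= v t) -> rint u <= rint v.
Proof.
move=> uc vc uv; apply: le_Rintegral; try exact: rint_integrable.
- exact: measurable_itv.
- by move=> t /=; rewrite in_itv; exact: uv.
Qed.

Lemma max_lip (a b e : R) : `|Num.max a e - Num.max b e| <= `|a - b|.
Proof.
by rewrite ler_norml; have := ler_norm (a - b); have := ler_norm (b - a);
  rewrite distrC; case: (leP a e); case: (leP b e); lra.
Qed.

Lemma cont_max (u : R -> R) (e : R) t : cont_at u t -> cont_at (fun t => Num.max (u t) e) t.
Proof.
move=> [uc]; split; apply/cvgrPdist_lt => d d0.
move/cvgrPdist_lt : uc => /(_ _ d0); apply: filterS => s.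
by apply: le_lt_trans; exact: max_lip.
Qed.

Lemma cont_max_sqrt (u : R -> R) (e : R) t : 0 < e -> cont_at u t ->
  cont_at (fun t => (Num.sqrt (Num.max (u t) e))^-1) t.
Proof.
move=> e0 uc; have mc := cont_max e uc.
have [sc] : cont_at (fun t => Num.sqrt (Num.max (u t) e)) t.
  by apply: (cont_comp mc (g := Num.sqrt)); split; exact: sqrt_continuous.
by split; apply: cvgV => //; rewrite gt_eqF// sqrtr_gt0 lt_max e0 orbT.
Qed.

Variables (E : set R[i]) (c : nat -> R[i]).
Hypotheses (E_compact : compact E) (E_circle : E `<=` circle) (E0 : E !=set0)
  (cE : forall n, E (c n)) (c_near : forall n : nat,
    normc (expi (ln n.+1%:R) - c n) < rdist E (expi (ln n.+1%:R)) + n.+1%:R^-1).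

(** [singular_defect_ge] is used with D = max (rdist, e). As 1 - r <= e, this D is admissible at
    every angle; the factor 1 - r cancels, and the bound depends neither on [e] nor on [r]. *)
Lemma factor_mean_bound : is_factor (singular_inner (atomic c)) ->
  exists h, exists C : R, [/\ holo h, exists2 z, normc z < 1 & h z != 0 &
    forall e r, 0 < e <= 2 -> 0 < r < 1 -> 1 - r <= e ->
    rint (fun t => (Num.sqrt (Num.max (rdist E (expi t)) e))^-1 *
      normc (h (r%:C * expi t)) ^+ 2) <= C].
Proof.
move=> [f [fD [z0 /discE z1 fz0] [h hh fSh]]].
have hol : holo h by apply/analytic_holo; case: hh.
have folo : holo f by apply/analytic_holo; case: fD.
have [A HA] := dirichlet_tcoef fD; have [M HM] := hardy2_bounded hh.
have atE := atomic_supported cE.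
have fSh' z : normc z < 1 -> f z = singular_inner (atomic c) z * h z by move=> /discE; exact: fSh.
have So := holo_singular_inner E_compact E_circle atE.
have B := product_mean_bound folo hol fSh' (normc_singular_inner_le1 E_compact E_circle atE)
  (fun r t r01 => holo_circle_cont So r01 t) HA HM (atomic_mean_small E_compact E_circle cE).
have /andP[d0 _] := @defect_constant_bounds R.
exists h, (4 * pi * A / defect_constant); split=> //.
  by exists z0 => //; apply: contraNneq fz0 => hz; rewrite fSh' ?hz ?mulr0.
move=> e r /andP[e0 e2] r01 re; rewrite ler_pdivlMr// mulrC.
have r1 : 0 < 1 - r by lra.
have nc t : cont_at (fun t => normc (h (r%:C * expi t)) ^+ 2) t.
  by apply: cont_sqr_normc; exact: holo_circle_cont.
have mc t : cont_at (fun t => (Num.sqrt (Num.max (rdist E (expi t)) e))^-1) t.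
  by apply: cont_max_sqrt => //; exact: cont_rdist_expi.
have pc t : cont_at (fun t => (Num.sqrt (Num.max (rdist E (expi t)) e))^-1 *
    normc (h (r%:C * expi t)) ^+ 2) t by exact: rcontM.
rewrite -(ler_pM2r r1); apply: le_trans (B r r01).
rewrite mulrAC -rintZ//; apply: le_rint_itv.
- by move=> t; apply: rcontM => //; exact: rcont_cst.
- move=> t; apply: rcontM => //; apply: rcontB; first exact: rcont_cst.
  by apply: cont_sqr_normc; exact: holo_circle_cont.
move=> t t01; rewrite mulrA ler_wpM2r ?sqr_ge0//.
apply: (singular_defect_ge E_compact E_circle E0 cE c_near) => //.
- by rewrite le_max lexx.
- by rewrite le_max re orbT.
- by rewrite ge_max e2 andbT; have := rdist_le2 E_circle E0 (expi t); rewrite normc_expi.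
Qed.

End FactorBound.

(** * The truncated logarithm of the distance and its Poisson integral *)

Section LogDistance.
Context {R : realType}.
Implicit Types (r s t x y e : R) (z w : R[i]) (h : R[i] -> R[i]).

Lemma ln_lip e x y : 0 < e -> e <= x -> e <= y -> `|ln x - ln y| <= `|x - y| / e.
Proof.
wlog yx : x y / y <= x => [W e0 ex ey|e0 ex ey].
  by have [/W|/ltW /W] := leP y x; [exact|rewrite (distrC y) (distrC (ln y)); exact].
have y0 : 0 < y by lra.
have x0 : 0 < x by lra.
rewrite !ger0_norm ?subr_ge0 ?ler_ln ?posrE//.
rewrite -ln_div ?posrE//.
have -> : x / y = 1 + (x - y) / y by field; rewrite gt_eqF.
apply: (@le_trans _ _ ((x - y) / y)).
  by apply: le_ln1Dx; rewrite (lt_le_trans (ltrN10 _))// divr_ge0// ?subr_ge0// ltW.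
by rewrite ler_wpM2l ?subr_ge0// lef_pV2 ?posrE.
Qed.

Variable E : set R[i].
Hypotheses (E_circle : E `<=` circle) (E0 : E !=set0).

(** Truncation at [e] makes this logarithm bounded and Lipschitz, the 2 makes it nonnegative for [e]
    <= 2, and it increases as [e] decreases, ready for monotone convergence. *)
Definition logdist e t : R := ln 2 - ln (Num.max (rdist E (expi t)) e).

Lemma logdist_ge0 e t : 0 < e <= 2 -> 0 <= logdist e t.
Proof.
move=> /andP[e0 e2]; rewrite subr_ge0 ler_ln ?posrE ?lt_max ?e0 ?orbT// ge_max e2 andbT.
by have := rdist_le2 E_circle E0 (expi t); rewrite normc_expi.
Qed.

Lemma logdist_lip e s t : 0 < e ->
  `|logdist e s - logdist e t| <= normc (expi s - expi t) / e.
Proof.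
move=> e0; rewrite /logdist.
have -> : ln 2 - ln (Num.max (rdist E (expi s)) e) - (ln 2 - ln (Num.max (rdist E (expi t)) e)) =
  - (ln (Num.max (rdist E (expi s)) e) - ln (Num.max (rdist E (expi t)) e)) by ring.
rewrite normrN; apply: le_trans (ln_lip (e := e) _ _ _) _; rewrite ?le_max ?lexx ?orbT//.
by rewrite ler_pM2r ?invr_gt0// (le_trans (max_lip _ _ _))// rdist_lipN.
Qed.

Lemma cont_logdist e t : 0 < e -> cont_at (logdist e) t.
Proof.
move=> e0; split; apply/cvgrPdist_lt => d d0.
have de : 0 < d * e by rewrite mulr_gt0.
have [] := cont_near (@expi R) t => /(_ (cont_expi t)) /(_ _ de) + _.
apply: filterS => s h; apply: le_lt_trans (logdist_lip _ _ e0) _.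
by rewrite ltr_pdivrMr.
Qed.

Definition logdist_herg e := herg (@lebesgue_measure R)
  (`[0, 2 * pi]%classic : set (measurableTypeR R)) (@expi R) (logdist e).

Let mI : measurable (`[0, 2 * pi]%classic : set (measurableTypeR R)).
Proof. exact: measurable_itv. Qed.

Let cmeas_expi : cmeas (`[0, 2 * pi]%classic : set (measurableTypeR R)) (@expi R).
Proof. by apply: cintegrable_cmeas; apply: cont_cintegrable => t _; exact: cont_expi. Qed.

Let expi1 (t : measurableTypeR R) : `[0, 2 * pi]%classic t -> 1 <= normc (expi t).
Proof. by rewrite normc_expi. Qed.

Let expi1' (t : measurableTypeR R) : `[0, 2 * pi]%classic t -> normc (expi t) <= 1.
Proof. by rewrite normc_expi. Qed.

Let logdist_int e : 0 < e -> lebesgue_measure.-integrable `[0, 2 * pi] (EFin \o logdist e).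
Proof. by move=> e0; apply: rint_integrable => t; exact: cont_logdist. Qed.

Lemma holo_logdist_herg e : 0 < e <= 2 -> holo (logdist_herg e).
Proof.
move=> e02; have /andP[e0 _] := e02.
exact: (holo_herg mI cmeas_expi expi1 expi1' (logdist_int e0) (fun _ _ => logdist_ge0 _ e02)).
Qed.

Lemma Re_logdist_herg e z : 0 < e <= 2 -> normc z < 1 ->
  complex.Re (logdist_herg e z) =
    rint (fun s => logdist e s * ((1 - normc z ^+ 2) / normc (expi s - z) ^+ 2)).
Proof.
move=> e02 z1; have /andP[e0 _] := e02.
rewrite /logdist_herg (Re_herg _ _ expi1 z1).
by apply: eq_Rintegral => t _; rewrite normc_expi expr1n.
Qed.

Lemma poisson_sym r s t : poisson (expi s) r t = poisson (expi t) r s.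
Proof.
rewrite /poisson !poisson_denom ?normc_expi//; congr (_ / (_ - _ * _)).
by rewrite !expi_cos_sin /=; ring.
Qed.

(** For fixed [e] the datum is Lipschitz with constant 1 / e, and the Poisson kernel has second
    moment O(1 - r), so close to the circle the Poisson integral hardly exceeds the boundary value.
    The factor 2 pi is the missing normalisation of [herg]. *)
Lemma Re_logdist_herg_le e r t : 0 < e <= 2 -> 0 < r < 1 -> 1 - r <= e ^+ 2 / 8 ->
  complex.Re (logdist_herg e (r%:C * expi t)) <= 2 * pi * (logdist e t + 1).
Proof.
move=> e02 r01 re; have /andP[e0 e2] := e02.
have nz : normc (r%:C * expi t : R[i]) = r by rewrite normc_circle gtr0_norm//; lra.
rewrite Re_logdist_herg ?nz//; last by lra.
have pc s : cont_at (poisson (expi t) r) s by apply: cont_poisson => //; exact: normc_expi.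
have lc s : cont_at (logdist e) s by exact: cont_logdist.
rewrite (eq_rint (v := fun s => logdist e s * poisson (expi t) r s)); last first.
  by move=> s; rewrite poisson_sym.
apply: (@le_trans _ _ (rint (fun s => (logdist e t + 2^-1) * poisson (expi t) r s + 2^-1))).
  apply: le_rint => s.
  - by apply: rcontM.
  - by apply: rcontD; [apply: rcontM => //; exact: rcont_cst|exact: rcont_cst].
  have r01' : 0 <= r < 1 by lra.
  have P0 := poisson_ge0 (expi t) s r01'.
  have n0 := normc_ge0 (expi s - expi t).
  have L : logdist e s <= logdist e t + 2^-1 + normc (expi s - expi t) ^+ 2 / (2 * e ^+ 2).
    have := logdist_lip s t e0; have := ler_norm (logdist e s - logdist e t).
    move: n0; move: (normc _) => x x0.
    have : x / e <= 2^-1 + x ^+ 2 / (2 * e ^+ 2).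
      rewrite -subr_ge0 (_ : _ - _ = (1 - x / e) ^+ 2 / 2); first by rewrite divr_ge0 ?sqr_ge0.
      by field; rewrite gt_eqF.
    move: (x / e) (x ^+ 2 / _) => a b; lra.
  (* |e^(is) - e^(it)| is at most 2 |e^(it) - r e^(is)|. The resulting 4 (1 - r^2) is at most 8 (1 -
     r) <= e^2, which divided by 2 e^2 is the second 1/2. *)
  have Q : normc (expi s - expi t) ^+ 2 * poisson (expi t) r s <= 4 * (1 - r ^+ 2).
    have near := normc_lerB (expi t) (r%:C * expi s).
    rewrite normc_expi normc_circle gtr0_norm in near; last by lra.
    set q := normc (expi t - r%:C * expi s) in near *.
    have q0 : 0 < q by lra.
    have : normc (expi s - expi t) <= 2 * q.
      have := normc_triangle (r%:C * expi s) (expi t) (expi s).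
      have : normc (r%:C * expi s - expi s) = 1 - r.
        rewrite -{2}[expi s]mul1r -mulrBl normcM normc_expi mulr1 normcBC.
        by rewrite -(rmorph1 (real_complex R)) -rmorphB normc_real ger0_norm//; lra.
      by rewrite -/q (normcBC (expi t) (expi s)); lra.
    move=> /(lerXn2r 2); rewrite !nnegrE => /(_ n0); rewrite mulr_ge0 ?(ltW q0)// => /(_ isT) h.
    have r2 : 0 <= 1 - r ^+ 2 by rewrite subr_ge0 expr_le1//; lra.
    rewrite /poisson -/q [leLHS]mulrA ler_pdivrMr ?exprn_gt0//.
    rewrite [leRHS]mulrAC ler_wpM2r//.
    by rewrite exprMn in h; lra.
  have : logdist e s * poisson (expi t) r s <=
      (logdist e t + 2^-1 + normc (expi s - expi t) ^+ 2 / (2 * e ^+ 2)) * poisson (expi t) r s.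
    by rewrite ler_wpM2r.
  rewrite [leRHS]mulrDl mulrAC => /le_trans; apply; rewrite lerD2l.
  rewrite ler_pdivrMr ?mulr_gt0 ?exprn_gt0//; apply: le_trans Q _.
  have : 1 - r ^+ 2 <= 2 * (1 - r).
    by have := sqr_ge0 (1 - r); rewrite !expr2; lra.
  lra.
rewrite rintD; [|by move=> s; apply: rcontM => //; exact: rcont_cst|by move=> s; exact: rcont_cst].
rewrite rintZ// poisson_mean ?normc_expi ?rint_cst//; last by lra.
by have := @pi_gt0 R; lra.
Qed.

End LogDistance.

Section Carleson.
Context {R : realType}.
Implicit Types (r s t x y e : R) (z w : R[i]) (h : R[i] -> R[i]).
Variables (E : set R[i]) (h : R[i] -> R[i]) (C : R).
Hypotheses (E_circle : E `<=` circle) (E0 : E !=set0) (hh : holo h)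
  (hC : forall e r, 0 < e <= 2 -> 0 < r < 1 -> 1 - r <= e ->
    rint (fun t => (Num.sqrt (Num.max (rdist E (expi t)) e))^-1 *
      normc (h (r%:C * expi t)) ^+ 2) <= C).

Lemma circ_normc_le (f : R[i] -> R[i]) r (u : R -> R) : (forall t, cont_at u t) ->
  (forall t, cont_at (fun t => f (r%:C * expi t)) t) ->
  (forall t, normc (f (r%:C * expi t)) <= u t) -> normc (circ f r) <= 2 * rint u.
Proof.
move=> uc fc fu; apply: normc_cint => //; last exact: rint_integrable.
by apply: cont_cintegrable.
Qed.

(** Re H(z0) dominates a multiple of the integral of [logdist], so a bound on |kap z0| is enough.
    Cauchy's formula for kap h provides it: by |kap h| <= (1 + |kap h|^2) / 2 only the weighted
    square mean in [hC] is needed, and h z0 can be divided out. *)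
Lemma rint_logdist_bound z0 : normc z0 < 1 -> h z0 != 0 ->
  exists K : R, forall e, 0 < e <= 2 -> rint (logdist E e) <= K.
Proof.
move=> z01 hz0; have p0 := @pi_gt0 R; have n0 := normc_ge0 z0.
pose k : R := expR ((ln 2 + 1) / 2).
have nh : 0 < normc (h z0) by rewrite normc_gt0.
have z1 : 0 < 1 - normc z0 by lra.
pose Q : R := 2 * ((2 * pi + k * C) / (1 - normc z0)) / (2 * pi * normc (h z0)).
exists (8 * pi * Q * 4 / (1 - normc z0)) => e e02; have /andP[e0 e2] := e02.
pose H := logdist_herg E e.
have Hh : holo H by exact: holo_logdist_herg.
(* 1 / (8 pi) fits the square root in [hC]: Re H is at most 2 pi (logdist + 1) on the circle used,
   so |kap|^2 is at most exp ((logdist + 1) / 2), which is [k] / sqrt (max (rdist, e)). *)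
pose kap z := expC (((8 * pi)^-1)%:C * H z).
have kh : holo kap.
  move=> z zz; have [l hl] := Hh z zz; eexists.
  exact: cdiff_comp (cdiffZ ((8 * pi)^-1)%:C hl) (cdiff_expC _).
have gh : holo (fun z => kap z * h z).
  move=> z zz; have [l hl] := kh z zz; have [m hm] := hh zz; eexists; exact: cdiffM hl hm.
have nk z : normc (kap z) = expR (complex.Re (H z) / (8 * pi)).
  rewrite normc_expC mulrC; congr expR; case: (H z) => a b /=.
  by rewrite mulr0 subr0.
(* The entries serve, in order, to keep [z0] well inside the circle, to apply [hC], and to apply
   [Re_logdist_herg_le]. *)
pose r := Num.max ((1 + normc z0) / 2) (Num.max (1 - e) (1 - e ^+ 2 / 8)).
have e28 : 0 < e ^+ 2 / 8 by rewrite divr_gt0// exprn_gt0.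
have r1 : r < 1 by rewrite !gt_max; apply/and3P; split; lra.
have rz : (1 + normc z0) / 2 <= r by rewrite le_max lexx.
have re : 1 - r <= e.
  by rewrite lerBlDr -lerBlDl !le_max lexx orbT.
have re2 : 1 - r <= e ^+ 2 / 8.
  by rewrite lerBlDr -lerBlDl !le_max lexx !orbT.
have r01 : 0 < r < 1 by lra.
have z0r : normc z0 < r by lra.
have disc t : normc (r%:C * expi t : R[i]) = r by rewrite normc_circle gtr0_norm//; lra.
pose m t := (Num.sqrt (Num.max (rdist E (expi t)) e))^-1 * normc (h (r%:C * expi t)) ^+ 2.
have mc t : cont_at m t.
  apply: rcontM; last by apply: cont_sqr_normc; exact: holo_circle_cont.
  by apply: cont_max_sqrt => //; exact: cont_rdist_expi.
have K2 t : normc (kap (r%:C * expi t)) ^+ 2 <= k * (Num.sqrt (Num.max (rdist E (expi t)) e))^-1.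
  rewrite nk -expRM_natr.
  have M0 : 0 < Num.max (rdist E (expi t)) e by rewrite lt_max e0 orbT.
  have -> : Num.sqrt (Num.max (rdist E (expi t)) e) = expR (ln (Num.max (rdist E (expi t)) e) / 2).
    rewrite -[in LHS](lnK M0) -[X in expR X](divfK (_ : 2 != 0 :> R))//.
    by rewrite expRM_natr sqrtr_sqr ger0_norm// expR_ge0.
  rewrite /k -expRN -expRD ler_expR.
  have := Re_logdist_herg_le E0 t e02 r01 re2; rewrite -/H /logdist.
  set X := complex.Re _; set Y := ln (Num.max _ _) => XY.
  have : X / (8 * pi) <= 2 * pi * (ln 2 - Y + 1) / (8 * pi) by rewrite ler_pM2r ?invr_gt0// mulr_gt0.
  have F (p q : R) : p != 0 -> 2 * p * q / (8 * p) = q / 4 by move=> ?; field.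
  rewrite F ?gt_eqF//.
  move: (X / _) => v; lra.
have U t : normc (kap (r%:C * expi t) * h (r%:C * expi t) *
    (r%:C * expi t / (r%:C * expi t - z0))) <= (1 - normc z0)^-1 * (1 + k * m t).
  have q : normc (r%:C * expi t / (r%:C * expi t - z0)) <= 2 / (1 - normc z0).
    rewrite normc_div disc; have := normc_lerB (r%:C * expi t) z0; rewrite disc => d.
    have d0 : 0 < normc (r%:C * expi t - z0) by lra.
    rewrite ler_pdivrMr// [leRHS]mulrAC ler_pdivlMr//.
    have : (1 - normc z0) <= 2 * normc (r%:C * expi t - z0) by lra.
    have : r * (1 - normc z0) <= 1 - normc z0 by rewrite ler_piMl//; lra.
    lra.
  rewrite normcM; apply: le_trans (ler_wpM2l (normc_ge0 _) q) _.
  rewrite mulrA mulrC ler_pM2l ?invr_gt0//.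
  have : k * m t >= (normc (kap (r%:C * expi t)) * normc (h (r%:C * expi t))) ^+ 2.
    by rewrite exprMn /m [leRHS]mulrA; apply: ler_wpM2r; [exact: sqr_ge0|exact: K2].
  rewrite -normcM; move: (normc (_ * _)) (k * m t) => a b ab.
  by have := sqr_ge0 (1 - a); rewrite expr2; rewrite expr2 in ab; lra.
have kmc t : cont_at (fun t => 1 + k * m t) t.
  by apply: rcontD; [exact: rcont_cst|apply: rcontM => //; exact: rcont_cst].
have B : normc (circ (fun w => kap w * h w * (w / (w - z0))) r) <=
    2 * ((2 * pi + k * C) / (1 - normc z0)).
  apply: le_trans (circ_normc_le (u := fun t => (1 - normc z0)^-1 * (1 + k * m t)) _ _ U) _.
  - by move=> t; apply: rcontM => //; exact: rcont_cst.
  - move=> t; apply: contM; first exact: (holo_circle_cont gh r01).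
    apply: contM; first exact: cont_circle.
    apply: contV; last by apply: contB; [exact: cont_circle|exact: cont_cst].
    by rewrite -normc_gt0; have := normc_lerB (r%:C * expi t) z0; rewrite disc; lra.
  rewrite rintZ// ler_pM2l// mulrC ler_pM2r ?invr_gt0//.
  rewrite rintD; [|by move=> t; exact: rcont_cst|by move=> t; apply: rcontM => //; exact: rcont_cst].
  rewrite rint_cst mulr1 rintZ// lerD2l ler_pM2l ?expR_gt0//; exact: hC.
have QB : normc (kap z0) <= Q.
  move: B; rewrite cauchy_formula// (normcM (2 * pi)%:C) (normcM (kap z0)) normc_real ger0_norm; last by lra.
  move=> B; rewrite /Q ler_pdivlMr ?mulr_gt0//; apply: le_trans B.
  by rewrite le_eqVlt; apply/orP; left; apply/eqP; ring.
have RB : complex.Re (H z0) <= 8 * pi * Q.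
  rewrite mulrC -ler_pdivrMr ?mulr_gt0//; apply: le_trans QB; rewrite nk.
  by have := expR_ge1Dx (complex.Re (H z0) / (8 * pi)); lra.
have lc t : cont_at (logdist E e) t by exact: cont_logdist.
(* The Poisson kernel at [z0] is at least (1 - |z0|) / 4, its denominator being at most 4. *)
have : (1 - normc z0) / 4 * rint (logdist E e) <= 8 * pi * Q.
  apply: le_trans RB; rewrite Re_logdist_herg// -rintZ//; apply: le_rint => t.
  - by apply: rcontM => //; exact: rcont_cst.
  - have far : 0 < normc (expi t - z0).
      by have := normc_lerB (expi t) z0; rewrite normc_expi; lra.
    apply: rcontM => //; apply: rcontM; first exact: rcont_cst.
    have sc : cont_at (fun t => normc (expi t - z0) ^+ 2) t.
      by apply: cont_sqr_normc; apply: contB; [exact: cont_expi|exact: cont_cst].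
    by case: sc => sc; split; apply: cvgV => //; rewrite gt_eqF// exprn_gt0.
  rewrite mulrC ler_wpM2l ?logdist_ge0//.
  have far : 0 < normc (expi t - z0).
    by have := normc_lerB (expi t) z0; rewrite normc_expi; lra.
  rewrite ler_pdivlMr ?exprn_gt0// mulrAC ler_pdivrMr//.
  have near : normc (expi t - z0) <= 2 by have := normcB (expi t) z0; rewrite normc_expi; lra.
  have n4 : normc (expi t - z0) ^+ 2 <= 4.
    have : normc (expi t - z0) * normc (expi t - z0) <= 2 * 2 by rewrite ler_pM// ltW.
    by rewrite expr2; lra.
  have : (1 - normc z0) * normc (expi t - z0) ^+ 2 <= (1 - normc z0) * 4 by rewrite ler_pM2l.
  have : normc z0 * normc z0 <= normc z0 by rewrite ler_piMl//; lra.
  rewrite -expr2; lra.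
rewrite mulrAC ler_pdivrMr// mulrC => {}B.
by rewrite ler_pdivlMr.
Qed.

End Carleson.

Section CarlesonIntegral.
Context {R : realType}.
Implicit Types (r s t x y e : R) (z w : R[i]).
Local Notation mu := (@lebesgue_measure R).
Local Notation I := (`[0, 2 * pi]%classic : set (measurableTypeR R)).

Section nonempty.
Variables (E : set R[i]) (K : R).
Hypotheses (E_circle : E `<=` circle) (E0 : E !=set0)
  (EK : forall e, 0 < e <= 2 -> rint (logdist E e) <= K).

Let eps (n : nat) : R := n.+1%:R^-1.

Let eps0 n : 0 < eps n <= 2.
Proof.
rewrite invr_gt0 ltr0n /=; apply: (@le_trans _ _ 1) => //; last by rewrite ler1n.
by rewrite invf_le1 ?ltr0n// ler1n.
Qed.

Let f t : \bar R := lne ((dist (expi t) E)^-1).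

Let g (n : nat) t : \bar R := (logdist E (eps n) t)%:E.

(** Where the distance is positive the sequence is eventually constant; where it vanishes, the terms
    are ln 2 + ln (n + 1) and tend to +oo. *)
Let g_cvg t : g n t @[n --> \oo] --> (f t + (ln 2)%:E)%E.
Proof.
have ge0 := rdist_ge0 E0 (expi t); rewrite /f (distE E0).
have [d0|d0] := eqVneq (rdist E (expi t)) 0.
  rewrite d0 /inve eqxx /= addye//; apply/cvgeyPge => A.
  exists (Num.bound (expR (A - ln 2))) => // n /= nA.
  rewrite /g lee_fin /logdist d0 max_r; last by case/andP: (eps0 n) => /ltW.
  rewrite /eps lnV ?posrE ?ltr0n// opprK -lerBlDl -[leLHS]expRK ler_ln ?posrE ?expR_gt0 ?ltr0n//.
  apply: ltW; apply: lt_le_trans (archi_boundP (expR_ge0 _)) _.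
  by rewrite ler_nat (leq_trans nA).
have dp : 0 < rdist E (expi t) by rewrite lt_neqAle eq_sym d0.
rewrite /inve (negbTE d0) /= leNgt invr_gt0 dp /= -EFinD lnV ?posrE// addrC.
apply: (@cvg_trans _ ((ln 2 - ln (rdist E (expi t)))%:E @[n --> \oo])); last exact: cvg_cst.
apply: near_eq_cvg; exists (Num.bound (rdist E (expi t))^-1) => // n /= nA.
rewrite /g /logdist max_l//; rewrite /eps -[leRHS]invrK lef_pV2 ?posrE ?invr_gt0 ?ltr0n//.
have := archi_boundP (_ : 0 <= (rdist E (expi t))^-1); rewrite invr_ge0 => /(_ ge0) /ltW /le_trans; apply.
by rewrite ler_nat (leq_trans nA).
Qed.

Let mg n : measurable_fun I (g n).
Proof.
apply/measurable_EFinP; apply: measurable_funTS; apply: continuous_measurable_fun => t.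
by have [] := cont_logdist E0 t (proj1 (andP (eps0 n))).
Qed.

Let g0 n t : (0 <= g n t)%E.
Proof. by rewrite lee_fin logdist_ge0. Qed.

Let g_mono t : {homo (g^~ t) : n m / (n <= m)%N >-> (n <= m)%E}.
Proof.
move=> n m nm; rewrite /g lee_fin lerD2l lerN2.
have /andP[n0 _] := eps0 n; have /andP[m0 _] := eps0 m.
rewrite ler_ln ?posrE ?lt_max ?n0 ?m0 ?orbT// ge_max !le_max lexx /=.
by rewrite /eps lef_pV2 ?posrE ?ltr0n// ler_nat ltnS nm orbT.
Qed.

Lemma measurable_lne_dist : measurable_fun I f.
Proof.
have mf2 : measurable_fun I (fun t => f t + (ln 2)%:E)%E.
  by apply: (emeasurable_fun_cvg _ _ mg) => t _; exact: g_cvg.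
have := emeasurable_funB mf2 (measurable_cst (ln 2 : R)%:E).
by apply: eq_measurable_fun => t _; rewrite addeK.
Qed.

Lemma lne_dist_ge t : (0 <= f t + (ln 2)%:E)%E.
Proof.
rewrite -(cvg_lim _ (@g_cvg t))//; apply: lime_ge; first by apply/cvg_ex; eexists; exact: g_cvg.
by apply: nearW => n; exact: g0.
Qed.

(** The integrand can be negative, but not below - ln 2. Shifted by ln 2 it is the increasing limit
    of nonnegative truncations, to which monotone convergence applies. *)
Lemma carleson_integral : (\int[mu]_(t in I) f t < +oo)%E.
Proof.
have mI : measurable I by exact: measurable_itv.
have mf2 : measurable_fun I (fun t => f t + (ln 2)%:E)%E.
  by apply: emeasurable_funD; [exact: measurable_lne_dist|exact: measurable_cst].
have ff : (\int[mu]_(t in I) f t <= \int[mu]_(t in I) (f t + (ln 2)%:E))%E.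
  rewrite integralE; apply: (@le_trans _ _ (\int[mu]_(t in I) f^\+ t)%E).
    by rewrite geeDl// oppe_le0 integral_ge0.
  apply: ge0_le_integral => //.
  - exact: measurable_funepos measurable_lne_dist.
  move=> t _; rewrite funeposE ge_max; apply/andP; split.
    by rewrite leeDl// lee_fin ln_ge0// ler1n.
  exact: lne_dist_ge.
apply: le_lt_trans ff _.
have -> : (\int[mu]_(t in I) (f t + (ln 2)%:E) = \int[mu]_(t in I) limn (g^~ t))%E.
  by apply: eq_integral => t _; rewrite (cvg_lim _ (@g_cvg t)).
rewrite monotone_convergence//.
apply: (@le_lt_trans _ _ K%:E); last exact: ltry.
apply: lime_le.
  apply: ereal_nondecreasing_is_cvgn => n m nm; apply: ge0_le_integral => //.
  by move=> t _; exact: g_mono.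
near=> n; rewrite /g.
have -> : (\int[mu]_(t in I) (logdist E (eps n) t)%:E = (rint (logdist E (eps n)))%:E)%E.
  rewrite /rint /Rintegral fineK//; apply: integrable_fin_num => //.
  by apply: rint_integrable => t; apply: cont_logdist => //; case/andP: (eps0 n).
by rewrite lee_fin; exact: EK.
Unshelve. all: by end_near. Qed.

End nonempty.

(** The distance to the empty set is +oo, so the integrand is constantly -oo, and so is its
    integral. *)
Lemma carleson_set0 : carleson_set (set0 : set R[i]).
Proof.
split; [exact: compact0|by []|].
rewrite (eq_integral (fun=> -oo%E)); last first.
  by move=> t _; rewrite /dist image_set0 ereal_inf0 invey /= lexx.
rewrite (integral_cst mu (measurable_itv `[0, 2 * pi]) (-oo)%E).
have p0 := @pi2_gt0 R.
have mI : mu I = (2 * pi - 0)%:E by apply: measure_itvcc; exact: ltW.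
have lt : (-oo * mu I < +oo)%E by rewrite mI gt0_mulNye ?lte_fin ?subr0// ltNyr.
exact: lt.
Qed.

(** The tolerance 1 / (n + 1) is comparable with the scale D at which the n-th atom gets used, so it
    costs only a constant. *)
Lemma nearest_exists (E : set R[i]) : E !=set0 -> exists c : nat -> R[i],
  (forall n, E (c n)) /\ forall n : nat,
    normc (expi (ln n.+1%:R) - c n) < rdist E (expi (ln n.+1%:R)) + n.+1%:R^-1.
Proof.
move=> E0; suff /choice[c Hc] : forall n : nat, exists z, E z /\
    normc (expi (ln n.+1%:R) - z) < rdist E (expi (ln n.+1%:R)) + n.+1%:R^-1.
  by exists c; split=> n; have [] := Hc n.
move=> n; have e0 : 0 < n.+1%:R^-1 :> R by rewrite invr_gt0 ltr0n.
by have [w Ew Hw] := rdist_approx E0 (expi (ln n.+1%:R)) e0; exists w.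
Qed.

Lemma factors_carleson (E : set R[i]) : compact E -> E `<=` circle ->
  (forall m : {finite_measure set (borelC R) -> \bar R},
     supported_on m circle -> singular m -> supported_on m E ->
     is_factor (singular_inner m)) -> carleson_set E.
Proof.
move=> cE Ec HE; have [->|/set0P E0] := eqVneq E set0; first exact: carleson_set0.
have [c [Ecn c_near]] := nearest_exists E0.
have fac : is_factor (singular_inner (atomic c)).
  apply: HE; first by apply: atomic_null => n; apply; exact: Ec.
    exact: atomic_singular.
  exact: atomic_supported.
have [h [C [hh [z z1 hz] hC]]] := factor_mean_bound cE Ec E0 Ecn c_near fac.
have [K HK] := rint_logdist_bound Ec E0 hh hC z1 hz.
by split=> //; exact: carleson_integral Ec E0 HK.
Qed.

End CarlesonIntegral.

(** * Carleson sets give factors *)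

Section CarlesonWeight.
Context {R : realType}.
Implicit Types (r s t x y e : R) (z w : R[i]).
Local Notation mu := (@lebesgue_measure R).
Local Notation I := (`[0, 2 * pi]%classic : set (measurableTypeR R)).
Variable E : set R[i].
Hypotheses (E_circle : E `<=` circle) (E0 : E !=set0)
  (E_carleson : (\int[mu]_(t in I) lne ((dist (expi t) E)^-1) < +oo)%E).

Let f t : \bar R := lne ((dist (expi t) E)^-1).

Let mI : measurable I. Proof. exact: measurable_itv. Qed.

Let muI : mu I = (2 * pi)%:E.
Proof. by have := measure_itvcc (ltW (@pi2_gt0 R)); rewrite subr0 => H; exact: H. Qed.

Let mf : measurable_fun I f. Proof. exact: measurable_lne_dist. Qed.

Let f_ge t : (0 <= f t + (ln 2)%:E)%E. Proof. exact: lne_dist_ge. Qed.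

(** The hypothesis bounds an integral of varying sign from above. Since the integrand is at least -
    ln 2, its negative part has finite integral, and hence so does the positive part. *)
Lemma lne_dist_integrable : mu.-integrable I (fun t => f t + (ln 2)%:E)%E.
Proof.
have l2 : 0 <= ln 2 :> R by rewrite ln_ge0// ler1n.
have icst : (\int[mu]_(t in I) (ln 2 : R)%:E = (ln 2 * (2 * pi))%:E)%E.
  by apply: (etrans (integral_cst mu mI (ln 2 : R)%:E)); rewrite EFinM; congr (_ * _)%E; exact: muI.
have fp : (\int[mu]_(t in I) f^\+ t < +oo)%E.
  move: E_carleson; rewrite integralE.
  have fn : (\int[mu]_(t in I) f^\- t <= (ln 2 * (2 * pi))%:E)%E.
    rewrite -icst; apply: ge0_le_integral => //.
    - exact: measurable_funeneg mf.
    - move=> t _; rewrite funenegE ge_max lee_fin l2 andbT.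
      have := f_ge t; case: (f t) => [x||] /=; [rewrite -EFinD !lee_fin; lra|by rewrite leNye|by []].
  have fn0 : (0 <= \int[mu]_(t in I) f^\- t)%E by exact: integral_ge0.
  move: (\int[mu]_(t in I) f^\- t)%E fn fn0 => [x||] // _ _ H.
  have fp0 : (0 <= \int[mu]_(t in I) f^\+ t)%E by exact: integral_ge0.
  rewrite ltey; apply: contraTneq H; rewrite -/I => ->; by rewrite addye// ltxx.
apply/integrableP; split.
  by apply: emeasurable_funD => //; exact: measurable_cst.
apply: (@le_lt_trans _ _ (\int[mu]_(t in I) (f^\+ t + (ln 2)%:E))%E).
  apply: ge0_le_integral => //.
  - apply: measurableT_comp => //; apply: emeasurable_funD => //; exact: measurable_cst.
  - by apply: emeasurable_funD; [exact: measurable_funepos mf|exact: measurable_cst].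
  - by move=> t _; rewrite gee0_abs// leeD2r// funeposE le_max lexx.
have l2' (t : measurableTypeR R) : I t -> (0 <= (ln 2 : R)%:E)%E by rewrite lee_fin.
rewrite (ge0_integralD mu mI _ (measurable_funepos mf) l2' (measurable_cst _))//.
by rewrite icst lte_add_pinfty// ltry.
Qed.

(** The 4 leaves room for comparing the distance at a point of the disc with that at nearby points
    of the circle, larger by a factor of at most 17/8. At distance 0 the value is ln 0 = 0 by
    convention, but only on a null set of angles. *)
Definition logweight t : R := ln (4 / rdist E (expi t)).

Lemma logweight_ge0 t : 0 <= logweight t.
Proof.
have ge0 := rdist_ge0 E0 (expi t).
rewrite /logweight; have [->|d0] := eqVneq (rdist E (expi t)) 0.
  by rewrite invr0 mulr0 ln0.
have dp : 0 < rdist E (expi t) by rewrite lt_neqAle eq_sym d0.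
apply: ln_ge0; rewrite ler_pdivlMr// mul1r.
by have := rdist_le2 E_circle E0 (expi t); rewrite normc_expi; lra.
Qed.

Let measurable_rdist : measurable_fun [set: measurableTypeR R] (fun t => rdist E (expi t)).
Proof. by apply: continuous_measurable_fun => t; have [] := cont_rdist_expi E0 t. Qed.

Lemma measurable_logweight : measurable_fun [set: measurableTypeR R] logweight.
Proof.
apply: (measurableT_comp (@measurable_ln R)); apply: measurable_funM; first exact: measurable_cst.
exact: (measurableT_comp measurable_inv measurable_rdist).
Qed.

Lemma logweight_integrable : mu.-integrable I (EFin \o logweight).
Proof.
have l2 : 0 <= ln 2 :> R by rewrite ln_ge0// ler1n.
have ic : mu.-integrable I (EFin \o (fun=> ln 2 : R)) by exact: integrable_itv_cst.
apply: le_integrable (integrableD mI lne_dist_integrable ic) => //.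
  by apply/measurable_EFinP; apply: measurable_funTS; exact: measurable_logweight.
move=> t _; rewrite /= (ger0_norm (logweight_ge0 t)) gee0_abs; last by rewrite adde_ge0//; exact: f_ge.
rewrite /f /logweight (distE E0) /inve.
have ge0 := rdist_ge0 E0 (expi t).
have [d0|d0] := eqVneq (rdist E (expi t)) 0; first by rewrite /= !addye// leey.
have dp : 0 < rdist E (expi t) by rewrite lt_neqAle eq_sym d0.
rewrite /lne (leNgt (rdist _ _)^-1) invr_gt0 dp /= -!EFinD lee_fin lnM ?posrE ?invr_gt0//.
have -> : 4 = 2 * 2 :> R by ring.
rewrite (@lnM _ 2 2) ?posrE//; lra.
Qed.

(** An integrable function is finite almost everywhere, and the shifted integrand is +oo at distance
    0. *)
Lemma rdist_neq0_ae : \forall t \ae mu, I t -> rdist E (expi t) != 0.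
Proof.
apply: filterS (integrable_ae mI lne_dist_integrable) => t H It; have := H It.
by apply: contraTneq => d0; rewrite /f (distE E0) d0 /inve eqxx.
Qed.

Definition outer_point t : R[i] := (1 + rdist E (expi t))%:C * expi t.

Lemma normc_outer_point t : normc (outer_point t) = 1 + rdist E (expi t).
Proof.
by rewrite /outer_point normc_realM normc_expi mulr1 ger0_norm// addr_ge0// rdist_ge0.
Qed.

Lemma outer_point_near t : normc (outer_point t - expi t) = rdist E (expi t).
Proof.
have -> : outer_point t - expi t = (rdist E (expi t))%:C * expi t.
  by rewrite /outer_point rmorphD rmorph1 mulrDl mul1r addrC addKr.
by rewrite normc_realM normc_expi mulr1 ger0_norm// rdist_ge0.
Qed.

(** The node has modulus 1 + rdist (expi t), so it is at least rdist (expi t) away from [z]; a path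
    from [z] to the node, to expi t and on to [E] costs that distance plus twice rdist (expi t). *)
Lemma outer_point_far t z : normc z < 1 -> rdist E z <= 3 * normc (outer_point t - z).
Proof.
move=> z1; have := normc_lerB (outer_point t) z; rewrite normc_outer_point.
have := rdist_lip E0 z (expi t); have := normc_triangle (outer_point t) z (expi t).
by rewrite outer_point_near (normcBC z (outer_point t)); lra.
Qed.

Lemma cmeas_outer_point : cmeas I outer_point.
Proof.
apply: cmeasM; last by apply: cintegrable_cmeas; apply: cont_cintegrable => t _; exact: cont_expi.
apply: cmeas_real; apply: measurable_funTS.
by apply: measurable_funD; [exact: measurable_cst|exact: measurable_rdist].
Qed.

Definition weight_herg := herg mu I outer_point logweight.

Let outer1 (t : measurableTypeR R) : I t -> 1 <= normc (outer_point t).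
Proof. by move=> _; rewrite normc_outer_point lerDl rdist_ge0. Qed.

Let outer3 (t : measurableTypeR R) : I t -> normc (outer_point t) <= 3.
Proof.
move=> _; rewrite normc_outer_point.
by have := rdist_le2 E_circle E0 (expi t); rewrite normc_expi; lra.
Qed.

Lemma Re_weight_herg_ge0 z : normc z < 1 -> 0 <= complex.Re (weight_herg z).
Proof. exact: (Re_herg_ge0 _ outer1 (fun t _ => logweight_ge0 t)). Qed.

Lemma rdist_gt0 z : normc z < 1 -> 0 < rdist E z.
Proof. by move=> z1; have := rdist_disc E_circle E0 z; lra. Qed.

Lemma weight_herg_derive : exists2 C : R, 0 <= C & forall z, normc z < 1 ->
  exists2 l, cdiff weight_herg z l & normc l <= C / rdist E z ^+ 2.
Proof.
pose W := \int[mu]_(t in I) logweight t.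
have W0 : 0 <= W by apply: Rintegral_ge0 => t _; exact: logweight_ge0.
(* 4 B / e^2 with nodes bounded by B = 3 and e = rdist E z / 6, the latter from [outer_point_far]:
   432 is 12 times 36. *)
exists (432 * W); first exact: mulr_ge0 (ler0n _ _) W0.
move=> z z1; have d0 := rdist_gt0 z1.
have e0 : 0 < rdist E z / 6 by rewrite divr_gt0.
eexists; first exact: (cdiff_herg mI cmeas_outer_point outer1 outer3 logweight_integrable (fun t _ => logweight_ge0 t)).
have far (t : measurableTypeR R) : I t -> 2 * (rdist E z / 6) <= normc (outer_point t - z).
  by move=> _; have := outer_point_far t z1; lra.
apply: le_trans (herg_derive_le mI cmeas_outer_point outer3 logweight_integrable (fun t _ => logweight_ge0 t) z1 e0 far) _.
rewrite -/W le_eqVlt; apply/orP; left; apply/eqP; field.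
by rewrite gt_eqF.
Qed.

End CarlesonWeight.

Section WeightLowerBound.
Context {R : realType}.
Implicit Types (r s t x y e : R) (z w : R[i]).
Local Notation mu := (@lebesgue_measure R).
Local Notation I := (`[0, 2 * pi]%classic : set (measurableTypeR R)).
Variable E : set R[i].
Hypotheses (E_circle : E `<=` circle) (E0 : E !=set0)
  (E_carleson : (\int[mu]_(t in I) lne ((dist (expi t) E)^-1) < +oo)%E).
Local Notation H := (weight_herg E).

(** The arc is placed on the side of [x] that has room, so that it is one subinterval of the domain
    of integration. *)
Lemma short_arc x e : 0 <= x <= 2 * pi -> 0 < e <= 1 ->
  exists y, [/\ 0 <= y, y + e <= 2 * pi, y <= x & x <= y + e].
Proof.
move=> x01 e01; have := @pi_ge2 R => p2.
have [xe|xe] := leP (x + e) (2 * pi); first by exists x; split; lra.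
by exists (x - e); split; lra.
Qed.

(** [d] is the distance from z to E, [n] is |z|, [rho] the distance at an angle of the arc, [q] the
    distance from z to the node. The numerator is at least 7 d / 8 after factoring, and (13/4)^2 /
    16 < 7/8. *)
Lemma kernel_ratio_ge (d n rho q : R) : 0 < d -> 0 <= n -> 0 < q -> q <= 13 / 4 * d ->
  7 / 8 * d <= 1 + rho - n -> 1 <= 1 + rho + n ->
  (16 * d)^-1 <= ((1 + rho) ^+ 2 - n ^+ 2) / q ^+ 2.
Proof.
move=> d0 n0 q0 qd h h1; have d16 : 0 < 16 * d by lra.
rewrite ler_pdivlMr ?exprn_gt0// mulrC ler_pdivrMr// subr_sqr.
have q2 : q ^+ 2 <= (13 / 4 * d) ^+ 2.
  by rewrite lerXn2r ?nnegrE ?(ltW q0)//; apply: le_trans qd; exact: ltW.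
have hv : 7 / 8 * d <= (1 + rho - n) * (1 + rho + n).
  by apply: (le_trans h); rewrite ler_peMr//; lra.
have : 7 / 8 * d * (16 * d) <= (1 + rho - n) * (1 + rho + n) * (16 * d) by rewrite ler_pM2r.
have : 0 < d * d by rewrite mulr_gt0.
by move: q2; rewrite exprMn !expr2; lra.
Qed.

(** Only an arc of length d / 16 next to z / |z| is kept. There the weight is at least - ln d and
    the kernel at least 1 / (16 d), whence 256. *)
Lemma Re_weight_herg_ge z : normc z < 1 -> rdist E z < 1 ->
  - ln (rdist E z) / 256 <= complex.Re (H z).
Proof.
move=> z1 d1; have d0 := rdist_gt0 E_circle E0 z1; set d := rdist E z in d0 d1 *.
have zd := rdist_disc E_circle E0 z; rewrite -/d in zd.
have nz0 := normc_ge0 z.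
have zn : z != 0 by rewrite -normc_gt0; lra.
have [x x01 zx] := polar zn.
have e01 : 0 < d / 16 <= 1 by apply/andP; split; lra.
have [y [y0 y1 yx xy]] := short_arc x01 e01.
pose J : set (measurableTypeR R) := `[y, y + d / 16]%classic.
have mJ : measurable J by exact: measurable_itv.
have mI : measurable I by exact: measurable_itv.
have JI : J `<=` I by move=> t; rewrite /J /= !in_itv /= => t01; lra.
have outer1 (t : measurableTypeR R) : I t -> 1 <= normc (outer_point E t).
  by move=> _; rewrite normc_outer_point// lerDl rdist_ge0.
pose u (t : measurableTypeR R) : R := logweight E t *
  ((normc (outer_point E t) ^+ 2 - normc z ^+ 2) / normc (outer_point E t - z) ^+ 2).
have outer3 (t : measurableTypeR R) : I t -> normc (outer_point E t) <= 3.
  move=> _; rewrite normc_outer_point//.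
  by have := rdist_le2 E_circle E0 (expi t); rewrite normc_expi; lra.
have iu : mu.-integrable I (EFin \o u).
  exact: (poisson_integrable mI (cmeas_outer_point E0) outer1 outer3
    (logweight_integrable E_circle E0 E_carleson) (fun t _ => logweight_ge0 E_circle E0 t) z1).
have u0 t : I t -> 0 <= u t.
  move=> It; apply: mulr_ge0; first exact: logweight_ge0.
  exact: (poisson_kernel_ge0 outer1 z1 It).
have -> : complex.Re (H z) = \int[mu]_(t in I) u t by rewrite /weight_herg (Re_herg _ _ outer1 z1).
rewrite -lee_fin fineK; last exact: integrable_fin_num.
have mu_u : measurable_fun I (EFin \o u) by exact: measurable_int iu.
apply: (@le_trans _ _ (\int[mu]_(t in J) (EFin \o u) t)%E); last first.
  by apply: ge0_subset_integral => // t It; rewrite lee_fin u0.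
have l0 : 0 < - ln d by rewrite oppr_gt0 ln_lt0// d0.
pose k : R := - ln d / (16 * d).
have k0 : 0 <= k by rewrite divr_ge0 ?ltW// mulr_gt0.
apply: (@le_trans _ _ (\int[mu]_(t in J) k%:E)%E).
  have muJ : mu J = (d / 16)%:E.
    have yy : y <= y + d / 16 by lra.
    by have := measure_itvcc yy; rewrite addrAC subrr add0r => h; exact: h.
  have -> : (\int[mu]_(t in J) k%:E = k%:E * mu J)%E by exact: (integral_cst mu mJ k%:E).
  rewrite muJ -EFinM lee_fin /k le_eqVlt; apply/orP; left; apply/eqP; field.
  by rewrite gt_eqF.
(* Almost everywhere only: at distance 0 the weight is 0 by convention and the pointwise bound
   fails. *)
apply: ae_ge0_le_integral => //.
- by move=> t Jt; rewrite lee_fin; exact/u0/JI.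
- exact: measurable_funS mu_u.
have Hae := rdist_neq0_ae E_circle E0 E_carleson.
apply: filterS Hae => t Ht Jt; have dt0 := Ht (JI _ Jt).
have tx : normc (expi t - expi x) <= d / 8.
  apply: le_trans (normc_expiB _ _) _.
  have : `|t - x| <= d / 16.
    by move: Jt; rewrite /J /= in_itv /= => /andP[t1 t2]; rewrite ler_norml; lra.
  lra.
have zx1 : normc (expi x - z) = 1 - normc z.
  rewrite [in LHS]zx -{1}[expi x]mul1r -mulrBl -(rmorph1 (real_complex R)) -rmorphB.
  by rewrite normc_realM normc_expi mulr1 ger0_norm// subr_ge0 ltW.
have dtp : 0 < rdist E (expi t) by rewrite lt_neqAle eq_sym dt0 rdist_ge0.
have tz := normc_triangle (expi x) (expi t) z.
have dle := rdist_lip E0 (expi t) z; rewrite -/d in dle.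
have dge := rdist_lip E0 z (expi t); rewrite -/d (normcBC z) in dge.
have far := normc_triangle (expi t) (outer_point E t) z; rewrite outer_point_near// in far.
have na := normc_outer_point E0 t.
have near := normc_lerB (outer_point E t) z; rewrite na in near.
have d16 : 0 < 16 * d by rewrite mulr_gt0.
rewrite lee_fin /u /k; apply: ler_pM; [exact: ltW|by rewrite invr_ge0 ltW| |].
  rewrite /logweight -lnV ?posrE// ler_ln ?posrE ?invr_gt0 ?divr_gt0//.
  rewrite ler_pdivlMr// mulrC ler_pdivrMr//.
  move: tx tz dle; rewrite zx1; move: (rdist E (expi t)) (normc (expi t - z)) (normc (expi t - expi x)) => *; lra.
(* Since 1 - |z| <= d, expi t is within 9/8 d of [z]; the distance there is at most 17/8 d and the
   node is within 13/4 d of [z]. The 7/8 is 1 minus the 1/8 lost along the arc. *)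
rewrite na; apply: kernel_ratio_ge => //.
- by apply: lt_le_trans near; rewrite subr_gt0 ltr_wpDr// ltW.
- move: far tz dle tx zd; rewrite zx1.
  move: (normc (outer_point E t - z)) (normc (expi t - z)) (normc (expi t - expi x)) => *; lra.
- move: dge tz tx; rewrite zx1.
  move: (normc (expi t - z)) (normc (expi t - expi x)) (rdist E (expi t)) => *; lra.
- by rewrite -addrA lerDl addr_ge0// ltW.
Qed.

End WeightLowerBound.

Section Factors.
Context {R : realType}.
Implicit Types (r s t x y e : R) (z w : R[i]) (f g h : R[i] -> R[i]).
Local Notation mu := (@lebesgue_measure R).
Local Notation mu2 := (mu \x mu)%E.
Local Notation R2 := (measurableTypeR R * measurableTypeR R)%type.

Lemma disc_area_lty : (mu2 [set p : R2 | (normc (p2c p) < 1)%R] < +oo)%E.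
Proof.
pose J : set (measurableTypeR R) := `[(-1)%R, 1%R]%classic.
have mJ : measurable J by exact: measurable_itv.
apply: (@le_lt_trans _ _ (mu2 (J `*` J))).
  apply: le_measure; rewrite ?inE; [exact: measurable_p2c_ball|exact: (measurableX mJ mJ)|].
  move=> p /= p1; have := normc_Re (p2c p); have := normc_Im (p2c p).
  by split; rewrite /J /= in_itv /= -ler_norml /=; apply: ltW; apply: le_lt_trans p1.
have -> : (mu2 (J `*` J) = mu J * mu J)%E by exact: product_measure1E.
have le11 : -1 <= 1 :> R by lra.
by have := measure_itvcc le11 => h; rewrite [mu J]h -EFinM ltry.
Qed.

Lemma dirichlet_bounded g (M : R) : holo g ->
  (forall z, normc z < 1 -> normc (derive1 g z) <= M) -> dirichlet_space g.
Proof.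
move=> gh gM; split; first exact/analytic_holo.
pose D : set R2 := [set p | normc (p2c p) < 1].
have mD : measurable D by exact: measurable_p2c_ball.
have DE : [set p : R * R | disc (p.1 +i* p.2)] = D by apply/seteqP; split => p /discE.
rewrite /dirichlet_integral DE.
have le : (\int[mu2]_(p in D) (normc (derive1 g (p2c p)) ^+ 2)%:E <= (M ^+ 2)%:E * mu2 D)%E.
  apply: (@le_trans _ _ (\int[mu2]_(p in D) (M ^+ 2)%:E)%E).
    apply: ge0_le_integral => //.
    - by move=> p _; rewrite lee_fin sqr_ge0.
    - by apply/measurable_EFinP/measurable_sqr_normc/cmeas_holo/holo_derive1.
    move=> p Dp; rewrite lee_fin lerXn2r ?nnegrE ?normc_ge0 ?gM//.
    exact: le_trans (normc_ge0 _) (gM _ Dp).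
  by rewrite (integral_cst mu2 mD (M ^+ 2)%:E).
have fin : ((M ^+ 2)%:E * mu2 D < +oo)%E.
  by apply: lte_mul_pinfty; rewrite ?lee_fin ?sqr_ge0//; exact: disc_area_lty.
have := le_lt_trans le fin.
have : (0 <= \int[mu2]_(p in D) (normc (derive1 g (p2c p)) ^+ 2)%:E)%E.
  by apply: integral_ge0 => p _; rewrite lee_fin sqr_ge0.
move=> i0 ioo; apply: lte_mul_pinfty => //.
by rewrite lee_fin invr_ge0 pi_ge0.
Qed.

Lemma hardy2_le1 h : holo h -> (forall z, normc z < 1 -> normc (h z) <= 1) -> hardy2 h.
Proof.
move=> hh h1; split; first exact/analytic_holo.
apply: (@le_lt_trans _ _ 1%:E); last exact: ltry.
apply: ge_ereal_sup => _ [r /= r01 <-]; have /andP[r0 r1] := r01.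
have nz t : normc (r%:C * expi t : R[i]) < 1 by rewrite normc_circle ger0_norm.
have hc t : cont_at (fun t => normc (h (r%:C * expi t)) ^+ 2) t.
  apply: cont_sqr_normc; apply: cont_on_circle => z zr.
  by apply: holo_cont => //; rewrite zr ger0_norm.
pose u t := normc (h (r%:C * expi t)) ^+ 2.
have ih : mu.-integrable `[0, 2 * pi] (EFin \o u) by exact: rint_integrable.
rewrite /hardy_mean -[X in (_ * X)%E](fineK (integrable_fin_num _ ih))// -[fine _]/(rint u).
rewrite -EFinM lee_fin ler_pdivrMl ?pi2_gt0// mulr1 -[leRHS]mulr1 -rint_cst.
apply: le_rint => // t; first exact: rcont_cst.
by rewrite exprn_ile1 ?normc_ge0// h1.
Qed.

(** The derivatives of the inner function and of the Herglotz integral are both O(d^-2), d the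
    distance to [E], and [F] is at most d^2. Being an exponential, [F] has no zeros, and it is
    bounded by 1, so it is also the cofactor in the Hardy space. *)
Lemma carleson_factor (E : set R[i]) (m : {finite_measure set (borelC R) -> \bar R}) :
  compact E -> E `<=` circle -> E !=set0 ->
  (\int[mu]_(t in `[0%R, (2 * pi)%R]) lne ((dist (expi t) E)^-1) < +oo)%E ->
  supported_on m E -> is_factor (singular_inner m).
Proof.
move=> cE Ec E0 car mE.
(* Twice the 256 of [Re_weight_herg_ge], which gives |F| <= d^2; the equation keeps the numeral out
   of later computations. *)
have [N N512] : exists N : R, N = 512 by exists 512.
have N0 : 0 <= N by rewrite N512 ler0n.
pose F z := expC ((- N)%:C * weight_herg E z).
have nF z : normc (F z) = expR (- N * complex.Re (weight_herg E z)).
  rewrite normc_expC; congr expR.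
  by case: (weight_herg E z) => a b /=; ring.
have [C C0 HC] := weight_herg_derive Ec E0 car.
have F1 z : normc z < 1 -> normc (F z) <= 1.
  move=> z1; rewrite nF -[leRHS]expR0 ler_expR.
  by rewrite mulNr oppr_le0 mulr_ge0// Re_weight_herg_ge0.
have Fd z : normc z < 1 -> normc (F z) <= rdist E z ^+ 2.
  move=> z1; have d0 := rdist_gt0 Ec E0 z1.
  have [d1|d1] := leP 1 (rdist E z); first by apply: le_trans (F1 z z1) _; rewrite exprn_ege1.
  rewrite nF -[leRHS]lnK ?posrE ?exprn_gt0// ler_expR lnXn//.
  by have := Re_weight_herg_ge Ec E0 car z1 d1; rewrite N512 mulr2n; lra.
have Fl z : normc z < 1 -> exists2 l, cdiff F z l & normc l <= N * C.
  move=> z1; have d0 := rdist_gt0 Ec E0 z1; have [l hl lC] := HC z z1.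
  exists (F z * ((- N)%:C * l)); first exact: cdiff_comp (cdiffZ _ hl) (cdiff_expC _).
  rewrite (normcM (F z)) (normcM (- N)%:C) normc_real normrN (ger0_norm N0).
  apply: (@le_trans _ _ (rdist E z ^+ 2 * (N * (C / rdist E z ^+ 2)))).
    apply: ler_pM; [exact: normc_ge0| |exact: Fd|exact: ler_wpM2l].
    by apply: mulr_ge0 => //; exact: normc_ge0.
  by rewrite le_eqVlt; apply/orP; left; apply/eqP; field; rewrite gt_eqF.
have Fh : holo F by move=> z /Fl[l hl _]; exists l.
have Sh := holo_singular_inner cE Ec mE.
have Sl z : normc z < 1 -> exists2 l, cdiff (singular_inner m) z l &
    normc l <= 16 * fine (m E) / rdist E z ^+ 2.
  move=> z1; have d0 := rdist_gt0 Ec E0 z1.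
  have e0 : 0 < rdist E z / 2 by rewrite divr_gt0.
  have far w : E w -> 2 * (rdist E z / 2) <= normc (w - z).
    by move=> Ew; rewrite normcBC; have := rdist_le E0 z Ew; lra.
  have [l hl lC] := sherg_derive_le m cE Ec z1 e0 far.
  exists (singular_inner m z * - l); first exact: (cdiff_singular_inner cE Ec mE z1 hl).
  rewrite (normcM (singular_inner m z)) normcN.
  apply: (@le_trans _ _ (1 * normc l)).
    by rewrite ler_wpM2r ?normc_ge0// (normc_singular_inner_le1 cE Ec mE).
  rewrite mul1r; apply: le_trans lC _.
  by rewrite le_eqVlt; apply/orP; left; apply/eqP; field; rewrite gt_eqF.
pose g z := singular_inner m z * F z.
have gl z : normc z < 1 -> exists2 l, cdiff g z l & normc l <= 16 * fine (m E) + N * C.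
  move=> z1; have d0 := rdist_gt0 Ec E0 z1.
  have [l hl lC] := Sl z z1; have [k hk kC] := Fl z z1.
  eexists; first exact: cdiffM hl hk.
  apply: le_trans (normcD _ _) _; rewrite (normcM l) (normcM (singular_inner m z)); apply: lerD.
    apply: (@le_trans _ _ (16 * fine (m E) / rdist E z ^+ 2 * rdist E z ^+ 2)).
      by apply: ler_pM => //; [exact: normc_ge0|exact: normc_ge0|exact: Fd].
    by rewrite divfK// expf_neq0// gt_eqF.
  apply: le_trans kC; rewrite ler_piMl ?normc_ge0//.
  exact: (normc_singular_inner_le1 cE Ec mE).
exists g; split.
- apply: (@dirichlet_bounded g (16 * fine (m E) + N * C)).
    by move=> z /gl[l hl _]; exists l.
  by move=> z /gl[l hl lC]; rewrite (cdiff_derive1 hl).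
- have n0 : normc (0 : R[i]) < 1 by rewrite normc0.
  exists 0; first exact/discE.
  by apply: mulf_neq0; [rewrite (singular_innerE cE Ec mE)//|]; exact: expC_neq0.
- by exists F => //; exact: hardy2_le1.
Qed.

(** Integrals over the empty set vanish, so the inner function is 1 on the disc and the constant 1
    is the witness. *)
Lemma null_factor (m : {finite_measure set (borelC R) -> \bar R}) :
  supported_on m (set0 : set R[i]) -> is_factor (singular_inner m).
Proof.
move=> m0; have S1 z : normc z < 1 -> singular_inner m z = 1.
  move=> z1; rewrite (singular_innerE (@compact0 _) (@sub0set _ _) m0)//.
  by rewrite /sherg /herg /cint !Rintegral_set0 (_ : _ +i* _ = 0)// oppr0 expC0.
have h1 : holo (fun=> 1 : R[i]) by move=> z _; exists 0; exact: cdiff_cst.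
have n1 : normc (1 : R[i]) = 1 by rewrite -(rmorph1 (real_complex R)) normc_real normr1.
exists (fun=> 1); split.
- apply: (@dirichlet_bounded _ 0) => // z _.
  by rewrite (cdiff_derive1 (cdiff_cst 1 z)) normc0.
- exists 0; last exact: oner_neq0.
  by apply/discE; rewrite normc0.
- exists (fun=> 1); first by apply: hardy2_le1 => // z _; rewrite n1.
  by move=> z /discE z1; rewrite S1// mulr1.
Qed.

End Factors.

Theorem proposition1p8 (R : realType) (E : set R[i])
    (E_compact : compact E) (E_circle : E `<=` circle) :
  (forall mu : {finite_measure set (borelC R) -> \bar R},
     supported_on mu circle -> singular mu -> supported_on mu E ->
     is_factor (singular_inner mu)) <->
  carleson_set E.
Proof.
split=> [|[_ _ E_carleson] mu _ _ muE]; first exact: factors_carleson.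
(* For the empty set [rdist] is a default value and not a distance, so this case is separate. *)
have [E0|/set0P E0] := eqVneq E set0; first by apply: null_factor; rewrite -E0.
exact: carleson_factor E_carleson muE.
Qed.
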